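(* Fix $0<\gamma<1$. In the density estimation model let $s_{\min}\in(0,s_{\max}]$, or in the regression model let $s_{\min}\in[\tfrac12,s_{\max}]$. Set $$r_n(s):=(n/\log n)^{-s/(2s+1)},\qquad \mathcal F:=\bigcup_{s\in[s_{\min},s_{\max}],\,M>0}C^s_0(M)$$ (where in the density estimation model all suprema over $f$ below are restricted to those $f$ that are probability densities on $[0,1]$). In either model there exist confidence bands $C_n=\{g\in C([0,1]):\|g-\hat f_n\|_\infty\le R_n\}$, with centre $\hat f_n$ and radius $R_n$ depending only on the data and the fixed parameters (not on $f$, $s$ or $M$), such that: (i) $\limsup_n\sup_{f\in\mathcal F}\mathbb P_f(f\notin C_n)\le\gamma$; and (ii) for any $s\in[s_{\min},s_{\max}]$ and $M>0$ there is a constant $L=L(s,M)>0$ such that $$\sup_{f\in C^s_0(M)}\mathbb P_f\left(R_n>\frac{L\,M^{1/(2s+1)}}{2^s-1}\,r_n(s)\right)\to0\quad\text{as }n\to\infty.$$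
   Context: Density estimation model: $f$ is a probability density on $[0,1]$ and one observes $X_1,\dots,X_n$ i.i.d. with density $f$. Regression model: $f:[0,1]\to\mathbb R$ and one observes $Y_i=f(x_i)+\varepsilon_i$, $x_i=i/n$, $i=1,\dots,n$, with $\varepsilon_i$ i.i.d. $N(0,\sigma^2)$, $\sigma>0$ fixed. $\mathbb P_f$ is the law of the data, and $\|\cdot\|_\infty$ is the supremum norm on $[0,1]$. Wavelet basis: $\varphi,\psi$ are the scaling function and wavelet of an orthonormal multiresolution analysis of $L^2(\mathbb R)$ such that, for some $K,N\in\mathbb N$: $\varphi,\psi$ are supported in $[1-K,K]$; $\int x^i\psi(x)\,dx=0$ for $i=0,\dots,N-1$; $\varphi$ is twice continuously differentiable. Moreover the 1-periodic function $\sigma_\varphi^2(t):=\sum_{k\in\mathbb Z}\varphi(t-k)^2$ attains its maximum at a unique point $t_0\in[0,1)$, and $(\sigma_\varphi^2)''(t_0)<0$. From these, the Cohen–Daubechies–Vial boundary-corrected construction gives an orthonormal basis of $L^2([0,1])$ consisting of $\varphi_{j_0,k}$, $0\le k<2^{j_0}$, and $\psi_{j,k}$, $j\ge j_0$, $0\le k<2^j$, for a suitable fixed coarsest level $j_0>0$. For $k\in[N,2^j-N)$ the functions are $\varphi_{j_0,k}(x)=2^{j_0/2}\varphi(2^{j_0}x-k)$ and $\psi_{j,k}(x)=2^{j/2}\psi(2^jx-k)$; for the other $k$ they are the boundary functions of that construction. For $f=\sum_k\alpha_k\varphi_{j_0,k}+\sum_{j\ge j_0}\sum_k\beta_{j,k}\psi_{j,k}\in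 L^2([0,1])$ and $s\in(0,N)$ put $\|f\|_{C^s}:=\max\big(\sup_k|\alpha_k|,\ \sup_{j,k}2^{j(s+1/2)}|\beta_{j,k}|\big)$ and $C^s(M):=\{f\in L^2([0,1]):\|f\|_{C^s}\le M\}$. Such $f$ are identified with their continuous versions. Set $f_{i,j}:=\sum_{l=i}^j\sum_k\beta_{l,k}\psi_{l,k}$ for $i>j_0$, and $f_{j_0,j}:=\sum_k\alpha_k\varphi_{j_0,k}+\sum_{l=j_0}^j\sum_k\beta_{l,k}\psi_{l,k}$. Self-similar functions: fix $s_{\max}\in(0,N)$, $\varepsilon\in(0,1)$, $\rho\in\mathbb N$. For $s\in(0,s_{\max})$, $M>0$, $C^s_0(M)=C^s_0(M,\varepsilon,\rho)$ is the set of $f\in C^s(M)$ with $\|f_{j,\rho j}\|_{C^s}\ge\varepsilon M$ for all $j\ge j_0$. For $s=s_{\max}$, $C^{s_{\max}}_0(M)$ is the set of $f\in C^{s_{\max}}(M)$ for which this inequality holds for $j=j_0$ only. *)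

(* Defs.v *)
From HB Require Import structures.
From mathcomp Require Import all_boot all_order all_algebra.
From mathcomp Require Import all_classical all_reals all_analysis.
From mathcomp Require Import measurable_realfun.

Set Implicit Arguments.
Unset Strict Implicit.
Unset Printing Implicit Defensive.

Import Order.TTheory GRing.Theory Num.Theory.
Import numFieldNormedType.Exports.

Local Open Scope classical_set_scope.
Local Open Scope ring_scope.

Section L2.
Context {R : realType}.
Implicit Types (D : set R) (f g : R -> R).
Local Notation mu := (@lebesgue_measure R).

(* Elements of L^2(D) are represented by functions R -> R; only their values
   on D matter. *)
Definition L2 D f : Prop := f \_ D \in Lfun mu 2%:E.

Definition L2dot D f g : R := \int[mu]_(x in D) (f x * g x).

Definition L2norm D f : \bar R := 'N[mu]_2%:E[EFin \o (f \_ D)].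

Definition lincomb (I : Type) (e : I -> R -> R) (s : seq (R * I)) : R -> R :=
  fun x => \sum_(ci <- s) ci.1 * e ci.2 x.

Definition closed_span D (I : eqType) (A : set I) (e : I -> R -> R) :
    set (R -> R) :=
  [set f | L2 D f /\ forall d : R, 0 < d ->
    exists2 s : seq (R * I), (forall i, i \in unzip2 s -> A i) &
      (L2norm D (f \- lincomb e s)%R < d%:E)%E].

Definition orthonormal D (I : eqType) (A : set I) (e : I -> R -> R) : Prop :=
  (forall i, A i -> L2 D (e i)) /\
  (forall i j, A i -> A j -> L2dot D (e i) (e j) = (i == j)%:R).

Definition orthonormal_basis D (V : set (R -> R)) (I : eqType) (A : set I)
    (e : I -> R -> R) : Prop :=
  [/\ orthonormal D A e, (forall i, A i -> V (e i)) &
      V `<=` closed_span D A e].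

End L2.

Section multiresolution.
Context {R : realType}.
Implicit Types (phi psi : R -> R).

Definition dil (j k : int) (g : R -> R) : R -> R :=
  fun x => 2 `^ (j%:~R / 2) * g (2 ^ j * x - k%:~R).

Definition mra_space phi (j : int) : set (R -> R) :=
  closed_span [set: R] [set: int] (fun k => dil j k phi).

(* The scaling relation f \in V_j <-> f (2 .) \in V_(j+1) is built into
   mra_space. *)
Definition orthonormal_mra phi psi : Prop :=
  [/\ orthonormal [set: R] [set: int] (fun k => dil 0 k phi),
      (forall j, mra_space phi j `<=` mra_space phi (j + 1)),
      (forall f, (forall j, mra_space phi j f) ->
         L2norm [set: R] f = 0%E),
      (forall f, L2 [set: R] f -> forall d : R, 0 < d ->
         exists j, exists2 g, mra_space phi j g &
           (L2norm [set: R] (f \- g)%R < d%:E)%E) &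
      orthonormal_basis [set: R]
        [set f | mra_space phi 1 f /\
           forall g, mra_space phi 0 g -> L2dot [set: R] f g = 0]
        [set: int] (fun k => dil 0 k psi)].

(* The sum has finitely many nonzero terms when phi has compact support. *)
Definition sigma2 phi (t : R) : R :=
  \sum_(k \in [set: int]) (phi (t - k%:~R)) ^+ 2.

Definition C2 (g : R -> R) : Prop :=
  [/\ (forall x, derivable g x 1), (forall x, derivable (derive1 g) x 1) &
      continuous (derive1n 2 g)].

Definition supported_in (a b : R) (g : R -> R) : Prop :=
  forall x, g x != 0 -> a <= x <= b.

End multiresolution.

(* phi, psi generate the multiresolution analysis of L^2(R); phiL k, phiR k,
   psiL k, psiR k (k < N) are the boundary functions of the half-lines
   [0, +oo[ and ]-oo, 0]. *)
Record wavelet_system (R : realType) := WaveletSystem {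
  wK : nat ;
  wN : nat ;
  wj0 : nat ;
  phi : R -> R ;
  psi : R -> R ;
  phiL : nat -> R -> R ;
  phiR : nat -> R -> R ;
  psiL : nat -> R -> R ;
  psiR : nat -> R -> R }.

Section interval_wavelets.
Context {R : realType} (W : wavelet_system R).
Local Notation K := (wK W).
Local Notation N := (wN W).
Local Notation j0 := (wj0 W).
Local Notation mu := (@lebesgue_measure R).
Local Notation I01 := (`[0, 1]%classic : set R).

Definition mother_assumptions : Prop :=
  [/\ orthonormal_mra (phi W) (psi W),
      supported_in (1 - K%:R) K%:R (phi W) /\
      supported_in (1 - K%:R) K%:R (psi W),
      (forall i, (i < N)%N -> \int[mu]_x (x ^+ i * psi W x) = 0),
      C2 (phi W) &
      exists t0 : R,
        [/\ 0 <= t0 < 1,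
            (forall t, 0 <= t < 1 -> t != t0 ->
               sigma2 (phi W) t < sigma2 (phi W) t0) &
            derive1n 2 (sigma2 (phi W)) t0 < 0]].

(* Cohen, Daubechies and Vial, Wavelets on the interval and fast wavelet
   transforms (1993): the non-orthogonalised edge functions on [0, +oo[ are
   phi~_k (x) = \sum_(n = k)^(2N - 2) 'C(n, k) phi (x + n - N + 1), k < N, for
   phi supported in [1 - N, N]. The terms with n < k vanish, and for support
   [1 - K, K] the translates that meet [0, +oo[ are those with n <= N + K - 2.
   The right edge is the mirror image under x -> - x, phi -> phi (1 - .). *)
Definition edgeL (k : nat) (x : R) : R :=
  \sum_(0 <= n < (N + K).-1) 'C(n, k)%:R * phi W (x + n%:R - N%:R + 1).

Definition edgeR (k : nat) (x : R) : R :=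
  \sum_(0 <= n < (N + K).-1) 'C(n, k)%:R * phi W (x + N%:R - n%:R).

(* Boundary scaling functions: Gram-Schmidt applied to phi~_(N-1), ...,
   phi~_0 in this order (orthonormality is part of cdv_system below).
   Boundary wavelets: they satisfy the two-scale relations below and, being
   orthonormal together with all the other basis functions, complete the
   interior wavelets to an orthonormal basis of V_(j+1) minus V_j. Such a
   completion is unique only up to an orthogonal N x N matrix at each edge;
   any choice is allowed. *)
Definition cdv_boundary : Prop :=
  forall k, (k < N)%N ->
  [/\ exists c : nat -> R, forall x, 0 <= x ->
        phiL W k x = \sum_(k <= l < N) c l * edgeL l x,
      exists c : nat -> R, forall x, x <= 0 ->
        phiR W k x = \sum_(k <= l < N) c l * edgeR l x,
      exists c d : nat -> R, forall x, 0 <= x ->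
        psiL W k x = \sum_(0 <= l < N) c l * phiL W l (2 * x)
          + \sum_(N <= m < (2 * N + K).-1) d m * phi W (2 * x - m%:R) &
      exists c d : nat -> R, forall x, x <= 0 ->
        psiR W k x = \sum_(0 <= l < N) c l * phiR W l (2 * x)
          + \sum_(N <= m < (2 * N + K).-1) d m * phi W (2 * x + m%:R + 1)].

Definition interval_fun (g : R -> R) (gL gR : nat -> R -> R) (j k : nat) :
    R -> R := fun x =>
  if (k < N)%N then 2 `^ (j%:R / 2) * gL k (2 ^+ j * x)
  else if (k < 2 ^ j - N)%N then dil j k g x
  else 2 `^ (j%:R / 2) * gR (2 ^ j - k.+1)%N (2 ^+ j * (x - 1)).

Definition phi_ (k : nat) : R -> R :=
  interval_fun (phi W) (phiL W) (phiR W) j0 k.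

Definition psi_ (j k : nat) : R -> R :=
  interval_fun (psi W) (psiL W) (psiR W) j k.

(* inl k stands for phi_(j0,k), inr (j, k) for psi_(j,k). *)
Definition basis_fun (i : nat + nat * nat) : R -> R :=
  match i with inl k => phi_ k | inr jk => psi_ jk.1 jk.2 end.

Definition basis_idx : set (nat + nat * nat) :=
  [set i | match i with
           | inl k => (k < 2 ^ j0)%N
           | inr jk => ((j0 <= jk.1) && (jk.2 < 2 ^ jk.1))%N
           end].

Definition cdv_system : Prop :=
  [/\ mother_assumptions, (0 < j0)%N, (2 * N <= 2 ^ j0)%N, cdv_boundary &
      orthonormal_basis I01 (L2 I01) basis_idx basis_fun].

Definition alpha (f : R -> R) (k : nat) : R := L2dot I01 f (phi_ k).

Definition beta (f : R -> R) (j k : nat) : R := L2dot I01 f (psi_ j k).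

Definition Cs_norm (s : R) (f : R -> R) : \bar R :=
  maxe
    (ereal_sup [set `|alpha f k|%:E | k in [set k | (k < 2 ^ j0)%N]])
    (ereal_sup [set (2 `^ (jk.1%:R * (s + 1 / 2)) * `|beta f jk.1 jk.2|)%:E |
       jk in [set jk : nat * nat | ((j0 <= jk.1) && (jk.2 < 2 ^ jk.1))%N]]).

Definition Cs (s M : R) : set (R -> R) :=
  [set f | [/\ L2 I01 f, {within I01, continuous f} &
               (Cs_norm s f <= M%:E)%E]].

Definition block (f : R -> R) (i j : nat) : R -> R := fun x =>
  (if i == j0 then \sum_(0 <= k < 2 ^ j0) alpha f k * phi_ k x else 0)
  + \sum_(i <= l < j.+1) \sum_(0 <= k < 2 ^ l) beta f l k * psi_ l k x.

Definition self_similar (smax eps : R) (rho : nat) (s M : R) : set (R -> R) :=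
  [set f | Cs s M f /\
     forall j, (j0 <= j)%N -> s < smax \/ j = j0 ->
       ((eps * M)%:E <= Cs_norm s (block f j (rho * j)))%E].

End interval_wavelets.

Section product_law.
Context d (T : measurableType d) (R : realType).

Definition tcons (n : nat) (p : T * n.-tuple T) : n.+1.-tuple T :=
  [the n.+1.-tuple T of p.1 :: p.2].

Let measurable_tcons n : measurable_fun [set: T * n.-tuple T] (@tcons n).
Proof. exact: measurable_cons. Qed.

HB.instance Definition _ n :=
  isMeasurableFun.Build _ _ _ _ (@tcons n) (@measurable_tcons n).

Fixpoint iid_law (P : probability T R) (n : nat) :
    probability (n.-tuple T) R :=
  match n with
  | 0 => \d_([tuple] : 0.-tuple T)
  | n'.+1 => distribution (P \x iid_law P n')%E (@tcons n')
  end.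

End product_law.

Section density_model.
Context {R : realType}.
Local Notation mu := (@lebesgue_measure R).
Local Notation I01 := (`[0, 1]%classic : set R).

Definition is_density : set (R -> R) :=
  [set f : R -> R | [/\ measurable_fun I01 f, (forall x, I01 x -> 0 <= f x) &
               (\int[mu]_(x in I01) (f x)%:E = 1)%E]].

(* The law on R with density f on [0, 1]; the uniform law is a dummy value for
   functions f that are not densities. *)
Definition density_pdf (f : R -> R) : R -> R :=
  if `[< is_density f >] then f \_ I01 else \1_I01.

Definition density_law (f : R -> R) (A : set (measurableTypeR R)) : \bar R :=
  (\int[mu]_(x in A) (density_pdf f x)%:E)%E.

Let mI01 : measurable I01. Proof. exact: measurable_itv. Qed.

Let density_pdf_ge0 f x : 0 <= density_pdf f x.
Proof.
rewrite /density_pdf; case: asboolP => [[_ f0 _]|_].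
  by rewrite patchE; case: ifPn => // /set_mem; exact: f0.
by rewrite indicE ler0n.
Qed.

Let measurable_density_pdf f : measurable_fun [set: R] (density_pdf f).
Proof.
rewrite /density_pdf; case: asboolP => [[mf _ _]|_].
  exact/(measurable_restrictT f mI01).
exact: measurable_indic.
Qed.

Let density_law0 f : density_law f set0 = 0%E.
Proof. exact: integral_set0. Qed.

Let density_law_ge0 f A : (0 <= density_law f A)%E.
Proof. by apply: integral_ge0 => x _; rewrite lee_fin. Qed.

Let density_law_sigma_additive f : semi_sigma_additive (density_law f).
Proof.
move=> /= F mF tF mUF; rewrite /density_law; apply: cvg_toP.
  by apply: (@is_cvg_ereal_nneg_natsum R _ 0) => n _; exact: density_law_ge0.
rewrite ge0_integral_bigcup//=.
- by apply: measurable_funTS; apply/measurable_EFinP; exact: measurable_density_pdf.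
- by move=> x Fx; rewrite lee_fin; exact: density_pdf_ge0.
Qed.

HB.instance Definition _ f := isMeasure.Build _ _ _ (density_law f)
  (density_law0 f) (density_law_ge0 f) (@density_law_sigma_additive f).

Let density_law_setT f : density_law f [set: _] = 1%E.
Proof.
rewrite /density_law /density_pdf; case: asboolP => [[_ _ <-]|_].
  rewrite [RHS]integral_mkcond; apply: eq_integral => x _.
  by rewrite !patchE; case: ifP.
rewrite integral_indic// setIT [LHS](lebesgue_measure_itv `[0, 1])/= lte01.
by rewrite -EFinD subr0.
Qed.

HB.instance Definition _ f := @Measure_isProbability.Build _ _ R
  (density_law f) (density_law_setT f).

End density_model.

Section regression_model.
Context {R : realType}.

(* The i-th component, i < n, is the observation at x_(i+1) = (i + 1) / n. *)
Definition regression_data (n : nat) (f : R -> R) (e : n.-tuple (measurableTypeR R)) :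
    n.-tuple (measurableTypeR R) :=
  [tuple f (i.+1%:R / n%:R) + tnth e i | i < n].

Let measurable_regression_data n f :
  measurable_fun [set: n.-tuple (measurableTypeR R)] (@regression_data n f).
Proof.
apply/measurable_fun_tnthP => i.
rewrite (_ : _ \o _ = (fun e => f (i.+1%:R / n%:R) + tnth e i)).
  by apply: measurable_funD => //; exact: measurable_tnth.
by apply/funext => e /=; rewrite tnth_mktuple.
Qed.

HB.instance Definition _ n f := isMeasurableFun.Build _ _ _ _
  (@regression_data n f) (@measurable_regression_data n f).

End regression_model.

(* Regression carries the standard deviation of the noise. *)
Inductive model (R : realType) := Density | Regression of R.
Arguments Density {R}.

Section bands.
Context {R : realType}.
Local Notation I01 := (`[0, 1]%classic : set R).

Definition data_law (m : model R) (f : R -> R) (n : nat) :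
    probability (n.-tuple (measurableTypeR R)) R :=
  match m with
  | Density => iid_law (density_law f) n
  | Regression sigma =>
      distribution (iid_law (normal_prob 0 sigma) n) (@regression_data R n f)
  end.

Definition in_model (m : model R) : set (R -> R) :=
  match m with Density => is_density | Regression _ => [set: R -> R] end.

Definition model_ok (m : model R) (smin : R) : Prop :=
  match m with
  | Density => 0 < smin
  | Regression sigma => 0 < sigma /\ 1 / 2 <= smin
  end.

Definition sup_norm (g : R -> R) : \bar R :=
  ereal_sup [set `|g x|%:E | x in I01].

Definition band (fhat : R -> R) (r : R) : set (R -> R) :=
  [set g | {within I01, continuous g} /\
           (sup_norm (g \- fhat)%R <= r%:E)%E].

(* fhat n is a random element of C([0, 1]) and rad n a real random variable,
   both functions of the data. *)
Definition estimators (fhat : forall n, n.-tuple R -> R -> R)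
    (rad : forall n, n.-tuple R -> R) : Prop :=
  forall n, [/\ measurable_fun [set: n.-tuple (measurableTypeR R)] (rad n),
    (forall x, I01 x ->
       measurable_fun [set: n.-tuple (measurableTypeR R)] (fun y => fhat n y x)) &
    (forall y, {within I01, continuous (fhat n y)})].

(* Supremum of probabilities; it is 0, not -oo, over an empty class. *)
Definition sup_prob (F : set (R -> R)) (p : (R -> R) -> \bar R) : \bar R :=
  maxe 0%E (ereal_sup (p @` F)).

Definition rate (s : R) (n : nat) : R :=
  (n%:R / ln n%:R) `^ (- s / (2 * s + 1)).

End bands.

(* Main.v *)
(* Proof idea. Since gamma is only an upper bound, the band may be conservative,
   and it suffices to control all empirical coefficients at once. Put
   tau = sqrt (ln n / n). By Bernstein's inequality (density) or a Gaussian tail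
   bound (regression, where smin >= 1/2 makes the discretisation bias of order
   M n^(-1/2)), every coefficient below the finest level 2^J = tau^(-1/(smin+1/2))
   is estimated up to C (1 + M) tau, outside an event of probability O(1/n),
   uniformly in f. Self-similarity at the coarsest level makes the largest low
   level coefficient comparable to M, hence gives an honest upper bound Mhat of M
   and a lower bound Mlow. To choose the level J at which the series is
   truncated, note that if 2^(-J(s+1/2)) > tau, then self-similarity yields in
   each window [j, rho j] a coefficient of level l larger than eps M tau^(l/J);
   so a window in which no estimated coefficient is that large certifies
   2^(-J(s+1/2)) <= tau, i.e. that the bias at level J is at most of the order of
   the stochastic error. Truncating at the first certified level gives coverage
   with radius C (1 + Mhat) tau 2^(J/2); conversely the window around
   j = J(s)/(2 rho), with 2^(-J(s)(s+1/2)) ~ tau, certifies level J(s) + O(1), which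
   gives the rate tau^(2s/(2s+1)). *)

Require Import Defs.
From HB Require Import structures.
From mathcomp Require Import all_boot all_order all_algebra.
From mathcomp Require Import all_classical all_reals all_analysis.
From mathcomp Require Import measurable_realfun ring lra zify.

Set Implicit Arguments.
Unset Strict Implicit.
Unset Printing Implicit Defensive.

Import Order.TTheory GRing.Theory Num.Theory.
Import numFieldNormedType.Exports.

Local Open Scope classical_set_scope.
Local Open Scope ring_scope.

(** * Square-integrable functions and orthonormal systems *)

(** Coverage must hold for all M > 0 from one threshold on n, while the estimation error grows with
    M. Errors are therefore measured in units of (1 + M) tau, and the condition [large] on n
    mentions neither M nor f; only the rate, where M is fixed, may wait for an n depending on M. At
    s = smax self-similarity is assumed at the coarsest level alone, so later windows certify
    nothing there. The search for a truncation level hence starts at [level smax n], where functions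
    of smoothness smax are already below the noise.

    Two obstacles come from L^2. The wavelet psi is controlled only up to null sets, whereas centres
    must be continuous; but psi lies in V_1 and has compact support, so it agrees almost everywhere
    with a finite combination of translates of phi(2 x), and this version enters the estimators.
    Likewise the wavelet series of f converges a priori only in L^2, and pointwise bias bounds are
    recovered from the continuity of f.

    Probability enters only through the event that all coefficients are close to the true ones; on
    it, coverage and rate are deterministic statements about arbitrary arrays [th]. *)

Section L2_space.
Context {R : realType}.
Local Notation mu := (@lebesgue_measure R).
Implicit Types (D : set R) (f g h : R -> R).

Lemma L2_measurable D f : measurable D -> L2 D f -> measurable_fun D f.
Proof.
move=> mD /andP[]; rewrite inE => mf _.
by apply/(measurable_restrictT f mD).
Qed.

Lemma L2_integrableM D f g : measurable D -> L2 D f -> L2 D g ->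
  mu.-integrable D (EFin \o (fun x => f x * g x)).
Proof.
move=> mD Lf Lg; have /Lfun1_integrable := Lfun2_mul_Lfun1 Lf Lg.
rewrite (_ : EFin \o _ = (EFin \o (fun x => f x * g x)) \_ D).
  by move=> ?; apply/integrable_mkcond.
apply/funext => x /=; rewrite !patchE; case: ifP => // _.
by rewrite mulr0.
Qed.

Lemma L2D D f g : L2 D f -> L2 D g -> L2 D (fun x => f x + g x).
Proof.
move=> Lf Lg; rewrite /L2 (_ : _ \_ D = f \_ D + g \_ D).
  by apply: rpredD; [rewrite lee_fin ler1n|move=> ?; exact: Lf|move=> ?; exact: Lg].
by apply/funext => x; rewrite fctE !patchE; case: ifP => // _; rewrite addr0.
Qed.

Lemma L2Z D f (a : R) : L2 D f -> L2 D (fun x => a * f x).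
Proof.
move=> Lf; rewrite /L2 (_ : _ \_ D = a *: f \_ D).
  by apply: rpredZ; [rewrite lee_fin ler1n|move=> ?; exact: Lf].
apply/funext => x; rewrite fctE !patchE; case: ifP => // _.
by rewrite scaler0.
Qed.

Lemma L20 D : L2 D (fun=> 0).
Proof.
rewrite /L2 (_ : _ \_ D = 0); first by apply: rpred0; rewrite lee_fin ler1n.
by apply/funext => x; rewrite patchE; case: ifP.
Qed.

Lemma L2B D f g : L2 D f -> L2 D g -> L2 D (fun x => f x - g x).
Proof.
move=> Lf Lg; rewrite (_ : (fun x => _) = (fun x => f x + (-1) * g x)).
  by apply: L2D => //; exact: L2Z.
by apply/funext => x; rewrite mulN1r.
Qed.

Lemma L2_sum D (I : eqType) (s : seq I) (F : I -> R -> R) :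
  (forall i, i \in s -> L2 D (F i)) -> L2 D (fun x => \sum_(i <- s) F i x).
Proof.
elim: s => [|i s ih] LF.
  by under eq_fun do rewrite big_nil; exact: L20.
under eq_fun do rewrite big_cons; apply: L2D; first by apply: LF; rewrite mem_head.
by apply: ih => j js; apply: LF; rewrite in_cons js orbT.
Qed.

Lemma L2dotC D f g : L2dot D f g = L2dot D g f.
Proof. by apply: eq_Rintegral => x _; rewrite mulrC. Qed.

Lemma L2dotDl D f g h : measurable D -> L2 D f -> L2 D g -> L2 D h ->
  L2dot D (fun x => f x + g x) h = L2dot D f h + L2dot D g h.
Proof.
move=> mD Lf Lg Lh; rewrite /L2dot -RintegralD//; try exact: L2_integrableM.
by apply: eq_Rintegral => x _; rewrite mulrDl.
Qed.

Lemma L2dotZl D f g (a : R) : measurable D -> L2 D f -> L2 D g ->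
  L2dot D (fun x => a * f x) g = a * L2dot D f g.
Proof.
move=> mD Lf Lg; rewrite /L2dot -RintegralZl//; try exact: L2_integrableM.
by apply: eq_Rintegral => x _; rewrite mulrA.
Qed.

Lemma L2dotBl D f g h : measurable D -> L2 D f -> L2 D g -> L2 D h ->
  L2dot D (fun x => f x - g x) h = L2dot D f h - L2dot D g h.
Proof.
move=> mD Lf Lg Lh; rewrite /L2dot -RintegralB//; try exact: L2_integrableM.
by apply: eq_Rintegral => x _; rewrite mulrBl.
Qed.

Lemma L2dot_suml D (I : eqType) (s : seq I) (F : I -> R -> R) h :
  measurable D -> (forall i, i \in s -> L2 D (F i)) -> L2 D h ->
  L2dot D (fun x => \sum_(i <- s) F i x) h = \sum_(i <- s) L2dot D (F i) h.
Proof.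
move=> mD + Lh; elim: s => [|i s ih] LF.
  rewrite big_nil /L2dot; under eq_Rintegral do rewrite big_nil mul0r.
  by rewrite Rintegral_cst// mul0r.
have Ls j : j \in s -> L2 D (F j) by move=> js; apply: LF; rewrite in_cons js orbT.
rewrite big_cons -ih// -L2dotDl//; last exact: L2_sum.
  by apply: eq_Rintegral => x _; rewrite big_cons.
by apply: LF; rewrite mem_head.
Qed.

Lemma L2dot_ge0 D f : 0 <= L2dot D f f.
Proof. by apply: Rintegral_ge0 => x _; rewrite -expr2 sqr_ge0. Qed.

Lemma L2normE D f : measurable D -> L2 D f ->
  L2norm D f = (L2dot D f f `^ 2^-1)%:E.
Proof.
move=> mD Lf; rewrite /L2norm unlock /=.
rewrite -poweR_EFin; congr (_ `^ _)%E.
rewrite /L2dot /Rintegral fineK; last first.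
  by apply: integrable_fin_num => //; exact: L2_integrableM.
rewrite [RHS]integral_mkcond; apply: eq_integral => x _ /=.
rewrite !patchE; case: ifP => _ /=.
  by rewrite -expr2 powR_mulrn// real_normK ?num_real.
by rewrite normr0 powR0.
Qed.

Lemma L2norm_lt D f (d : R) : measurable D -> L2 D f -> 0 < d ->
  (L2norm D f < d%:E)%E -> L2dot D f f < d ^+ 2.
Proof.
move=> mD Lf d0; rewrite L2normE// lte_fin => h.
have -> : L2dot D f f = (L2dot D f f `^ 2^-1) ^+ 2.
  by rewrite -powR_mulrn ?powR_ge0// -powRrM mulVf// powRr1// L2dot_ge0.
by rewrite ltr_pXn2r// ?nnegrE ?powR_ge0// ltW.
Qed.

End L2_space.

Section orthonormal_families.
Context {R : realType} (D : set R) (I : eqType) (A : set I) (e : I -> R -> R).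
Hypotheses (mD : measurable D) (oA : Defs.orthonormal D A e).
Implicit Types (f : R -> R) (F : seq I).

Definition proj f F : R -> R := fun x => \sum_(i <- F) L2dot D f (e i) * e i x.

(** [closed_span] speaks of lists of weighted indices in which an index may recur; adding up the
    weights of equal indices gives coefficients on a duplicate-free list, to which orthonormality
    applies. *)
Lemma lincomb_coefs (F : seq I) (s : seq (R * I)) : uniq F ->
    {subset unzip2 s <= F} ->
  exists c : I -> R, lincomb e s = fun x => \sum_(i <- F) c i * e i x.
Proof.
move=> uF; elim: s => [|[a i] s ih] sF.
  exists (fun=> 0); apply/funext => x; rewrite /lincomb big_nil big1// => i _.
  by rewrite mul0r.
have [|c hc] := ih; first by move=> j js; apply: sF; rewrite in_cons js orbT.
exists (fun j => (if j == i then a else 0) + c j).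
apply/funext => x; rewrite /lincomb big_cons/=.
rewrite -[X in _ + X]/(lincomb e s x) hc.
under [RHS]eq_bigr do rewrite mulrDl.
rewrite big_split/=; congr (_ + _).
rewrite (bigD1_seq i)/= ?eqxx//; last by apply: sF; rewrite mem_head.
by rewrite big1 ?addr0// => j /negbTE ->; rewrite mul0r.
Qed.

Lemma L2_comb (c : I -> R) F : (forall i, i \in F -> A i) ->
  L2 D (fun x => \sum_(i <- F) c i * e i x).
Proof.
move=> FA; apply: L2_sum => i iF; apply: L2Z.
by apply: (oA.1); exact: FA.
Qed.

Lemma L2dot_comb (c : I -> R) F j : uniq F -> (forall i, i \in F -> A i) ->
  A j -> L2dot D (fun x => \sum_(i <- F) c i * e i x) (e j) =
         if j \in F then c j else 0.
Proof.
move=> uF FA Aj; rewrite L2dot_suml//; last 2 first.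
- by move=> i iF; apply/L2Z/(oA.1)/FA.
- exact: (oA.1).
rewrite (eq_big_seq (fun i => if i == j then c i else 0)); last first.
  move=> i iF; rewrite L2dotZl//; [|exact/(oA.1)/FA|exact: (oA.1)].
  by rewrite oA.2//; [case: ifP => _; rewrite ?mulr1 ?mulr0|exact: FA].
have [jF|jF] := boolP (j \in F).
  by rewrite (bigD1_seq j)//= eqxx big1 ?addr0// => i /negbTE ->.
rewrite big_seq big1// => i iF; case: eqP => // ij.
by move: jF; rewrite -ij iF.
Qed.

(** Pythagoras: [f - lincomb e s] splits into [u = f - proj f F] and a combination [v] over [F], and
    [u] is orthogonal to every [e i] with [i] in [F]. *)
Lemma best_approx f F s : L2 D f -> uniq F -> (forall i, i \in F -> A i) ->
    {subset unzip2 s <= F} ->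
  L2dot D (f \- proj f F) (f \- proj f F) <=
  L2dot D (f \- lincomb e s) (f \- lincomb e s).
Proof.
move=> Lf uF FA sF; have [c ->] := lincomb_coefs uF sF.
set P := proj f F.
have LP : L2 D P by exact: L2_comb.
set u := f \- P.
have Lu : L2 D u by exact: L2B.
pose a i := L2dot D f (e i) - c i.
pose v x := \sum_(i <- F) a i * e i x.
have Lv : L2 D v by exact: L2_comb.
have -> : f \- (fun x => \sum_(i <- F) c i * e i x) = (fun x => u x + v x).
  apply/funext => x /=; rewrite /u /v /P /proj /=.
  under [X in _ = _ - _ + X]eq_bigr do rewrite mulrBl.
  by rewrite sumrB addrA subrK.
have uv0 : L2dot D v u = 0.
  rewrite /v L2dot_suml//; last by move=> i iF; apply/L2Z/(oA.1)/FA.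
  rewrite big_seq big1// => i iF; rewrite L2dotZl//; last exact/(oA.1)/FA.
  rewrite L2dotC L2dotBl//; last exact/(oA.1)/FA.
  by rewrite /P L2dot_comb// ?iF ?subrr ?mulr0//; exact: FA.
have Luv : L2 D (fun x => u x + v x) by exact: L2D.
rewrite (L2dotDl mD Lu Lv Luv) (L2dotC _ u) (L2dotC _ v).
rewrite (L2dotDl mD Lu Lv Lu) (L2dotDl mD Lu Lv Lv) uv0 (L2dotC _ u v) uv0.
rewrite addr0 add0r lerDl.
exact: L2dot_ge0.
Qed.

(** The bound is stated for every finite [F] containing [s], so that [F] can later be a full range
    of resolution levels. *)
Lemma closed_span_proj_cvg f (d : R) : closed_span D A e f -> 0 < d ->
  exists2 s : seq I, (forall i, i \in s -> A i) &
    forall F, uniq F -> (forall i, i \in F -> A i) -> {subset s <= F} ->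
      L2dot D (f \- proj f F) (f \- proj f F) < d ^+ 2.
Proof.
move=> [Lf /(_ d)] + d0 => /(_ d0)[s sA hs].
exists (unzip2 s) => // F uF FA sF.
apply: (le_lt_trans (best_approx Lf uF FA sF)).
apply: L2norm_lt => //; apply: L2B => //.
by have [c ->] := lincomb_coefs uF sF; exact: L2_comb.
Qed.

(** Projecting on more indices than [F] changes nothing, since the extra coefficients vanish; so the
    distance to [proj f F] is already as small as that of any larger projection. *)
Lemma closed_span_finite f F : closed_span D A e f -> uniq F ->
    (forall i, i \in F -> A i) ->
    (forall i, A i -> i \notin F -> L2dot D f (e i) = 0) ->
  L2dot D (f \- proj f F) (f \- proj f F) = 0.
Proof.
move=> cf uF FA f0; apply/eqP; rewrite eq_le L2dot_ge0 andbT leNgt.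
apply/negP => h0; set q := L2dot _ _ _ in h0.
(* With this tolerance a positive squared distance [q] would be smaller than itself. *)
have := @closed_span_proj_cvg f (Num.sqrt q) cf.
rewrite sqrtr_gt0 => /(_ h0)[s sA hs].
have := hs (undup (F ++ s)); rewrite undup_uniq => /(_ isT).
have FsA i : i \in undup (F ++ s) -> A i.
  by rewrite mem_undup mem_cat => /orP[/FA|/sA].
move=> /(_ FsA); rewrite (_ : proj f (undup (F ++ s)) = proj f F).
  rewrite sqr_sqrtr ?(ltW h0)// ltxx => H.
  suff: false by [].
  by apply: H => i iS; rewrite mem_undup mem_cat iS orbT.
apply/funext => x; rewrite /proj.
rewrite (bigID (mem F))/= [X in _ + X]big_seq_cond [X in _ + X]big1 ?addr0; last first.
  move=> i /andP[iFs iF]; rewrite f0 ?mul0r//; exact: FsA.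
rewrite -big_filter; apply: perm_big; apply: uniq_perm => //.
  by rewrite filter_uniq// undup_uniq.
move=> i; rewrite mem_filter mem_undup mem_cat/=.
by case: (i \in F).
Qed.

(** Applied to normalised indicators of design cells, this bounds the variance of the regression
    estimators. *)
Lemma bessel f F : L2 D f -> uniq F -> (forall i, i \in F -> A i) ->
  \sum_(i <- F) L2dot D f (e i) ^+ 2 <= L2dot D f f.
Proof.
move=> Lf uF FA; have Lp : L2 D (proj f F) by exact: L2_comb.
have Lu : L2 D (fun x => f x - proj f F x) by exact: L2B.
have pf : L2dot D (proj f F) f = \sum_(i <- F) L2dot D f (e i) ^+ 2.
  rewrite /proj L2dot_suml//; last by move=> i iF; apply/L2Z/(oA.1)/FA.
  rewrite big_seq [RHS]big_seq; apply: eq_bigr => i iF.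
  by rewrite L2dotZl//; [rewrite (L2dotC _ (e i)) expr2|exact/(oA.1)/FA].
have pp : L2dot D (proj f F) (proj f F) = \sum_(i <- F) L2dot D f (e i) ^+ 2.
  rewrite {1}/proj L2dot_suml//; last by move=> i iF; apply/L2Z/(oA.1)/FA.
  rewrite big_seq [RHS]big_seq; apply: eq_bigr => i iF.
  rewrite L2dotZl//; last exact/(oA.1)/FA.
  by rewrite (L2dotC _ (e i)) /proj L2dot_comb ?iF ?expr2//; exact: FA.
rewrite -subr_ge0; suff -> : L2dot D f f - \sum_(i <- F) L2dot D f (e i) ^+ 2 =
    L2dot D (fun x => f x - proj f F x) (fun x => f x - proj f F x).
  exact: L2dot_ge0.
rewrite (L2dotBl mD Lf Lp Lu) (L2dotC _ f) (L2dotC _ (proj f F)).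
rewrite (L2dotBl mD Lf Lp Lf) (L2dotBl mD Lf Lp Lp) (L2dotC _ f (proj f F)) pf pp.
by ring.
Qed.

End orthonormal_families.

(** * Affine changes of variable in Lebesgue integrals *)

Section affine_substitution.
Context {R : realType} (a b : R).
Hypothesis a0 : 0 < a.
Local Notation mu := (@lebesgue_measure R).
Let h : measurableTypeR R -> measurableTypeR R := fun x => a * x + b.

Let mh : measurable_fun [set: measurableTypeR R] h.
Proof. by apply: measurable_funD => //; apply: measurable_funM. Qed.

HB.instance Definition _ := isMeasurableFun.Build _ _ _ _ h mh.

(** Lebesgue measure is determined by its values on the intervals ]u, v]. The factor [a] is moved to
    the other side so that the measure to be identified is a scaled pushforward. *)
Lemma lebesgue_measure_affine (A : set R) : measurable A ->
  mu (h @^-1` A) = (a^-1%:E * mu A)%E.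
Proof.
move=> mA.
pose c : {nonneg R} := NngNum (ltW a0).
suff -> : mu A = (a%:E * mu (h @^-1` A))%E.
  by rewrite muleA -EFinM mulVf ?gt_eqF// mul1e.
have -> : (a%:E * mu (h @^-1` A))%E = mscale c (pushforward mu h) A by [].
apply: lebesgue_measure_unique => // _ [[u v] _ <-].
transitivity (a%:E * mu [set` `](u - b) / a, (v - b) / a]%R])%E; last first.
  congr (_ * mu _)%E; apply/seteqP; split => x /=; rewrite !in_itv/= /h;
    by rewrite ltr_pdivrMr// ler_pdivlMr// ltrBlDr lerBrDr (mulrC x).
rewrite [LHS]lebesgue_measure_itv /= [in RHS]lebesgue_measure_itv/= !lte_fin.
rewrite ltr_pM2r ?invr_gt0// ltrD2r.
case: ifP => uv; last by rewrite mule0.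
rewrite -!EFinB -EFinM; congr EFin; field.
by rewrite gt_eqF.
Qed.

Lemma ae_affine (P : R -> Prop) :
  {ae mu, forall x, P x} -> {ae mu, forall x, P (a * x + b)}.
Proof.
move=> [N [mN N0 PN]]; exists (h @^-1` N); split.
- by rewrite -[X in measurable X]setTI; exact: mh.
- by rewrite lebesgue_measure_affine// [mu N]N0 mule0.
- by move=> x /=; exact: (PN (h x)).
Qed.

Lemma integral_affine_ge0 (F : R -> \bar R) : measurable_fun setT F ->
  (forall x, (0 <= F x)%E) ->
  (\int[mu]_x F (a * x + b)%R = a^-1%:E * \int[mu]_x F x)%E.
Proof.
move=> mF F0.
have := @ge0_integral_pushforward _ _ _ _ R h mh mu setT F measurableT mF.
rewrite preimage_setT => <-; last by move=> y _; exact: F0.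
have ia0 : 0 <= a^-1 by rewrite invr_ge0 ltW.
pose c : {nonneg R} := NngNum ia0.
rewrite -(@ge0_integral_mscale _ _ _ mu _ measurableT c F mF)//.
apply: eq_measure_integral => /= A mA _.
by rewrite /pushforward lebesgue_measure_affine.
Qed.

Lemma Rintegral_affine (F : R -> R) : mu.-integrable setT (EFin \o F) ->
  \int[mu]_x F (a * x + b) = a^-1 * \int[mu]_x F x.
Proof.
move=> iF; have mF := measurable_int _ iF.
rewrite /Rintegral -[a^-1]/(fine a^-1%:E) -fineM//; last exact: integrable_fin_num.
congr fine.
rewrite integralE [in RHS]integralE.
have fp := integrable_pos_fin_num measurableT iF.
have fn := integrable_neg_fin_num measurableT iF.
rewrite muleBr//; last by rewrite fin_num_adde_defr.
congr (_ - _)%E.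
- by rewrite -integral_affine_ge0//; [by apply: eq_integral => x _; rewrite ?funeposE ?funenegE|exact: measurable_funepos].
- by rewrite -integral_affine_ge0//; [by apply: eq_integral => x _; rewrite ?funeposE ?funenegE|exact: measurable_funeneg].
Qed.

End affine_substitution.

(** * Regular representatives of the wavelet basis *)

Section bounded_lipschitz.
Context {R : realType}.
Implicit Types (D : set R) (g : R -> R).

Definition blip D (B : R) g : Prop :=
  (forall x, D x -> `|g x| <= B) /\
  (forall x y, D x -> D y -> `|g x - g y| <= B * `|x - y|).

Definition bounded_lipschitz D g : Prop := exists2 B, 0 <= B & blip D B g.

Lemma bounded_lipschitzD D g h : bounded_lipschitz D g ->
  bounded_lipschitz D h -> bounded_lipschitz D (fun x => g x + h x).
Proof.
move=> [B B0 [gB gL]] [C C0 [hC hL]]; exists (B + C); first exact: addr_ge0.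
split=> [x Dx|x y Dx Dy].
  by rewrite (le_trans (ler_normD _ _))// lerD// ?gB// hC.
rewrite opprD addrACA mulrDl (le_trans (ler_normD _ _))// lerD//.
  exact: gL.
exact: hL.
Qed.

Lemma bounded_lipschitzZ D g (a : R) : bounded_lipschitz D g ->
  bounded_lipschitz D (fun x => a * g x).
Proof.
move=> [B B0 [gB gL]]; exists (`|a| * B); first by rewrite mulr_ge0.
split=> [x Dx|x y Dx Dy]; first by rewrite normrM ler_wpM2l// gB.
by rewrite -mulrBr normrM -mulrA ler_wpM2l// gL.
Qed.

Lemma bounded_lipschitz_sum D (I : eqType) (s : seq I) (c : I -> R)
    (F : I -> R -> R) : (forall i, i \in s -> bounded_lipschitz D (F i)) ->
  bounded_lipschitz D (fun x => \sum_(i <- s) c i * F i x).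
Proof.
elim: s => [_|i s ih LF].
  exists 0 => //; split=> [x Dx|x y Dx Dy]; first by rewrite big_nil normr0.
  by rewrite !big_nil subrr normr0 mul0r.
under eq_fun do rewrite big_cons.
apply: bounded_lipschitzD; first by apply/bounded_lipschitzZ/LF/mem_head.
by apply: ih => j js; apply: LF; rewrite in_cons js orbT.
Qed.

Lemma bounded_lipschitz_ext D g h : (forall x, D x -> g x = h x) ->
  bounded_lipschitz D h -> bounded_lipschitz D g.
Proof.
move=> gh [B B0 [hB hL]]; exists B => //.
by split=> [x Dx|x y Dx Dy]; rewrite !gh//; [exact: hB|exact: hL].
Qed.

Lemma blip_le D B C g : B <= C -> blip D B g -> blip D C g.
Proof.
move=> BC [gB gL]; split=> [x Dx|x y Dx Dy]; first exact: le_trans (gB _ Dx) BC.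
by rewrite (le_trans (gL _ _ Dx Dy))// ler_wpM2r.
Qed.

Lemma bounded_lipschitz_unif D (g : nat -> R -> R) n :
  (forall k, (k < n)%N -> bounded_lipschitz D (g k)) ->
  exists2 B, 0 <= B & forall k, (k < n)%N -> blip D B (g k).
Proof.
elim: n => [_|n ih gL]; first by exists 0.
have [k kn|B B0 hB] := ih; first by apply: gL; exact: ltnW.
have [C C0 hC] := gL n (ltnSn n).
exists (B + C); first exact: addr_ge0.
move=> k; rewrite ltnS leq_eqVlt => /orP[/eqP ->|kn].
  by apply: blip_le hC; rewrite lerDr.
by apply: blip_le (hB _ kn); rewrite lerDl.
Qed.

Lemma bounded_lipschitz_affine D D' g (a b : R) : bounded_lipschitz D g ->
    (forall x, D' x -> D (a * x + b)) ->
  bounded_lipschitz D' (fun x => g (a * x + b)).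
Proof.
move=> [B B0 [gB gL]] DD'; exists (B * (1 + `|a|)).
  by rewrite mulr_ge0// addr_ge0.
split=> [x Dx|x y Dx Dy].
  rewrite (le_trans (gB _ (DD' _ Dx)))// ler_peMr//.
  by rewrite lerDl.
rewrite (le_trans (gL _ _ (DD' _ Dx) (DD' _ Dy)))//.
rewrite -mulrA ler_wpM2l// opprD addrACA subrr addr0 -mulrBr normrM ler_wpM2r//.
by rewrite lerDr.
Qed.

(** For a <= b, the nearest-point retraction of the line onto [a, b]; being 1-Lipschitz, it extends
    Lipschitz functions from the interval to the line. *)
Definition clamp (a b x : R) := Num.max a (Num.min b x).

Lemma clamp_itv a b x : a <= b -> a <= clamp a b x <= b.
Proof.
by move=> ab; rewrite /clamp le_max lexx/= ge_max ab ge_min lexx.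
Qed.

Lemma clamp_id a b x : a <= x <= b -> clamp a b x = x.
Proof. by move=> /andP[ax xb]; rewrite /clamp (min_idPr xb) (max_idPr ax). Qed.

Lemma clamp_dist a b x y : a <= b -> `|clamp a b x - clamp a b y| <= `|x - y|.
Proof.
move=> ab.
have H u v : u <= v -> `|clamp a b u - clamp a b v| <= `|u - v|.
  move=> uv; rewrite !(distrC u) !(distrC _ (clamp a b v)).
  rewrite (@ger0_norm _ (v - u)) ?subr_ge0// ger0_norm ?subr_ge0; last first.
    by rewrite /clamp; case: (leP b u) => ?; case: (leP b v) => ?;
      case: (leP a b) => ?; case: (leP a u) => ?; case: (leP a v) => ?; lra.
  by rewrite /clamp; case: (leP b u) => ?; case: (leP b v) => ?;
      case: (leP a b) => ?; case: (leP a u) => ?; case: (leP a v) => ?; lra.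
have [/H//|yx] := leP x y.
by rewrite distrC (distrC x); exact/H/ltW.
Qed.

(** The derivative is bounded on the compact interval [-b, b], so the mean value theorem gives a
    Lipschitz constant there; it extends to the line because [g] is unchanged when its argument is
    clamped to [-b, b]. *)
Lemma bounded_lipschitz_C1 g (b : R) : 0 < b -> (forall x, derivable g x 1) ->
    continuous (derive1 g) -> (forall x, b <= `|x| -> g x = 0) ->
  bounded_lipschitz setT g.
Proof.
move=> b0 dg cg g0.
have bb : - b <= b by lra.
have [C C0 hC] : exists2 C, 0 <= C & forall x, -b <= x <= b -> `|derive1 g x| <= C.
  have cn : {within `[-b, b], continuous (fun x => `|derive1 g x|)}.
    apply: continuous_subspaceT => x.
    by apply: continuous_comp; [exact: cg|exact: norm_continuous].
  have [c _ hc] := EVT_max bb cn.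
  by exists `|derive1 g c| => // x xb; apply: hc; rewrite in_itv.
have cont : continuous g.
  by move=> x; exact/differentiable_continuous/derivable1_diffP.
have L1 u v : -b <= u <= b -> -b <= v <= b -> u <= v -> `|g u - g v| <= C * `|u - v|.
  move=> ub vb uv; have [||c] := @MVT_segment R g (derive1 g) u v uv.
  - by move=> x _; rewrite derive1E; apply: DeriveDef.
  - exact: continuous_subspaceT.
  rewrite in_itv/= => cuv; rewrite distrC => ->.
  rewrite normrM (distrC u) ler_wpM2r// hC//; lra.
have L2 u v : -b <= u <= b -> -b <= v <= b -> `|g u - g v| <= C * `|u - v|.
  move=> ub vb; have [|/ltW] := leP u v; first exact: L1.
  by move=> vu; rewrite distrC (distrC u); exact: L1.
have gc x : g x = g (clamp (-b) b x).
  have [xb|xb] := leP `|x| b.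
    by rewrite clamp_id//; move: xb; rewrite ler_norml.
  rewrite g0 ?(ltW xb)// g0// /clamp; move: xb; rewrite lter_normr.
  have bn : `|b| = b by rewrite gtr0_norm.
  by move=> /orP[] xb; case: (leP b x) => ?; case: (leP (-b) b) => ?;
    case: (leP (-b) x) => ?; rewrite ?normrN ?bn//; lra.
have Lip x y : `|g x - g y| <= C * `|x - y|.
  rewrite (gc x) (gc y); apply: (le_trans (L2 _ _ _ _)); rewrite ?clamp_itv//.
  by rewrite ler_wpM2l// clamp_dist.
(* The extra 2 b C bounds the values: [g] vanishes at [b], and clamped points lie within 2 b of
   it. *)
exists (C + C * (2 * b)); first by rewrite addr_ge0// mulr_ge0//; lra.
split=> [x _|x y _ _].
  have -> : g x = g x - g b by rewrite (g0 b) ?subr0// ger0_norm// ltW.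
  rewrite (gc x); apply: (le_trans (Lip _ _)).
  have /andP[h1 h2] := clamp_itv x bb.
  have : `|clamp (-b) b x - b| <= 2 * b.
    by rewrite ler0_norm ?subr_le0//; lra.
  by move=> h; rewrite (le_trans (ler_wpM2l C0 h))// lerDr.
rewrite (le_trans (Lip _ _))// ler_wpM2r// lerDl mulr_ge0//; lra.
Qed.

End bounded_lipschitz.

(** * Regularity of the wavelet up to null sets *)

Section smooth_wavelet.
Context {R : realType}.
Local Notation mu := (@lebesgue_measure R).

Lemma L2_bounded (D : set R) (h : R -> R) (B T : R) : measurable D ->
    measurable_fun D h -> (forall x, D x -> `|h x| <= B) ->
    (forall x, D x -> T < `|x| -> h x = 0) ->
  L2 D h.
Proof.
move=> mD mh hB hT; rewrite /L2; set k := h \_ D.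
have mk : measurable_fun setT k by apply/(measurable_restrictT h mD).
have kB x : `|k x| <= `|B|.
  rewrite /k patchE; case: ifPn => [/set_mem Dx|_]; last by rewrite normr0.
  by rewrite (le_trans (hB _ Dx))// ler_norm.
have kT x : T < `|x| -> k x = 0.
  by move=> Tx; rewrite /k patchE; case: ifPn => // /set_mem Dx; exact: hT.
apply/andP; split; first by rewrite inE.
rewrite inE/= /finite_norm unlock/= poweR_lty//.
rewrite (_ : (fun x => _) = EFin \o (fun x => k x ^+ 2)); last first.
  apply/funext => x /=.
  by rewrite powR_mulrn// real_normK ?num_real.
apply: (@le_lt_trans _ _ (\int[mu]_x ((`|B| ^+ 2) * \1_(`[- `|T|, `|T|]) x)%:E)%E).
  apply: ge0_le_integral => //=.
  - by move=> x _; rewrite lee_fin sqr_ge0.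
  - by apply/measurable_EFinP; exact: measurable_funX.
  - apply/measurable_EFinP/measurable_funM => //; apply: measurable_indic; exact: measurable_itv.
  - move=> x _; rewrite lee_fin indicE.
    have [xT|xT] := boolP (x \in _).
      by rewrite mulr1 -[leLHS]real_normK ?num_real// ler_pXn2r// nnegrE.
    rewrite mulr0 kT ?expr0n//.
    apply: contraNT xT; rewrite -leNgt inE/= in_itv/= => xT.
    by rewrite -ler_norml (le_trans xT)// ler_norm.
under eq_integral do rewrite EFinM.
rewrite integralZl//; last by exact: integrable_indic_itv.
rewrite integral_indic// setIT [X in (_ * X)%E]lebesgue_measure_itv/=.
by case: ifP => _; rewrite -?EFinB -EFinM ltry.
Qed.

Lemma L2dot_eq0_ae (D : set R) (h : R -> R) : measurable D -> L2 D h ->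
  L2dot D h h = 0 -> {ae mu, forall x, D x -> h x = 0}.
Proof.
move=> mD Lh h0.
have ih := L2_integrableM mD Lh Lh.
have : (\int[mu]_(x in D) `|(h x * h x)%:E| = 0)%E.
  under eq_integral do rewrite /= ger0_norm -?expr2 ?sqr_ge0// expr2.
  by rewrite -[LHS]fineK ?integrable_fin_num//; congr EFin.
move/(ae_eq_integral_abs mu mD (measurable_int mu ih)).
apply: filterS => x /= + Dx => /(_ Dx)[] /eqP.
by rewrite mulf_eq0 orbb => /eqP.
Qed.

Lemma bounded_lipschitz_continuous (g : R -> R) :
  bounded_lipschitz setT g -> continuous g.
Proof.
move=> [B B0 [_ gL]] x; apply/cvgrPdist_lt => e e0.
have B1 : 0 < B + 1 by rewrite ltr_wpDl.
near=> y; apply: (le_lt_trans (gL _ _ I I)).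
apply: (@le_lt_trans _ _ ((B + 1) * `|x - y|)).
  by rewrite ler_wpM2r// lerDl.
rewrite -ltr_pdivlMl// mulrC.
near: y; apply: cvgr_dist_lt; last by rewrite divr_gt0.
exact: cvg_id.
Unshelve. all: by end_near. Qed.

Context (W : wavelet_system R) (hW : mother_assumptions W).
Local Notation K := (wK W).

Let phi_supp x : (K%:R + 1 : R) <= `|x| -> phi W x = 0.
Proof.
case: hW => _ [sp _] _ _ _ Kx; apply/eqP; apply: contraLR Kx => /sp.
rewrite -ltNge ltr_norml; lra.
Qed.

Lemma phi_bounded_lipschitz : bounded_lipschitz setT (phi W).
Proof.
case: (hW) => _ _ _ [d1 d2 _] _.
apply: (@bounded_lipschitz_C1 _ _ (K%:R + 1)) => //.
- by move=> x; exact/differentiable_continuous/derivable1_diffP.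
Qed.

Let phi1E (k : int) (x : R) :
  dil 1 k (phi W) x = 2 `^ (1 / 2) * phi W (2 * x + - k%:~R).
Proof. by rewrite /dil expr1z. Qed.

Let phi1_lip k : bounded_lipschitz setT (dil 1 k (phi W)).
Proof.
rewrite (_ : dil _ _ _ = (fun x => 2 `^ (1 / 2) * phi W (2 * x + - k%:~R))).
  by apply/bounded_lipschitzZ/(bounded_lipschitz_affine phi_bounded_lipschitz).
by apply/funext => x; rewrite phi1E.
Qed.

(** Orthonormality is assumed at scale 0 only; the substitution x -> 2 x carries it to scale 1, its
    Jacobian cancelling the two normalising factors 2^(1/2). *)
Let phi1_orthonormal :
  Defs.orthonormal [set: R] [set: int] (fun k => dil 1 k (phi W)).
Proof.
case: (hW) => -[[L0 o0] _ _ _ _] _ _ _ _; split.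
  move=> k _; have [B B0 [gB _]] := phi1_lip k.
  apply: (@L2_bounded _ _ B (K%:R + 1 + `|k%:~R|)) => //.
    apply: continuous_measurable_fun; apply: bounded_lipschitz_continuous. exact: phi1_lip.
  move=> x _ xT; rewrite phi1E phi_supp ?mulr0//.
  have := lerB_dist (2 * x) (k%:~R).
  rewrite normrM ger0_norm//; have := normr_ge0 (k%:~R : R).
  have : 0 <= K%:R :> R by [].
  lra.
move=> k l _ _; rewrite -(o0 k l I I).
pose F x := dil 0 k (phi W) x * dil 0 l (phi W) x.
have iF : mu.-integrable setT (EFin \o F) by exact: L2_integrableM (L0 k I) (L0 l I).
have FE x : F x = phi W (x - k%:~R) * phi W (x - l%:~R).
  by rewrite /F /dil mul0r powRr0 !mul1r.
transitivity (\int[mu]_x (2 * F (2 * x + 0))).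
  apply: eq_Rintegral => x _.
  rewrite !phi1E FE addr0 mulrACA; congr (_ * _).
  rewrite -powRD ?pnatr_eq0 ?implybT//.
  have -> : 1 / 2 + 1 / 2 = 1 :> R by lra.
  by rewrite powRr1.
have iG : mu.-integrable setT (EFin \o (fun x => 2 * F x)).
  by apply: (integrableZl _ 2 iF).
rewrite (Rintegral_affine 0 (ltr0n _ 2) iG) RintegralZl// mulrA mulVf ?mul1r//.
Qed.

(** [psi] overlaps only finitely many of the functions phi(2 x - k), so all its other coefficients
    in V_1 vanish and [closed_span_finite] identifies it, almost everywhere, with a finite sum of
    Lipschitz functions. *)
Lemma psi_ae_smooth : exists g : R -> R,
  [/\ bounded_lipschitz setT g,
      exists T : nat, forall x, T%:R < `|x| -> g x = 0 &
      {ae mu, forall x, psi W x = g x}].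
Proof.
case: (hW) => -[_ _ _ _ [_ hpsi _]] [_ sp] _ _ _.
have {hpsi} [Vpsi _] := hpsi 0 I.
have psiE : dil 0 0 (psi W) = psi W.
  by apply/funext => x; rewrite /dil mul0r powRr0 !mul1r subr0.
rewrite psiE in Vpsi.
(* On the support of [psi], |2 x| is at most 2 K, and phi(2 x - k) is nonzero only if |2 x - k| < K
   + 1; hence |k| < 3 K + 1. *)
pose n := (3 * K + 1)%N.
pose S := [seq (i : int) - (n : int) | i : nat <- iota 0 (2 * n).+1].
have uS : uniq S.
  by rewrite map_inj_uniq ?iota_uniq// => i j /addIr [].
have dot0 k : [set: int] k -> k \notin S ->
    L2dot setT (psi W) (dil 1 k (phi W)) = 0.
  move=> _ kS; rewrite /L2dot (@eq_Rintegral _ _ _ _ _ (fun=> 0)).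
    by rewrite Rintegral_cst// mul0r.
  move=> x _; apply/eqP; apply: contraNT kS.
  rewrite phi1E !mulf_eq0 !negb_or => /and3P[/sp px _ ph].
  have : `|2 * x - k%:~R| < K%:R + 1.
    by rewrite ltNge; apply: contra ph => h; rewrite phi_supp.
  rewrite ltr_norml => /andP[h1 h2].
  have kn : `|k| <= n%:Z.
    rewrite ler_norml -!(ler_int R) rmorphN/= -!pmulrn /n natrD natrM; lra.
  have kn0 : (0 <= k + n%:Z)%R by move: kn; rewrite ler_norml; lia.
  apply/mapP; exists `|(k + n%:Z)%R|%N; last by rewrite gez0_abs// addrK.
  by rewrite mem_iota /= add0n; lia.
have LT : @measurable _ (measurableTypeR R) setT by [].
have h0 := closed_span_finite LT phi1_orthonormal Vpsi uS (fun i _ => I) dot0.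
exists (proj setT (fun k => dil 1 k (phi W)) (psi W) S); split.
- exact: bounded_lipschitz_sum.
- exists (4 * K + 2)%N => x xT; rewrite /proj big1_seq// => k /andP[_].
  move=> /mapP[i]; rewrite mem_iota add0n => /andP[_ iN] ->.
  rewrite phi1E phi_supp ?mulr0//.
  have iN' : i%:R <= (2 * n)%:R :> R by rewrite ler_nat.
  rewrite rmorphB/= -!pmulrn /n; move: xT iN'.
  rewrite /n !(natrD, natrM) => xT iN'.
  have i0 : 0 <= i%:R :> R by [].
  have K0 : 0 <= K%:R :> R by [].
  by move: xT; rewrite ltr_normr ler_normr => /orP[] xT; apply/orP;
    [left|right]; lra.
- have Lp : L2 setT (proj setT (fun k => dil 1 k (phi W)) (psi W) S).
    exact: (L2_comb phi1_orthonormal).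
  have := L2dot_eq0_ae LT (L2B Vpsi.1 Lp) h0.
  apply: (@filterS _ _ (ae_filter_ringOfSetsType (@lebesgue_measure R))) => x.
  by move=> /(_ I) /= /eqP; rewrite subr_eq0 => /eqP.
Qed.

End smooth_wavelet.

Section counting.
Context {R : realType}.

(** The set counted lies among the [c] integers starting at its least element. This bounds,
    uniformly in the level, how many basis functions are active at a point. *)
Lemma sum_window_le (p : pred nat) (c m : nat) :
  (forall k l, p k -> p l -> (l < k + c)%N) ->
  \sum_(0 <= k < m) (p k)%:R <= c%:R :> R.
Proof.
move=> pc; rewrite -natr_sum ler_nat.
have [[k0 pk0]|np] := pselect (exists k, p k); last first.
  rewrite big1// => k _; case: (boolP (p k)) => // pk.
  by exfalso; apply: np; exists k.
case: (ex_minnP (ex_intro _ k0 pk0)) => q pq qmin.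
rewrite [leqLHS](_ : _ = count p (index_iota 0 m)); last first.
  rewrite -sum1_count [RHS]big_mkcond/=; apply: eq_bigr => k _.
  by case: (p k).
rewrite -size_filter -(size_iota q c).
apply: uniq_leq_size; first by rewrite filter_uniq// iota_uniq.
move=> k; rewrite mem_filter mem_iota => /andP[pk _].
by rewrite qmin//= pc.
Qed.

Lemma normr_le_sum (G : nat -> R) (n k : nat) (c : R) : (k < n)%N ->
  \sum_(0 <= i < n) `|G i| <= c -> `|G k| <= c.
Proof.
move=> kn; apply: le_trans; rewrite big_mkord (bigD1 (Ordinal kn))//=.
by rewrite lerDl sumr_ge0.
Qed.

End counting.

(** * Sums over all basis functions of one level *)

Section interval_functions.
Context {R : realType} (W : wavelet_system R).
Variables (g : R -> R) (gL gR : nat -> R -> R) (T : nat).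
Local Notation N := (wN W).
Hypothesis lip_g : bounded_lipschitz setT g.
Hypothesis supp_g : forall x, T%:R < `|x| -> g x = 0.
Hypothesis lip_gL : forall k, (k < N)%N -> bounded_lipschitz [set x | 0 <= x] (gL k).
Hypothesis lip_gR : forall k, (k < N)%N -> bounded_lipschitz [set x | x <= 0] (gR k).
Local Notation IF := (interval_fun W g gL gR).

Let near_k (j : nat) (x : R) : pred nat :=
  fun k => `|2 ^+ j * x - k%:R| <= T%:R.

Let near_k_window j x k l : near_k j x k -> near_k j x l ->
  (l < k + (2 * T).+1)%N.
Proof.
rewrite /near_k !ler_norml => kx lx.
by rewrite addnS ltnS -(ler_nat R) natrD natrM; lra.
Qed.

(** Of the 2^j functions at level [j] a bounded number can be nonzero at [x] or [y]: those of the
    two edges, and those whose translate lies within [T] of one of the points. Each contributes the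
    scaling 2^(j/2), with a further 2^j in the Lipschitz bound. *)
Lemma interval_fun_bounds : exists2 B : R, 0 <= B &
  forall j x y, 0 <= x <= 1 -> 0 <= y <= 1 ->
    \sum_(0 <= k < 2 ^ j) `|IF j k x| <= B * 2 `^ (j%:R / 2) /\
    \sum_(0 <= k < 2 ^ j) `|IF j k x - IF j k y| <=
      B * (2 `^ (j%:R / 2) * 2 ^+ j) * `|x - y|.
Proof.
have [B1 B10 hB1] := lip_g.
have [B2 B20 hB2] := bounded_lipschitz_unif lip_gL.
have [B3 B30 hB3] := bounded_lipschitz_unif lip_gR.
pose B := B1 + B2 + B3.
have B0 : 0 <= B by rewrite /B; lra.
have [gB gl] : blip setT B g by apply: blip_le hB1; rewrite /B; lra.
have hL k : (k < N)%N -> blip [set x | 0 <= x] B (gL k).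
  by move=> kN; apply: blip_le (hB2 _ kN); rewrite /B; lra.
have hR k : (k < N)%N -> blip [set x | x <= 0] B (gR k).
  by move=> kN; apply: blip_le (hB3 _ kN); rewrite /B; lra.
pose c : R := (N + N + (2 * T).+1 + (2 * T).+1)%:R.
exists (c * B); first by rewrite mulr_ge0.
move=> j x y x01 y01.
(* The weight [w k] is at least 1 whenever the k-th function can be nonzero at [x] or [y], and the
   weights sum to at most [c]; multiplying each term by its weight thus gives a sum that is easy to
   bound. *)
pose w (k : nat) : R := (k < N)%:R + (2 ^ j - N <= k < 2 ^ j)%:R
  + (near_k j x k)%:R + (near_k j y k)%:R.
have sw : \sum_(0 <= k < 2 ^ j) w k <= c.
  rewrite /w !big_split/= /c !natrD.
  apply: lerD; last by apply: sum_window_le => k l; exact: near_k_window.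
  apply: lerD; last by apply: sum_window_le => k l; exact: near_k_window.
  by apply: lerD; apply: sum_window_le => k l; clear; lia.
have rightN (k : nat) : (k < 2 ^ j)%N -> ~~ (k < 2 ^ j - N)%N ->
    (2 ^ j - k.+1 < N)%N by clear; lia.
have p0 : 0 <= 2 `^ (j%:R / 2) :> R by rewrite powR_ge0.
have nn (b : bool) : 0 <= b%:R :> R by [].
have w4 (b1 b2 b3 b4 : bool) : b1 || b2 || b3 || b4 ->
    1 <= b1%:R + b2%:R + b3%:R + b4%:R :> R.
  have := nn b1; have := nn b2; have := nn b3; have := nn b4.
  by case: b1 b2 b3 b4 => [] [] [] [] //= *; lra.
have wL (k : nat) : (k < N)%N -> 1 <= w k.
  by move=> kN; apply: w4; rewrite kN.
have wR (k : nat) : (k < 2 ^ j)%N -> (2 ^ j - N <= k)%N -> 1 <= w k.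
  by move=> k2 kN; apply: w4; rewrite kN k2 !orbT.
have wx (k : nat) : near_k j x k -> 1 <= w k.
  by move=> kn; apply: w4; rewrite kn !orbT.
have wy (k : nat) : near_k j y k -> 1 <= w k.
  by move=> kn; apply: w4; rewrite kn !orbT.
have w0 (k : nat) : 0 <= w k by rewrite /w !addr_ge0.
have far z k : ~~ near_k j z k -> g (2 ^+ j * z - k%:R) = 0.
  by rewrite /near_k -ltNge; exact: supp_g.
have e2 : 0 <= 2 ^+ j :> R by rewrite exprn_ge0.
have dilE (k : nat) z : dil j k g z = 2 `^ (j%:R / 2) * g (2 ^+ j * z - k%:R).
  by [].
split.
  apply: (@le_trans _ _ (\sum_(0 <= k < 2 ^ j) w k * (B * 2 `^ (j%:R / 2)))).
    apply: ler_sum_nat => k /andP[_ k2]; rewrite /interval_fun.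
    case: ifPn => kN.
      rewrite normrM (ger0_norm p0) mulrC -[leLHS]mul1r ler_pM ?mulr_ge0//.
        exact: wL.
      rewrite ler_wpM2r//; apply: (hL _ kN).1 => /=.
      by rewrite mulr_ge0//; lra.
    case: ifPn => kM; last first.
      rewrite normrM (ger0_norm p0) mulrC -[leLHS]mul1r ler_pM ?mulr_ge0//.
        by apply: wR => //; rewrite leqNgt.
      rewrite ler_wpM2r//; apply: (hR _ _).1 => /=; first exact: rightN.
      by rewrite mulr_ge0_le0//; lra.
    rewrite dilE normrM (ger0_norm p0) mulrC.
    have [kx|kx] := boolP (near_k j x k).
      rewrite -[leLHS]mul1r ler_pM ?mulr_ge0//; first exact: wx.
      by rewrite ler_wpM2r// gB.
    by rewrite far// normr0 mul0r !mulr_ge0.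
  by rewrite -mulr_suml -mulrA ler_wpM2r// mulr_ge0.
apply: (@le_trans _ _ (\sum_(0 <= k < 2 ^ j) w k *
    (B * (2 `^ (j%:R / 2) * 2 ^+ j) * `|x - y|))).
  have sc (G : R -> R) u v : `|G u - G v| <= B * `|u - v| ->
      `|u - v| = 2 ^+ j * `|x - y| ->
      `|2 `^ (j%:R / 2) * G u - 2 `^ (j%:R / 2) * G v| <=
      B * (2 `^ (j%:R / 2) * 2 ^+ j) * `|x - y|.
    move=> h uv; rewrite -mulrBr normrM (ger0_norm p0) mulrCA -mulrA.
    by rewrite -!mulrA ler_wpM2l// -uv.
  have bnd0 : 0 <= B * (2 `^ (j%:R / 2) * 2 ^+ j) * `|x - y|.
    by rewrite !mulr_ge0.
  have up a b (k : nat) : 1 <= w k -> a <= b -> 0 <= b -> a <= w k * b.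
    by move=> w1 ab b0; rewrite (le_trans ab)// ler_peMl.
  apply: ler_sum_nat => k /andP[_ k2]; rewrite /interval_fun.
  case: ifPn => kN.
    apply: up => //; first exact: wL.
    apply: sc; last by rewrite -mulrBr normrM (ger0_norm e2).
    by apply: (hL _ kN).2 => /=; rewrite mulr_ge0//; lra.
  case: ifPn => kM; last first.
    apply: up => //; first by apply: wR => //; rewrite leqNgt.
    apply: sc; last first.
      by rewrite -mulrBr normrM (ger0_norm e2); congr (_ * `|_|); ring.
    by apply: (hR _ _).2 => /=; [exact: rightN|rewrite mulr_ge0_le0//; lra..].
  rewrite !dilE.
  have H : `|2 `^ (j%:R / 2) * g (2 ^+ j * x - k%:R)
     - 2 `^ (j%:R / 2) * g (2 ^+ j * y - k%:R)| <=
      B * (2 `^ (j%:R / 2) * 2 ^+ j) * `|x - y|.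
    apply: sc; first exact: gl.
    by rewrite opprB addrA subrK -mulrBr normrM (ger0_norm e2).
  have [kx|kx] := boolP (near_k j x k); first by apply: up => //; exact: wx.
  have [ky|ky] := boolP (near_k j y k); first by apply: up => //; exact: wy.
  by rewrite !far// !mulr0 subrr normr0 mulr_ge0.
by rewrite -mulr_suml -!mulrA ler_wpM2r// !mulr_ge0.
Qed.

End interval_functions.

Section regular_basis.
Context {R : realType} (W : wavelet_system R) (hW : cdv_system W).
Local Notation mu := (@lebesgue_measure R).
Local Notation N := (wN W).
Local Notation K := (wK W).
Local Notation j0 := (wj0 W).
Local Notation I01 := (`[0, 1]%classic : set R).

Let mother : mother_assumptions W. Proof. by case: hW. Qed.
Let bdry : cdv_boundary W. Proof. by case: hW. Qed.

Let phi_shift (D : set R) (a b : R) :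
  bounded_lipschitz D (fun x => phi W (a * x + b)).
Proof. exact: bounded_lipschitz_affine (phi_bounded_lipschitz mother) _. Qed.

Let edgeL_lip D k : bounded_lipschitz D (edgeL W k).
Proof.
apply: bounded_lipschitz_sum => n _.
apply: (@bounded_lipschitz_ext _ _ _
  (fun x => phi W (1 * x + (n%:R - N%:R + 1)))); last exact: phi_shift.
by move=> x _; rewrite mul1r !addrA.
Qed.

Let edgeR_lip D k : bounded_lipschitz D (edgeR W k).
Proof.
apply: bounded_lipschitz_sum => n _.
apply: (@bounded_lipschitz_ext _ _ _
  (fun x => phi W (1 * x + (N%:R - n%:R)))); last exact: phi_shift.
by move=> x _; rewrite mul1r !addrA.
Qed.

Let phiL_lip k : (k < N)%N -> bounded_lipschitz [set x | 0 <= x] (phiL W k).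
Proof.
move=> /bdry[[c hc] _ _ _]; apply: bounded_lipschitz_ext hc _.
exact: bounded_lipschitz_sum.
Qed.

Let phiR_lip k : (k < N)%N -> bounded_lipschitz [set x | x <= 0] (phiR W k).
Proof.
move=> /bdry[_ [c hc] _ _]; apply: bounded_lipschitz_ext hc _.
exact: bounded_lipschitz_sum.
Qed.

Let psiL_lip k : (k < N)%N -> bounded_lipschitz [set x | 0 <= x] (psiL W k).
Proof.
move=> /bdry[_ _ [c [d hc]] _]; apply: bounded_lipschitz_ext hc _.
apply: bounded_lipschitzD; apply: bounded_lipschitz_sum => l.
  rewrite mem_index_iota /= => lN.
  apply: (@bounded_lipschitz_ext _ _ _ (fun x => phiL W l (2 * x + 0))).
    by move=> x _; rewrite addr0.
  apply: bounded_lipschitz_affine (phiL_lip lN) _ => x /= x0.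
  by rewrite addr0 mulr_ge0.
by move=> _; exact: phi_shift.
Qed.

Let psiR_lip k : (k < N)%N -> bounded_lipschitz [set x | x <= 0] (psiR W k).
Proof.
move=> /bdry[_ _ _ [c [d hc]]]; apply: bounded_lipschitz_ext hc _.
apply: bounded_lipschitzD; apply: bounded_lipschitz_sum => l.
  rewrite mem_index_iota /= => lN.
  apply: (@bounded_lipschitz_ext _ _ _ (fun x => phiR W l (2 * x + 0))).
    by move=> x _; rewrite addr0.
  apply: bounded_lipschitz_affine (phiR_lip lN) _ => x /= x0.
  by rewrite addr0 mulr_ge0_le0.
move=> _; apply: (@bounded_lipschitz_ext _ _ _
  (fun x => phi W (2 * x + (l%:R + 1)))); last exact: phi_shift.
by move=> x _; rewrite addrA.
Qed.

Definition basis_idxb (i : nat + nat * nat) : bool :=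
  match i with
  | inl k => (k < 2 ^ j0)%N
  | inr jk => ((j0 <= jk.1) && (jk.2 < 2 ^ jk.1))%N
  end.

Lemma basis_idxP i : basis_idx W i <-> basis_idxb i.
Proof. by case: i. Qed.

(* Since psi is only known up to null sets, basis_fun is replaced by
   representatives e that are continuous; they are extended outside [0, 1] by
   their boundary values. *)
Definition regular_basis (e : nat + nat * nat -> R -> R) (B : R) : Prop :=
  [/\ 0 <= B, (forall i, continuous (e i)),
      (forall i, basis_idx W i ->
         {ae mu, forall x, I01 x -> basis_fun W i x = e i x}),
      (forall x y, I01 x -> I01 y ->
         \sum_(0 <= k < 2 ^ j0) `|e (inl k) x| <= B /\
         \sum_(0 <= k < 2 ^ j0) `|e (inl k) x - e (inl k) y| <= B * `|x - y|) &
      (forall j x y, (j0 <= j)%N -> I01 x -> I01 y ->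
         \sum_(0 <= k < 2 ^ j) `|e (inr (j, k)) x| <= B * 2 `^ (j%:R / 2) /\
         \sum_(0 <= k < 2 ^ j) `|e (inr (j, k)) x - e (inr (j, k)) y| <=
           B * (2 `^ (j%:R / 2) * 2 ^+ j) * `|x - y|)].

Lemma regular_basis_exists : exists e B, regular_basis e B.
Proof.
have [g [lip_g [T supp_g] psig]] := psi_ae_smooth mother.
have supp_phi x : (K%:R + 1 : R) < `|x| -> phi W x = 0.
  move=> Kx; case: mother => _ [sp _] _ _ _.
  apply/eqP; apply: contraLR Kx => /sp; rewrite -leNgt ler_norml; lra.
have := @interval_fun_bounds R W (phi W) (phiL W) (phiR W) K.+1
  (phi_bounded_lipschitz mother).
move=> /(_ _ phiL_lip phiR_lip)[x|B1 B10 h1].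
  by rewrite -addn1 natrD; exact: supp_phi.
have [B2 B20 h2] := interval_fun_bounds lip_g supp_g psiL_lip psiR_lip.
pose F i := match i with
  | inl k => phi_ W k
  | inr (j, k) => interval_fun W g (psiL W) (psiR W) j k end.
pose e i := if basis_idxb i then F i \o clamp 0 1 else fun=> 0.
have c01 x : I01 x -> clamp 0 1 x = x.
  by rewrite /= in_itv/= => x01; rewrite clamp_id.
(* The coarse functions live at the single level [j0], so their scaling factors can go into the
   constant. *)
pose P := 2 `^ (j0%:R / 2) * 2 ^+ j0 : R.
have P0 : 0 <= P by rewrite mulr_ge0 ?powR_ge0 ?exprn_ge0.
have p1 : 2 `^ (j0%:R / 2) <= P by rewrite ler_peMr ?powR_ge0// exprn_ege1// ler1n.
exists e, (B1 * P + B2); split.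
- by rewrite addr_ge0// mulr_ge0.
- have cc : continuous (clamp (0 : R) 1).
    apply: bounded_lipschitz_continuous; exists 1 => //; split=> [x _|x y _ _].
      by have := clamp_itv x (@ler01 R); rewrite ler_norml; lra.
    by rewrite mul1r; exact: clamp_dist.
  have lipc (G : R -> R) (C : R) : 0 <= C ->
      (forall x y, 0 <= x <= 1 -> 0 <= y <= 1 ->
         `|G x| <= C /\ `|G x - G y| <= C * `|x - y|) ->
      continuous (G \o clamp 0 1).
    move=> C0 hG; apply: bounded_lipschitz_continuous; exists C => //.
    have k01 x := clamp_itv x (@ler01 R).
    split=> [x _|x y _ _] /=; first by have [] := hG _ _ (k01 x) (k01 x).
    have [_ h] := hG _ _ (k01 x) (k01 y).
    by rewrite (le_trans h)// ler_wpM2l// clamp_dist.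
  move=> i; rewrite /e; case: ifPn => [|_]; last by move=> x; exact: cvg_cst.
  case: i => [k /= kj|[j k] /= /andP[jj kj]].
    apply: (lipc _ (B1 * P)); first exact: mulr_ge0.
    move=> x y x01 y01; have [sx sl] := h1 j0 x y x01 y01; split.
      apply: (le_trans (normr_le_sum kj sx)).
      by rewrite ler_wpM2l.
    exact: (@normr_le_sum _ (fun k => interval_fun W (phi W) (phiL W) (phiR W) j0 k x -
      interval_fun W (phi W) (phiL W) (phiR W) j0 k y) _ _ _ kj sl).
  pose Q := 2 `^ (j%:R / 2) * 2 ^+ j : R.
  apply: (lipc _ (B2 * Q)).
    by rewrite mulr_ge0// mulr_ge0 ?powR_ge0 ?exprn_ge0.
  move=> x y x01 y01; have [sx sl] := h2 j x y x01 y01; split.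
    apply: (le_trans (normr_le_sum kj sx)).
    by rewrite ler_wpM2l// ler_peMr ?powR_ge0// exprn_ege1// ler1n.
  exact: (@normr_le_sum _ (fun k => interval_fun W g (psiL W) (psiR W) j k x -
      interval_fun W g (psiL W) (psiR W) j k y) _ _ _ kj sl).
- move=> i /basis_idxP ib; rewrite /e ib.
  case: i ib => [k|[j k]] /= ib.
    by apply: aeW => x x01; rewrite c01.
  have e2 : 0 < 2 ^+ j :> R by rewrite exprn_gt0.
  (* The almost everywhere identity for [psi] is pulled back along x -> 2^j x - k, under which null
     sets have null preimages; the edge functions are kept as they are. *)
  have := @ae_affine R (2 ^+ j) (- k%:R) e2 _ psig.
  apply: (@filterS _ _ (ae_filter_ringOfSetsType (@lebesgue_measure R))) => x /=.
  move=> hx x01; rewrite c01// /psi_ /interval_fun.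
  by case: ifP => // _; case: ifP => // _; rewrite /dil -hx.
- move=> x y x01 y01.
  have [] := h1 j0 x y; first by move: x01; rewrite /= in_itv.
    by move: y01; rewrite /= in_itv.
  move=> sx sl; split.
    rewrite (@eq_big_nat _ _ _ _ _ _ (fun k => `|phi_ W k x|)); last first.
      by move=> k /andP[_ kj]; rewrite /e /= kj /= c01.
    apply: (le_trans sx); rewrite -[leLHS]addr0 lerD// ler_wpM2l//.
  rewrite (@eq_big_nat _ _ _ _ _ _ (fun k => `|phi_ W k x - phi_ W k y|)); last first.
    by move=> k /andP[_ kj]; rewrite /e /= kj /= !c01.
  apply: (le_trans sl); rewrite ler_wpM2r// lerDl//.
- move=> j x y jj x01 y01.
  have [] := h2 j x y; first by move: x01; rewrite /= in_itv.
    by move: y01; rewrite /= in_itv.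
  move=> sx sl; split.
    rewrite (@eq_big_nat _ _ _ _ _ _ (fun k => `|F (inr (j, k)) x|)); last first.
      by move=> k /andP[_ kj]; rewrite /e /= jj kj /= c01.
    apply: (le_trans sx); rewrite ler_wpM2r ?powR_ge0// lerDr mulr_ge0//.
  rewrite (@eq_big_nat _ _ _ _ _ _ (fun k => `|F (inr (j, k)) x - F (inr (j, k)) y|)); last first.
    by move=> k /andP[_ kj]; rewrite /e /= jj kj /= !c01.
  apply: (le_trans sl); rewrite !ler_wpM2r//.
  by rewrite lerDr mulr_ge0.
Qed.

End regular_basis.

(** * Wavelet series *)

Section powers_of_two.
Context {R : realType}.
Implicit Types x y : R.

Lemma pow2E x : 2 `^ x = expR (x * ln 2).
Proof. by rewrite /powR pnatr_eq0. Qed.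

Lemma ln2_gt0 : 0 < ln 2 :> R. Proof. by rewrite ln_gt0// ltr1n. Qed.

Lemma ler_pow2 x y : (2 `^ x <= 2 `^ y) = (x <= y).
Proof. by rewrite !pow2E ler_expR ler_pM2r// ln2_gt0. Qed.

Lemma pow2N_lt1 x : 0 < x -> 0 < (2 : R) `^ (- x) < 1.
Proof.
move=> x0; rewrite powR_gt0//= pow2E expR_lt1 nmulr_rlt0 ?ln2_gt0// oppr_lt0//.
Qed.

End powers_of_two.

Lemma continuous_sum (R : realType) (I : Type) (s : seq I) (F : I -> R -> R) :
  (forall i, continuous (F i)) -> continuous (fun x => \sum_(i <- s) F i x).
Proof.
move=> cF; elim: s => [|i s ih] x.
  by under eq_fun do rewrite big_nil; exact: cvg_cst.
under eq_fun do rewrite big_cons.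
by apply: cvgD; [exact: cF|exact: ih].
Qed.

Section wavelet_series.
Context {R : realType} (W : wavelet_system R) (hW : cdv_system W).
Variables (e : nat + nat * nat -> R -> R) (B : R).
Hypothesis he : regular_basis W e B.
Local Notation mu := (@lebesgue_measure R).
Local Notation j0 := (wj0 W).
Local Notation I01 := (`[0, 1]%classic : set R).
Implicit Types (f : R -> R) (J l k : nat).

(** The coefficients [alpha] and [beta] under one index type, taken against the given basis to match
    the definition of the class; [thetaE] passes to the regular representatives. *)
Definition theta f (i : nat + nat * nat) : R := L2dot I01 f (basis_fun W i).

Definition idxs J : seq (nat + nat * nat) :=
  [seq inl k | k <- iota 0 (2 ^ j0)] ++
  [seq inr (l, k) | l <- iota j0 (J - j0), k <- iota 0 (2 ^ l)].

Lemma mem_idxs J i : (i \in idxs J) =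
  basis_idxb W i && (match i with inl _ => true | inr jk => (jk.1 < J)%N end).
Proof.
rewrite mem_cat; case: i => [k|[l k]] /=.
  rewrite mem_map; last by move=> ? ? [].
  rewrite mem_iota add0n andbT/=.
  by rewrite [X in _ || X](_ : _ = false) ?orbF//; apply/negP => /allpairsPdep[? [? []]].
rewrite [X in X || _](_ : _ = false)/=; last by apply/negP => /mapP[].
apply/allpairsPdep/idP => [[l' [k' [+ + [-> ->]]]]|].
  by rewrite !mem_iota; lia.
by move=> h; exists l, k; rewrite !mem_iota; split => //; lia.
Qed.

Lemma idxs_uniq J : uniq (idxs J).
Proof.
rewrite cat_uniq map_inj_uniq ?iota_uniq /=; last by move=> ? ? [].
apply/andP; split.
  by apply/hasPn => i /allpairsPdep[l [k [_ _ ->]]]; apply/negP => /mapP[].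
apply: allpairs_uniq_dep => [|l _|]; rewrite ?iota_uniq//.
by move=> [l k] [l' k'] _ _ /= [-> ->].
Qed.

Lemma idxsP J i : i \in idxs J -> basis_idx W i.
Proof. by rewrite mem_idxs => /andP[/basis_idxP]. Qed.

Lemma big_idxs J (F : nat + nat * nat -> R) :
  \sum_(i <- idxs J) F i = \sum_(0 <= k < 2 ^ j0) F (inl k) +
    \sum_(j0 <= l < J) \sum_(0 <= k < 2 ^ l) F (inr (l, k)).
Proof.
rewrite big_cat/= big_map /index_iota subn0; congr (_ + _).
rewrite big_allpairs_dep/=; apply: eq_bigr => l _.
by rewrite /index_iota subn0.
Qed.

Lemma regular_basis_L2 i : L2 I01 (e i).
Proof.
have [_ ce _ _ _] := he.
have mI : measurable I01 by exact: measurable_itv.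
have cI : {within I01, continuous (fun x => `|e i x|)}.
  apply: continuous_subspaceT => x.
  by apply: continuous_comp; [exact: ce|exact: norm_continuous].
have [c _ hc] := EVT_max (@ler01 R) cI.
apply: (@L2_bounded _ _ _ `|e i c| 1) => //.
- by apply: measurable_funTS; apply: continuous_measurable_fun; exact: ce.
- by move=> x; rewrite /= in_itv/= => /andP[x0 x1]; rewrite ger0_norm// ltNge x1.
Qed.

Let mI : measurable I01. Proof. exact: measurable_itv. Qed.

Lemma ae_seq (I : eqType) (s : seq I) (P : I -> R -> Prop) :
  (forall i, i \in s -> {ae mu, forall x, P i x}) ->
  {ae mu, forall x, forall i, i \in s -> P i x}.
Proof.
elim: s => [|i s ih] h; first exact: aeW.
have h1 := h i (mem_head _ _).
have h2 : {ae mu, forall x, forall i, i \in s -> P i x}.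
  by apply: ih => j js; apply: h; rewrite in_cons js orbT.
move: h1 h2; apply: (@filterS2 _ _ (ae_filter_ringOfSetsType (@lebesgue_measure R))).
by move=> x h1 h2 j; rewrite in_cons => /orP[/eqP ->//|]; exact: h2.
Qed.

Lemma L2_basis i : basis_idx W i -> L2 I01 (basis_fun W i).
Proof. by case: hW => _ _ _ _ [[L _] _ _]; exact: L. Qed.

Lemma thetaE f i : L2 I01 f -> basis_idx W i -> theta f i = L2dot I01 f (e i).
Proof.
move=> Lf ib; have [_ _ ee _ _] := he.
congr fine; apply: ae_eq_integral => //.
- exact: measurable_int (L2_integrableM mI Lf (L2_basis ib)).
- exact: measurable_int (L2_integrableM mI Lf (regular_basis_L2 i)).
move: (ee i ib).
apply: (@filterS _ _ (ae_filter_ringOfSetsType (@lebesgue_measure R))) => x /=.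
by move=> h x01; rewrite h.
Qed.

Definition partial_sum f J : R -> R := fun x => \sum_(i <- idxs J) theta f i * e i x.

Lemma partial_sum_continuous f J : continuous (partial_sum f J).
Proof.
have [_ ce _ _ _] := he; apply: continuous_sum => i x.
by apply: cvgM; [exact: cvg_cst|exact: ce].
Qed.

Lemma partial_sum_L2 f J : L2 I01 (partial_sum f J).
Proof. by apply: L2_sum => i _; exact/L2Z/regular_basis_L2. Qed.

(** The finite set supplied by the closed span is enlarged to all indices below some level [J'],
    which the projection bound allows. *)
Lemma partial_sum_cvg f (d : R) J : L2 I01 f -> 0 < d ->
  exists2 J', (J <= J')%N &
    L2dot I01 (f \- partial_sum f J') (f \- partial_sum f J') < d ^+ 2.
Proof.
move=> Lf d0; have [_ _ _ _ [oA _ spanA]] := hW.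
have [s sA hs] := closed_span_proj_cvg mI oA (spanA _ Lf) d0.
(* One more than the level, since [idxs J'] stops strictly below [J']. *)
pose lev (i : nat + nat * nat) := match i with inl _ => 0%N | inr jk => jk.1.+1 end.
pose J' := maxn J (\max_(i <- s) lev i).
exists J'; first exact: leq_maxl.
have <- : L2dot I01 (f \- proj I01 (basis_fun W) f (idxs J'))
    (f \- proj I01 (basis_fun W) f (idxs J')) =
    L2dot I01 (f \- partial_sum f J') (f \- partial_sum f J').
  have Lp : L2 I01 (f \- proj I01 (basis_fun W) f (idxs J')).
    by apply: L2B => //; apply: (L2_comb oA) => i; exact: idxsP.
  have Lq : L2 I01 (f \- partial_sum f J') by apply: L2B => //; exact: partial_sum_L2.
  congr fine; apply: ae_eq_integral => //.
  - exact: measurable_int (L2_integrableM mI Lp Lp).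
  - exact: measurable_int (L2_integrableM mI Lq Lq).
  have [_ _ ee _ _] := he.
  have := @ae_seq _ (idxs J') (fun i x => I01 x -> basis_fun W i x = e i x)
    (fun i h => ee i (idxsP h)).
  apply: (@filterS _ _ (ae_filter_ringOfSetsType (@lebesgue_measure R))) => x /=.
  move=> h x01; rewrite /proj /partial_sum.
  by under eq_big_seq => i iJ do rewrite h//.
apply: hs; first exact: idxs_uniq.
- by move=> i; exact: idxsP.
- move=> i iS; rewrite mem_idxs; apply/andP; split; first exact/basis_idxP/sA.
  case: i iS => // jk iS; rewrite /J' leq_max; apply/orP; right.
  exact: (@leq_bigmax_seq _ s xpredT lev (inr jk) iS isT).
Qed.

Lemma Cs_alpha s M f k : Cs W s M f -> (k < 2 ^ j0)%N -> `|theta f (inl k)| <= M.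
Proof.
move=> [_ _]; rewrite /Cs_norm ge_max => /andP[h _] k0.
by rewrite -lee_fin (le_trans _ h)//; apply: ereal_sup_ubound; exists k.
Qed.

Lemma Cs_beta s M f j k : Cs W s M f -> (j0 <= j)%N -> (k < 2 ^ j)%N ->
  `|theta f (inr (j, k))| <= M * 2 `^ (- (j%:R * (s + 1 / 2))).
Proof.
move=> [_ _]; rewrite /Cs_norm ge_max => /andP[_ h] jj kj.
rewrite powRN ler_pdivlMr ?powR_gt0// mulrC.
rewrite -lee_fin (le_trans _ h)//; apply: ereal_sup_ubound.
by exists (j, k) => //=; rewrite jj kj.
Qed.

Lemma geometric_window (q : R) J J' : 0 < q < 1 ->
  \sum_(J <= l < J') q ^+ l <= q ^+ J / (1 - q).
Proof.
move=> /andP[q0 q1]; have q1' : 0 < 1 - q by lra.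
have [JJ|/ltnW JJ] := leqP J' J.
  by rewrite big_geq// divr_ge0 ?exprn_ge0 ?ltW.
rewrite ler_pdivlMr//.
suff -> : (\sum_(J <= l < J') q ^+ l) * (1 - q) = q ^+ J - q ^+ J'.
  by rewrite lerBlDr lerDl exprn_ge0 ?ltW.
rewrite -(subnKC JJ); elim: (J' - J)%N => [|n ih].
  by rewrite addn0 big_geq// mul0r subrr.
rewrite addnS big_nat_recr ?leq_addr//= mulrDl ih exprS; ring.
Qed.

(** Coefficients of size 2^(-l(s+1/2)) meet basis functions of size 2^(l/2), so level [l]
    contributes 2^(-ls) in supremum norm. *)
Lemma powR_half (l : nat) (s : R) :
  2 `^ (- (l%:R * (s + 1 / 2))) * 2 `^ (l%:R / 2) = (2 `^ (- s)) ^+ l.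
Proof.
rewrite -powRD ?pnatr_eq0 ?implybT// -powR_mulrn ?powR_ge0// -powRrM.
by congr (_ `^ _); lra.
Qed.

Let B0 : 0 <= B. Proof. by have [] := he. Qed.

Lemma level_bound (c : nat -> R) (C : R) l x : 0 <= C -> (j0 <= l)%N -> I01 x ->
    (forall k, (k < 2 ^ l)%N -> `|c k| <= C) ->
  `|\sum_(0 <= k < 2 ^ l) c k * e (inr (l, k)) x| <= C * (B * 2 `^ (l%:R / 2)).
Proof.
move=> C0 jl x01 hc; have [_ _ _ _ /(_ l x x jl x01 x01)[h _]] := he.
rewrite (le_trans (ler_norm_sum _ _ _))//.
apply: (@le_trans _ _ (\sum_(0 <= k < 2 ^ l) C * `|e (inr (l, k)) x|)).
  by apply: ler_sum_nat => k /andP[_ kl]; rewrite normrM ler_wpM2r// hc.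
by rewrite -mulr_sumr ler_wpM2l.
Qed.

Lemma coarse_bound (c : nat -> R) (C : R) x : 0 <= C -> I01 x ->
    (forall k, (k < 2 ^ j0)%N -> `|c k| <= C) ->
  `|\sum_(0 <= k < 2 ^ j0) c k * e (inl k) x| <= C * B.
Proof.
move=> C0 x01 hc; have [_ _ _ /(_ x x x01 x01)[h _] _] := he.
rewrite (le_trans (ler_norm_sum _ _ _))//.
apply: (@le_trans _ _ (\sum_(0 <= k < 2 ^ j0) C * `|e (inl k) x|)).
  by apply: ler_sum_nat => k /andP[_ kl]; rewrite normrM ler_wpM2r// hc.
by rewrite -mulr_sumr ler_wpM2l.
Qed.

Lemma partial_sumB f J J' x : (j0 <= J)%N -> (J <= J')%N ->
  partial_sum f J' x - partial_sum f J x = \sum_(J <= l < J')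
    \sum_(0 <= k < 2 ^ l) theta f (inr (l, k)) * e (inr (l, k)) x.
Proof.
move=> jJ JJ; rewrite /partial_sum !big_idxs.
rewrite (big_cat_nat jJ JJ)/=; ring.
Qed.

Lemma Cs_ge0 s M f : Cs W s M f -> 0 <= M.
Proof.
move=> h; have k0 : (0 < 2 ^ j0)%N by rewrite expn_gt0.
by apply: le_trans (Cs_alpha h k0).
Qed.

Lemma partial_sum_tail s M f J J' x : 0 < s -> Cs W s M f -> (j0 <= J)%N ->
    (J <= J')%N -> I01 x ->
  `|partial_sum f J' x - partial_sum f J x| <=
    B * M * ((2 `^ (- s)) ^+ J / (1 - 2 `^ (- s))).
Proof.
move=> s0 Cf jJ JJ x01; rewrite partial_sumB//.
have M0 := Cs_ge0 Cf.
have q01 := pow2N_lt1 s0.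
rewrite (le_trans (ler_norm_sum _ _ _))//.
apply: (@le_trans _ _ (\sum_(J <= l < J') B * M * (2 `^ (- s)) ^+ l)); last first.
  by rewrite -mulr_sumr ler_wpM2l ?mulr_ge0// geometric_window.
apply: ler_sum_nat => l /andP[Jl _].
have jl : (j0 <= l)%N by exact: leq_trans jJ Jl.
apply: (le_trans (@level_bound _ (M * 2 `^ (- (l%:R * (s + 1 / 2)))) l x _ jl x01 _)).
- by rewrite mulr_ge0 ?powR_ge0.
- by move=> k kl; exact: (Cs_beta Cf).
by rewrite -powR_half le_eqVlt; apply/orP; left; apply/eqP; ring.
Qed.

Lemma L2dot_ge_itv (h : R -> R) (a b c : R) : L2 I01 h -> 0 <= a -> a < b -> b <= 1 ->
    0 <= c -> (forall x, a <= x <= b -> c <= `|h x|) ->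
  c ^+ 2 * (b - a) <= L2dot I01 h h.
Proof.
move=> Lh a0 ab b1 c0 hc.
have sub : `[a, b]%classic `<=` I01.
  by move=> x; rewrite /= !in_itv/= => /andP[ax xb]; apply/andP; split; lra.
have ih := L2_integrableM mI Lh Lh.
rewrite -lee_fin /L2dot /Rintegral fineK ?integrable_fin_num//.
apply: (@le_trans _ _ (\int[mu]_(x in `[a, b]) (h x * h x)%:E)%E); last first.
  apply: ge0_subset_integral => //; first exact: measurable_int ih.
  by move=> x _; rewrite lee_fin -expr2 sqr_ge0.
apply: (@le_trans _ _ (\int[mu]_(x in `[a, b]) (cst (c ^+ 2)%:E) x)%E).
  by rewrite integral_cst// [X in (_ <= _ * X)%E]lebesgue_measure_itv/= lte_fin ab -EFinB -EFinM.
apply: ge0_le_integral => //.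
- by move=> x _; rewrite /= lee_fin sqr_ge0.
- by apply: measurable_funS (measurable_int mu ih).
- move=> x; rewrite /= in_itv/= => xab; rewrite lee_fin -expr2.
  by rewrite -[leRHS]real_normK ?num_real// ler_pXn2r// ?nnegrE// hc.
Qed.

Lemma within_continuous_dist (A : set R) (f : R -> R) x (d : R) :
    {within A, continuous f} -> A x -> 0 < d ->
  exists2 r, 0 < r & forall y, A y -> `|x - y| < r -> `|f x - f y| < d.
Proof.
move=> /subspace_continuousP cf Ax d0.
have /cvgrPdist_lt /(_ d d0) := cf x Ax.
rewrite near_withinE => /nbhs_ballP[r /= r0 hr].
by exists r => // y Ay xy; exact: hr.
Qed.

(** The interval is one-sided and directed into [0, 1], which covers the endpoints as well. *)
Lemma unit_subinterval (x r : R) : I01 x -> 0 < r ->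
  exists a b, [/\ 0 <= a, a < b, b <= 1 &
    forall y, a <= y <= b -> `|x - y| < r].
Proof.
rewrite /= in_itv/= => /andP[x0 x1] r0.
pose w := Num.min r 1 / 2.
have [w0 wr w1] : [/\ 0 < w, w < r & w <= 1 / 2].
  by rewrite /w; case: (leP r 1) => ?; split; lra.
have [xh|xh] := leP x (1 / 2).
  exists x, (x + w); split; [lra|lra|lra|move=> y yb].
  by rewrite ler0_norm; lra.
exists (x - w), x; split; [lra|lra|lra|move=> y yb].
by rewrite ger0_norm; lra.
Qed.

(** If the bound failed at [x], continuity would make it fail by a margin on a whole interval, and
    by [partial_sum_tail] all later partial sums would stay away from [f] there. This contradicts
    convergence in L^2. *)
Lemma series_tail s M f J x : 0 < s -> Cs W s M f -> (j0 <= J)%N -> I01 x ->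
  `|f x - partial_sum f J x| <=
    B * M * ((2 `^ (- s)) ^+ J / (1 - 2 `^ (- s))).
Proof.
move=> s0 Cf jJ x01; set t := (X in _ <= X); rewrite leNgt; apply/negP => tx.
have [Lf cf _] := Cf.
pose h y := f y - partial_sum f J y.
have ch : {within I01, continuous h}.
  move=> y; apply: cvgB; first exact: cf.
  exact: (continuous_subspaceT (@partial_sum_continuous f J)).
(* Half of the excess over [t]: continuity costs less than [d], so a distance of at least [d]
   remains nearby. *)
pose d := (`|h x| - t) / 2.
have d0 : 0 < d by rewrite divr_gt0// subr_gt0.
have [r r0 hr] := within_continuous_dist ch x01 d0.
have far y J' : (J <= J')%N -> I01 y -> `|x - y| < r -> d <= `|f y - partial_sum f J' y|.
  move=> JJ y01 xy.
  have h1 := hr y y01 xy.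
  have h2 := partial_sum_tail s0 Cf jJ JJ y01.
  have h3 := ler_dist_dist (h x) (h y).
  have h4 : `|h y| <= `|f y - partial_sum f J' y| +
      `|partial_sum f J' y - partial_sum f J y|.
    by rewrite (le_trans _ (ler_normD _ _))// addrA subrK.
  move: (ler_norm (`|h x| - `|h y|)) => h5.
  have : `|h x| = t + 2 * d by rewrite /d; lra.
  rewrite -/t in h2; lra.
have [a [b [a0 ab b1 hab]]] := unit_subinterval x01 r0.
pose c := d * Num.sqrt (b - a).
have c0 : 0 < c by rewrite mulr_gt0// sqrtr_gt0 subr_gt0.
have [J' JJ] := partial_sum_cvg J Lf c0.
apply/negP; rewrite -leNgt /c exprMn sqr_sqrtr ?subr_ge0 ?(ltW ab)//.
apply: L2dot_ge_itv => //.
- by apply: L2B => //; exact: partial_sum_L2.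
- exact: ltW.
- move=> y yab /=; apply: far => //; last exact: hab.
  by rewrite /= in_itv/=; apply/andP; split; lra.
Qed.

End wavelet_series.

(** * Bounds that are uniform over the smoothness classes *)

Section function_class.
Context {R : realType} (W : wavelet_system R) (hW : cdv_system W).
Variables (e : nat + nat * nat -> R -> R) (B : R).
Hypothesis he : regular_basis W e B.
Variables (smin : R).
Hypothesis smin0 : 0 < smin.
Local Notation j0 := (wj0 W).
Local Notation I01 := (`[0, 1]%classic : set R).
Implicit Types (f : R -> R) (J l k n : nat).

(** The geometric factor is taken at [smin], which makes the constant uniform over s >= smin. *)
Definition tail_const : R := B / (1 - 2 `^ (- smin)).

Let B0 : 0 <= B. Proof. by have [] := he. Qed.

Lemma tail_const_ge0 : 0 <= tail_const.
Proof.
by have /andP[_ q1] := pow2N_lt1 smin0; rewrite divr_ge0// subr_ge0 ltW.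
Qed.

Lemma series_tail_unif s M f J x : smin <= s -> Cs W s M f -> (j0 <= J)%N ->
  I01 x ->
  `|f x - partial_sum W e f J x| <= tail_const * M * 2 `^ (- (J%:R * s)).
Proof.
move=> ss Cf jJ x01; have s0 : 0 < s by exact: lt_le_trans ss.
apply: (le_trans (series_tail hW he s0 Cf jJ x01)).
have M0 := Cs_ge0 Cf.
have /andP[q0 q1] := pow2N_lt1 smin0.
have -> : (2 `^ (- s)) ^+ J = 2 `^ (- (J%:R * s)).
  by rewrite -powR_mulrn ?powR_ge0// -powRrM; congr (_ `^ _); ring.
rewrite /tail_const mulrCA [leRHS]mulrC ler_wpM2l ?powR_ge0//.
rewrite mulrAC ler_wpM2r// ler_wpM2l// lef_pV2 ?posrE ?subr_gt0//; last first.
  by have /andP[] := pow2N_lt1 s0.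
by rewrite lerB// ler_pow2 lerN2.
Qed.

Lemma Cs_bounded s M f x : smin <= s -> Cs W s M f -> I01 x ->
  `|f x| <= (B + tail_const) * M.
Proof.
move=> ss Cf x01; have M0 := Cs_ge0 Cf.
have h := series_tail_unif ss Cf (leqnn _) x01.
rewrite -(subrK (partial_sum W e f j0 x) (f x)).
rewrite (le_trans (ler_normD _ _))// addrC mulrDl lerD//.
  rewrite /partial_sum big_idxs [X in _ + X]big_geq// addr0 mulrC.
  by apply: (coarse_bound he) => // k kj; exact: (Cs_alpha Cf).
rewrite (le_trans h)// ler_piMr ?(mulr_ge0 tail_const_ge0)//.
rewrite -[leRHS](powRr0 2) ler_pow2 oppr_le0 mulr_ge0//.
exact: le_trans (ltW smin0) ss.
Qed.

Lemma geometric_sum_gt1 (q : R) J J' : 1 < q ->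
  \sum_(J <= l < J') q ^+ l <= q ^+ J' / (q - 1).
Proof.
move=> q1; have q10 : 0 < q - 1 by lra.
have q0 : 0 <= q by lra.
have [JJ|/ltnW JJ] := leqP J' J.
  by rewrite big_geq// divr_ge0 ?exprn_ge0// ltW.
rewrite ler_pdivlMr//.
suff -> : (\sum_(J <= l < J') q ^+ l) * (q - 1) = q ^+ J' - q ^+ J.
  by rewrite lerBlDr lerDl exprn_ge0.
rewrite -(subnKC JJ); elim: (J' - J)%N => [|n ih].
  by rewrite addn0 big_geq// mul0r subrr.
rewrite addnS big_nat_recr ?leq_addr//= mulrDl ih exprS; ring.
Qed.

Definition modulus_const : R :=
  B + B * 2 `^ ((j0.+1)%:R / 2) / (2 `^ (1 / 2) - 1) + 2 * tail_const.

(** For s >= 1/2 level [l] has a Lipschitz constant of order 2^(-l(s+1/2)) 2^(l/2) 2^l <= 2^(l/2),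
    and these sum geometrically up to 2^(J/2). *)
Lemma partial_sum_dist s M f J x y : 1 / 2 <= s -> Cs W s M f ->
  I01 x -> I01 y ->
  `|partial_sum W e f J x - partial_sum W e f J y| <=
  M * B * `|x - y| * (1 + 2 `^ (J%:R / 2) / (2 `^ (1 / 2) - 1)).
Proof.
move=> s12 Cf x01 y01; have M0 := Cs_ge0 Cf.
have [_ _ _ hc hl] := he.
rewrite /partial_sum -sumrB; under eq_bigr do rewrite -mulrBr.
rewrite big_idxs (le_trans (ler_normD _ _))// mulrDr mulr1 lerD//.
  rewrite (le_trans (ler_norm_sum _ _ _))//.
  apply: (@le_trans _ _ (\sum_(0 <= k < 2 ^ j0) M * `|e (inl k) x - e (inl k) y|)).
    by apply: ler_sum_nat => k /andP[_ kl]; rewrite normrM ler_wpM2r// (Cs_alpha Cf).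
  by rewrite -mulr_sumr -mulrA ler_wpM2l//; have [] := hc x y x01 y01.
rewrite (le_trans (ler_norm_sum _ _ _))//.
have r1 : 1 < 2 `^ (1 / 2) :> R.
  by rewrite -[ltLHS](powRr0 2) !pow2E ltr_expR ltr_pM2r ?ln2_gt0//; lra.
have powE (l : nat) : (2 `^ (1 / 2)) ^+ l = 2 `^ (l%:R / 2) :> R.
  by rewrite -powR_mulrn ?powR_ge0// -powRrM; congr (_ `^ _); ring.
apply: (@le_trans _ _ (\sum_(j0 <= l < J) M * B * `|x - y| * (2 `^ (1 / 2)) ^+ l)); last first.
  rewrite -mulr_sumr ler_wpM2l ?mulr_ge0// -powE.
  exact: geometric_sum_gt1.
apply: ler_sum_nat => l /andP[jl _].
rewrite (le_trans (ler_norm_sum _ _ _))//.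
apply: (@le_trans _ _ (\sum_(0 <= k < 2 ^ l) M * 2 `^ (- (l%:R * (s + 1 / 2))) *
    `|e (inr (l, k)) x - e (inr (l, k)) y|)).
  apply: ler_sum_nat => k /andP[_ kl].
  by rewrite normrM ler_wpM2r// (Cs_beta Cf).
rewrite -mulr_sumr.
have [_ h] := hl l x y jl x01 y01.
apply: (le_trans (ler_wpM2l _ h)); first by rewrite mulr_ge0 ?powR_ge0.
rewrite powE.
rewrite [leLHS](_ : _ = M * B * `|x - y| * (2 `^ (- (l%:R * (s + 1 / 2))) *
  2 `^ (l%:R / 2) * 2 ^+ l)); last by ring.
rewrite ler_wpM2l ?mulr_ge0// -powR_mulrn// -!powRD ?pnatr_eq0 ?implybT//.
rewrite ler_pow2.
have : l%:R * (1 / 2) <= l%:R * s by rewrite ler_wpM2l.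
lra.
Qed.

(** Truncation at 2^J of order n balances two parts: the tails are of order at most 2^(-J/2), and
    the partial sum varies over a distance 1/n by at most the order of 2^(J/2) / n. Both are
    n^(-1/2). This controls the discretisation bias in regression. *)
Lemma Cs_modulus s M f n x y : 1 / 2 <= s -> smin <= s -> Cs W s M f ->
    (0 < n)%N -> I01 x -> I01 y -> `|x - y| <= n%:R^-1 ->
  `|f x - f y| <= modulus_const * M / Num.sqrt n%:R.
Proof.
move=> s12 ss Cf n0 x01 y01 xy; have M0 := Cs_ge0 Cf.
pose J := (j0 + (trunc_log 2 n).+1)%N.
have jJ : (j0 <= J)%N by exact: leq_addr.
have hx := series_tail_unif ss Cf jJ x01.
have hy := series_tail_unif ss Cf jJ y01.
have hd := partial_sum_dist J s12 Cf x01 y01.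
have /andP[tn nt] := trunc_log_bounds (isT : 1 < 2)%N n0.
have nR : 0 < n%:R :> R by rewrite ltr0n.
have sn0 : 0 < Num.sqrt n%:R :> R by rewrite sqrtr_gt0.
have t1 : 2 `^ (- (J%:R * s)) <= (Num.sqrt n%:R)^-1 :> R.
  rewrite powRN lef_pV2 ?posrE ?powR_gt0//.
  apply: (@le_trans _ _ (2 `^ (J%:R / 2))); last first.
    by rewrite ler_pow2 ler_wpM2l//; lra.
  rewrite powRrM powR12_sqrt ?powR_ge0// ler_wsqrtr// powR_mulrn// -natrX ler_nat.
  by rewrite /J expnD (leq_trans (ltnW nt))// leq_pmull// expn_gt0.
have t2 : 2 `^ (J%:R / 2) <= 2 `^ (j0.+1%:R / 2) * Num.sqrt n%:R :> R.
  rewrite [in leLHS]powRrM [in leRHS]powRrM !powR12_sqrt ?powR_ge0//.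
  rewrite -sqrtrM ?powR_ge0// ler_wsqrtr// !powR_mulrn// -!natrX -natrM ler_nat.
  by rewrite /J addnS -addSn expnD leq_mul2l tn orbT.
have xn : `|x - y| <= (Num.sqrt n%:R)^-1 * (Num.sqrt n%:R)^-1.
  by rewrite -invfM -expr2 sqr_sqrtr// ltW.
have sn1 : (Num.sqrt n%:R)^-1 <= 1 :> R.
  rewrite invf_le1// -[leLHS]sqrtr1 ler_wsqrtr// ler1n//.
have r1 : 0 < 2 `^ (1 / 2) - 1 :> R.
  by rewrite subr_gt0 -[ltLHS](powRr0 2) !pow2E ltr_expR ltr_pM2r ?ln2_gt0//; lra.
have T0 := tail_const_ge0.
set v := (Num.sqrt n%:R)^-1 in t1 xn sn1 *.
have v0 : 0 < v by rewrite invr_gt0.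
have key : `|x - y| * (1 + 2 `^ (J%:R / 2) / (2 `^ (1 / 2) - 1)) <=
    v * (1 + 2 `^ (j0.+1%:R / 2) / (2 `^ (1 / 2) - 1)).
  rewrite !mulrDr !mulr1 lerD//.
    by rewrite (le_trans xn)// ler_piMr// ltW.
  rewrite !mulrA ler_wpM2r ?invr_ge0 ?(ltW r1)//.
  apply: (@le_trans _ _ (v * v * (2 `^ (j0.+1%:R / 2) * Num.sqrt n%:R))).
    by apply: ler_pM; rewrite ?powR_ge0.
  rewrite [leLHS](_ : _ = v * 2 `^ (j0.+1%:R / 2) * (v * Num.sqrt n%:R)).
    by rewrite mulVf ?mulr1 ?gt_eqF.
  by ring.
have h4 : `|f x - f y| <= `|f x - partial_sum W e f J x| +
  `|f y - partial_sum W e f J y| + `|partial_sum W e f J x - partial_sum W e f J y|.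
  rewrite [X in _ <= X + _](_ : _ = `|f x - partial_sum W e f J x| +
      `|partial_sum W e f J y - f y|); last by rewrite (distrC (f y)).
  rewrite [X in `|X|](_ : _ = (f x - partial_sum W e f J x) +
    (partial_sum W e f J y - f y) + (partial_sum W e f J x - partial_sum W e f J y));
    last by ring.
  by rewrite (le_trans (ler_normD _ _))// lerD2r// ler_normD.
have h5 : tail_const * M * 2 `^ (- (J%:R * s)) <= tail_const * M * v.
  by rewrite ler_wpM2l// mulr_ge0.
have h6 := ler_wpM2l (mulr_ge0 M0 B0) key; rewrite mulrA in h6.
rewrite /modulus_const mulrAC -/v.
rewrite [leRHS](_ : _ = M * B * (v * (1 + 2 `^ (j0.+1%:R / 2) / (2 `^ (1 / 2) - 1)))
  + 2 * (tail_const * M * v)); first by lra.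
by ring.
Qed.

End function_class.

(** * Self-similarity *)

Section self_similarity.
Context {R : realType} (W : wavelet_system R) (hW : cdv_system W).
Local Notation j0 := (wj0 W).
Local Notation I01 := (`[0, 1]%classic : set R).
Implicit Types (f : R -> R) (i j l k n : nat).

Definition block_idxs i j : seq (nat + nat * nat) :=
  (if i == j0 then [seq inl k | k <- iota 0 (2 ^ j0)] else [::]) ++
  [seq inr (l, k) | l <- index_iota i j.+1, k <- iota 0 (2 ^ l)].

Definition weight (s : R) (i : nat + nat * nat) : R :=
  match i with inl _ => 1 | inr jk => 2 `^ (jk.1%:R * (s + 1 / 2)) end.

Lemma mem_block_idxs i j a : (a \in block_idxs i j) =
  match a with
  | inl k => (i == j0) && (k < 2 ^ j0)%N
  | inr jk => (i <= jk.1 <= j)%N && (jk.2 < 2 ^ jk.1)%N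
  end.
Proof.
rewrite mem_cat; case: a => [k|[l k]] /=.
  rewrite [X in _ || X](_ : _ = false) ?orbF; last first.
    by apply/negP => /allpairsPdep[? [? []]].
  case: eqP => //= _; rewrite mem_map; last by move=> ? ? [].
  by rewrite mem_iota add0n.
rewrite [X in X || _](_ : _ = false)/=; last first.
  by case: eqP => // _; apply/negP => /mapP[].
apply/allpairsPdep/idP => [[l' [k' [+ + [-> ->]]]]|].
  by rewrite mem_index_iota mem_iota; lia.
by move=> h; exists l, k; rewrite mem_index_iota mem_iota; split => //; lia.
Qed.

Lemma block_idxs_uniq i j : uniq (block_idxs i j).
Proof.
rewrite cat_uniq; apply/and3P; split.
- by case: eqP => // _; rewrite map_inj_uniq ?iota_uniq// => ? ? [].
- apply/hasPn => a /allpairsPdep[l [k [_ _ ->]]].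
  by case: eqP => // _; apply/negP => /mapP[].
- apply: allpairs_uniq_dep => [|l _|]; rewrite ?iota_uniq//.
  by move=> [l k] [l' k'] _ _ /= [-> ->].
Qed.

Lemma block_idxsP i j a : (j0 <= i)%N -> a \in block_idxs i j -> basis_idx W a.
Proof.
move=> ij; rewrite mem_block_idxs; case: a => [k /andP[]//|[l k] /=].
by move=> /andP[/andP[il _] kl]; rewrite /= kl (leq_trans ij il).
Qed.

Lemma blockE f i j : block W f i j =
  fun x => \sum_(a <- block_idxs i j) theta W f a * basis_fun W a x.
Proof.
apply/funext => x; rewrite /block big_cat/=; congr (_ + _).
  case: eqP => _; last by rewrite big_nil.
  by rewrite big_map /index_iota subn0.
by rewrite big_allpairs_dep/=; apply: eq_bigr => l _; rewrite /index_iota subn0.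
Qed.

Lemma theta_block f i j a : (j0 <= i)%N -> basis_idx W a ->
  theta W (block W f i j) a = if a \in block_idxs i j then theta W f a else 0.
Proof.
have mI : measurable I01 by exact: measurable_itv.
have [_ _ _ _ [oA _ _]] := hW.
move=> ij ia; rewrite /theta blockE (L2dot_comb mI oA)//.
  exact: block_idxs_uniq.
by move=> b; exact: block_idxsP.
Qed.

(** The norm is a supremum over infinitely many indices, but only those of the block carry nonzero
    coefficients. If all their weighted sizes were below [c], so would be their maximum [m], which
    bounds the norm; [c > 0] takes care of the vanishing coefficients. *)
Lemma block_large_coef s f i j (c : R) : (j0 <= i)%N -> 0 < c ->
    (c%:E <= Cs_norm W s (block W f i j))%E ->
  exists2 a, a \in block_idxs i j & c <= weight s a * `|theta W f a|.
Proof.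
move=> ij c0 h; apply: contrapT => nex.
have small a : a \in block_idxs i j -> weight s a * `|theta W f a| < c.
  by move=> ab; rewrite ltNge; apply/negP => ca; apply: nex; exists a.
pose F a := weight s a * `|theta W f a|.
pose m := \big[Num.max/0]_(a <- block_idxs i j) F a.
have mc : m < c.
  by rewrite /m big_seq; apply: bigmax_lt => // a ai; exact: small.
have m0 : 0 <= m by exact: bigmax_ge_id.
have Fm a : a \in block_idxs i j -> F a <= m.
  by move=> ai; rewrite /m; exact: (le_bigmax_seq 0 a xpredT F ai isT).
have le_m a : basis_idx W a -> weight s a * `|theta W (block W f i j) a| <= m.
  move=> ia; rewrite theta_block//; case: ifPn => [|_]; first exact: Fm.
  by rewrite normr0 mulr0.
suff : (Cs_norm W s (block W f i j) <= m%:E)%E.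
  by move=> /(le_trans h); rewrite lee_fin leNgt mc.
rewrite /Cs_norm ge_max; apply/andP; split; apply: ge_ereal_sup.
  move=> _ [k /= kj <-]; rewrite lee_fin.
  by have := le_m (inl k) kj; rewrite mul1r.
by move=> _ [[l k] /= lk <-]; rewrite lee_fin; exact: (le_m (inr (l, k)) lk).
Qed.

End self_similarity.

(** * Deviation inequalities *)

Section measurable_comparison.
Context d (T : measurableType d) (R : realType).
Implicit Types f g : T -> R.

Lemma measurable_le_set f g : measurable_fun setT f -> measurable_fun setT g ->
  measurable [set x | f x <= g x].
Proof.
move=> mf mg; have /(_ measurableT [set true]) := measurable_fun_ler mf mg.
rewrite setTI (_ : _ @^-1` _ = [set x | f x <= g x]); first exact.
by apply/seteqP; split.
Qed.

Lemma measurable_lt_set f g : measurable_fun setT f -> measurable_fun setT g ->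
  measurable [set x | f x < g x].
Proof.
move=> mf mg; have /(_ measurableT [set true]) := measurable_fun_ltr mf mg.
rewrite setTI (_ : _ @^-1` _ = [set x | f x < g x]); first exact.
by apply/seteqP; split.
Qed.

End measurable_comparison.

(** * Integration against a measure given by a density *)

Section density_change_of_measure.
Context d (T : measurableType d) (R : realType).
Variables (mu nu : {measure set T -> \bar R}) (p : T -> R).
Hypotheses (mp : measurable_fun setT p) (p0 : forall x, 0 <= p x).
Hypothesis nuE : forall A, measurable A -> nu A = (\int[mu]_(x in A) (p x)%:E)%E.
Local Open Scope ereal_scope.

Import HBNNSimple.

(** Simple functions reduce to [nuE], and monotone convergence does the rest. The lemma serves both
    the normal law and the law with density f. *)
Lemma ge0_integral_density (f : T -> \bar R) : measurable_fun setT f ->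
    (forall x, 0 <= f x) ->
  \int[nu]_x f x = \int[mu]_x (f x * (p x)%:E).
Proof.
move=> mf f0; pose h := nnsfun_approx measurableT mf.
have mpE : measurable_fun setT (EFin \o p) by exact/measurable_EFinP.
have mhE n : measurable_fun setT (EFin \o h n).
  by apply/measurable_EFinP; exact: measurable_funP.
have hf x : f x = limn (fun n => (EFin \o h n) x).
  by apply/esym/cvg_lim => //; exact: cvg_nnsfun_approx.
have nuh : \int[nu]_x f x = limn (fun n => \int[nu]_x (EFin \o h n) x).
  under eq_integral do rewrite hf.
  apply: monotone_convergence => //.
  - by move=> n x _; rewrite lee_fin.
  - by move=> x _ a b ab; rewrite lee_fin; exact/lefP/nd_nnsfun_approx.
have muh : \int[mu]_x (f x * (p x)%:E) =
    limn (fun n => \int[mu]_x ((EFin \o h n) x * (p x)%:E)).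
  have hfp x : f x * (p x)%:E = limn (fun n => (EFin \o h n) x * (p x)%:E).
    apply/esym/cvg_lim => //; apply: cvgeZr => //.
    exact: cvg_nnsfun_approx.
  under eq_integral do rewrite hfp.
  apply: monotone_convergence => //.
  - by move=> n; apply: emeasurable_funM => //; exact: mhE.
  - by move=> n x _; rewrite mule_ge0// lee_fin.
  - move=> x _ a b ab; rewrite lee_wpmul2r ?lee_fin//.
    exact/lefP/nd_nnsfun_approx.
rewrite nuh muh; congr (lim (_ @ \oo)); apply/funext => n.
transitivity (\int[nu]_x (\sum_(y \in range (h n)) (y * \1_(h n @^-1` [set y]) x)%:E)).
  by apply: eq_integral => x _; rewrite /= fimfunE -fsumEFin.
have mind (y : R) : measurable_fun setT (fun x => (y * \1_(h n @^-1` [set y]) x)%:E).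
  apply/measurable_EFinP/measurable_funM => //.
rewrite ge0_integral_fsum//; last by move=> y x _; exact: nnfun_muleindic_ge0.
transitivity (\int[mu]_x (\sum_(y \in range (h n))
    (y * \1_(h n @^-1` [set y]) x)%:E * (p x)%:E)); last first.
  apply: eq_integral => x _; rewrite -ge0_mule_fsuml; last first.
    by move=> y; exact: nnfun_muleindic_ge0.
  by rewrite /= [in RHS]fimfunE -fsumEFin.
rewrite ge0_integral_fsum//; last 2 first.
  - by move=> y; apply: emeasurable_funM.
  - by move=> y x _; rewrite mule_ge0 ?EFinM ?nnfun_muleindic_ge0// lee_fin.
apply: eq_fsbigr => y yr.
have y0 : (0 <= y)%R by move: yr; rewrite inE => -[t _ <-].
have mA : measurable (h n @^-1` [set y]) by [].
under eq_integral do rewrite EFinM.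
rewrite integralZl_indic_nnsfun//.
under [RHS]eq_integral do rewrite EFinM -muleA.
rewrite ge0_integralZl//; last 2 first.
- by apply: emeasurable_funM => //; apply/measurable_EFinP.
- by move=> x _; rewrite mule_ge0 ?lee_fin.
rewrite integral_indic// setIT nuE//; congr (_ * _).
rewrite integral_mkcond; apply: eq_integral => x _.
rewrite patchE indicE; case: ifP => _; rewrite ?mul1e ?mul0e//.
Qed.

End density_change_of_measure.

(** * Exponential bounds for independent observations *)

Section iid_law_integrals.
Context d (T : measurableType d) (R : realType) (P : probability T R).
Local Open Scope ereal_scope.

(** Independence for the recursively built law: Tonelli splits off the head of the tuple, and
    induction handles its tail. *)
Lemma integral_iid_law_prod n (g : 'I_n -> T -> R) :
    (forall i, measurable_fun setT (g i)) -> (forall i x, (0 <= g i x)%R) ->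
  \int[iid_law P n]_y (\prod_(i < n) g i (tnth y i))%:E =
  \prod_(i < n) \int[P]_x (g i x)%:E.
Proof.
elim: n g => [|n ih] g mg g0.
  rewrite big_ord0 (eq_integral (cst 1)); last first.
    by move=> y _; rewrite big_ord0.
  rewrite integral_cst// mul1e; exact: (@probability_setT _ _ _ (iid_law P 0)).
have mprod m (k : 'I_m -> T -> R) : (forall i, measurable_fun setT (k i)) ->
    measurable_fun setT (fun y : m.-tuple T => \prod_(i < m) k i (tnth y i))%R.
  move=> mk; apply: measurable_prod => i _.
  by apply: measurableT_comp => //; exact: measurable_tnth.
have mF : measurable_fun setT (fun y : n.+1.-tuple T =>
    (\prod_(i < n.+1) g i (tnth y i))%:E).
  by apply/measurable_EFinP; exact: mprod.
have F0 y : 0 <= (\prod_(i < n.+1) g i (tnth y i))%:E.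
  by rewrite lee_fin prodr_ge0.
rewrite /= ge0_integral_distribution//=.
have mtc : measurable_fun setT (@tcons _ T n).
  exact: measurable_funP.
rewrite fubini_tonelli1//; last first.
  by apply: (measurableT_comp mF).
rewrite /fubini_F/=.
transitivity (\int[P]_x ((g ord0 x)%:E *
    \prod_(i < n) \int[P]_x (g (lift ord0 i) x)%:E)).
  apply: eq_integral => x _.
  rewrite -(ih (fun i => g (lift ord0 i)))//.
  rewrite -ge0_integralZl//; last 3 first.
  - by apply/measurable_EFinP; apply: (mprod _ (fun i => g (lift ord0 i))).
  - by move=> y _; rewrite lee_fin prodr_ge0.
  - by rewrite lee_fin.
  apply: eq_integral => y _; rewrite big_ord_recl EFinM; congr (_ * _%:E).
  by apply: eq_bigr => i _; rewrite tnthS.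
rewrite ge0_integralZr//; last 3 first.
- exact/measurable_EFinP.
- by move=> x _; rewrite lee_fin.
- by apply: prode_ge0 => i _; apply: integral_ge0 => x _; rewrite lee_fin.
by rewrite big_ord_recl.
Qed.

(** Markov's inequality for the exponential of the sum, whose expectation factorises. The functions
    [g i] depend on the coordinate to allow for regression weights. *)
Lemma iid_law_chernoff n (g : 'I_n -> T -> R) (u : 'I_n -> R) (x : R) :
    (forall i, measurable_fun setT (g i)) ->
    (forall i, \int[P]_z (expR (g i z))%:E <= (expR (u i))%:E) ->
  iid_law P n [set y | (\sum_(i < n) u i + x <= \sum_(i < n) g i (tnth y i))%R]
    <= (expR (- x))%:E.
Proof.
move=> mg gu; pose S (y : n.-tuple T) : R := (\sum_(i < n) g i (tnth y i))%R.
have mS : measurable_fun setT S.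
  apply: measurable_sum => i; apply: measurableT_comp => //.
  exact: measurable_tnth.
have meS : measurable_fun setT (fun y => (expR (S y))%:E).
  by apply/measurable_EFinP; exact: measurableT_comp.
pose a := expR (\sum_(i < n) u i + x).
have a0 : (0 < a)%R by exact: expR_gt0.
have := @le_integral_abse _ _ _ (iid_law P n) setT measurableT _ a meS a0.
have -> : [set: n.-tuple T] `&` [set y | a%:E <= `|(expR (S y))%:E|] =
    [set y | (\sum_(i < n) u i + x <= S y)%R].
  rewrite setTI; apply/seteqP; split => y /=;
    by rewrite lee_fin ger0_norm ?expR_ge0// ler_expR.
under eq_integral do rewrite gee0_abs ?lee_fin ?expR_ge0//.
have -> : \int[iid_law P n]_y (expR (S y))%:E =
    \prod_(i < n) \int[P]_z (expR (g i z))%:E.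
  have mg' i : measurable_fun setT (expR \o g i) by exact: measurableT_comp.
  have g0' i z : (0 <= (expR \o g i) z)%R by exact: expR_ge0.
  rewrite -(integral_iid_law_prod mg' g0').
  by apply: eq_integral => y _; rewrite expR_sum.
have h : \prod_(i < n) \int[P]_z (expR (g i z))%:E <= (expR (\sum_(i < n) u i))%:E.
  rewrite expR_sum -prodEFin.
  suff : 0 <= \prod_(i < n) \int[P]_z (expR (g i z))%:E <=
      \prod_(i < n) (expR (u i))%:E by case/andP.
  apply: (big_ind2 (fun a b => 0 <= a <= b)) => [|a1 b1 a2 b2|i _].
  - by rewrite lee01 lexx.
  - move=> /andP[h1 h2] /andP[h3 h4].
    by rewrite mule_ge0// lee_pmul.
  - by rewrite gu andbT integral_ge0//= => z _; rewrite lee_fin expR_ge0.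
move=> /le_trans /(_ h); rewrite muleC -lee_pdivlMr// => /le_trans; apply.
by rewrite lee_fin /a expRD invfM mulrA divff ?mul1r ?expRN// gt_eqF ?expR_gt0.
Qed.

End iid_law_integrals.

Section normal_moment_generating_function.
Context {R : realType}.
Local Notation mu := (@lebesgue_measure R).

(** Completing the square turns exp(l x) times the centred normal density into a constant times the
    normal density with mean l sigma^2. *)
Lemma normal_mgf (sigma l : R) : 0 < sigma ->
  (\int[normal_prob 0 sigma]_x (expR (l * x))%:E =
   (expR (l ^+ 2 * sigma ^+ 2 / 2))%:E)%E.
Proof.
move=> s0; have sn0 : sigma != 0 by rewrite gt_eqF.
have me : measurable_fun [set: measurableTypeR R] (fun x => (expR (l * x))%:E).
  by apply/measurable_EFinP; apply: measurableT_comp => //; exact: mulrl_measurable.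
have e0 (x : R) : (0%:E <= (expR (l * x))%:E)%E by rewrite lee_fin expR_ge0.
have -> := @ge0_integral_density _ _ _ mu (normal_prob 0 sigma)
  (normal_pdf 0 sigma) (measurable_normal_pdf 0 sigma) (normal_pdf_ge0 0 sigma)
  (fun A _ => erefl) _ me e0.
transitivity (\int[mu]_x ((expR (l ^+ 2 * sigma ^+ 2 / 2))%:E *
    (normal_pdf (l * sigma ^+ 2) sigma x)%:E))%E.
  apply: eq_integral => x _; rewrite -!EFinM; congr EFin.
  rewrite !normal_pdfE// mulrCA [RHS]mulrCA /normal_fun -!expRD.
  congr (_ * expR _); field.
  by rewrite sn0.
rewrite ge0_integralZl//.
- by rewrite integral_normal_pdf mule1.
- by apply/measurable_EFinP; exact: measurable_normal_pdf.
- by move=> x _; rewrite lee_fin normal_pdf_ge0.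
Qed.

(** Chernoff with exponent n tau w_i on the i-th noise variable: the variance term is at most n
    tau^2 sigma^2 / 2, which the summand sigma^2 / 2 of the threshold absorbs. When n tau^2 = ln n
    the bound is n^(-K). *)
Lemma regression_upper_tail (sigma tau K : R) n (w : 'I_n -> R) (f : R -> R) :
    0 < sigma -> 0 < tau -> (0 < n)%N -> \sum_(i < n) w i ^+ 2 <= n%:R^-1 ->
  (data_law (Regression sigma) f n
    [set y | ((K + sigma ^+ 2 / 2) * tau <=
      \sum_(i < n) w i * tnth y i - \sum_(i < n) w i * f (i.+1%:R / n%:R))%R]
  <= (expR (- (K * (n%:R * tau ^+ 2))))%:E)%E.
Proof.
move=> s0 t0 n0 hw; rewrite /= /distribution /pushforward.
have nR : 0 < n%:R :> R by rewrite ltr0n.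
pose g (i : 'I_n) (z : measurableTypeR R) : R := n%:R * tau * w i * z.
pose u (i : 'I_n) : R := (n%:R * tau * w i) ^+ 2 * sigma ^+ 2 / 2.
have mg i : measurable_fun setT (g i) by exact: mulrl_measurable.
have gu i : (\int[normal_prob 0 sigma]_z (expR (g i z))%:E <= (expR (u i))%:E)%E.
  by rewrite /g normal_mgf.
pose S (e : n.-tuple (measurableTypeR R)) := \sum_(i < n) w i * tnth e i.
have mS : measurable_fun setT S.
  apply: measurable_sum => i; apply: measurable_funM => //.
  exact: measurable_tnth.
rewrite [X in iid_law _ _ X](_ : _ =
    [set e | ((K + sigma ^+ 2 / 2) * tau <= S e)%R]); last first.
  apply/seteqP; split => e /=; rewrite -sumrB;
    by under eq_bigr do rewrite tnth_mktuple mulrDr addrAC subrr add0r.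
have := iid_law_chernoff (K * (n%:R * tau ^+ 2)) mg gu.
apply: le_trans; apply: le_measure; rewrite ?inE.
- exact: (measurable_le_set (measurable_cst _) mS).
- have mS' : measurable_fun setT (fun y : n.-tuple (measurableTypeR R) =>
      \sum_(i < n) g i (tnth y i)).
    apply: measurable_sum => i; apply: measurableT_comp => //.
    exact: measurable_tnth.
  exact: (measurable_le_set (measurable_cst _) mS').
move=> e /= hS.
have -> : \sum_(i < n) g i (tnth e i) = n%:R * tau * S e.
  by rewrite mulr_sumr; apply: eq_bigr => i _; rewrite /g !mulrA.
have -> : \sum_(i < n) u i = (n%:R * tau) ^+ 2 * sigma ^+ 2 / 2 * \sum_(i < n) w i ^+ 2.
  by rewrite mulr_sumr; apply: eq_bigr => i _; rewrite /u; field.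
have h1 : (n%:R * tau) ^+ 2 * sigma ^+ 2 / 2 * \sum_(i < n) w i ^+ 2 <=
    n%:R * tau * (sigma ^+ 2 / 2 * tau).
  apply: le_trans (ler_wpM2l _ hw) _.
    by rewrite divr_ge0// mulr_ge0// sqr_ge0.
  rewrite le_eqVlt; apply/orP; left; apply/eqP; field.
  by rewrite gt_eqF.
have h2 : n%:R * tau * ((K + sigma ^+ 2 / 2) * tau) <= n%:R * tau * S e.
  by rewrite ler_wpM2l// mulr_ge0// ltW.
have -> : K * (n%:R * tau ^+ 2) = n%:R * tau * (K * tau) by ring.
rewrite (le_trans _ h2)//; apply: le_trans (lerD h1 (lexx _)) _.
by rewrite -mulrDr ler_wpM2l// ?mulr_ge0 ?(ltW t0)//; lra.
Qed.

End normal_moment_generating_function.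

Section density_moment_generating_function.
Context {R : realType}.
Local Notation mu := (@lebesgue_measure R).
Local Notation I01 := (`[0, 1]%classic : set R).

(** From exp(-x) >= 1 - x one gets exp(x) <= 1 / (1 - x), and (1 - x)(1 + x + 2 x^2) = 1 + x^2 (1 -
    2 x) >= 1 for x <= 1/2. *)
Lemma expR_le_quadratic (x : R) : `|x| <= 1 / 2 -> expR x <= 1 + x + 2 * x ^+ 2.
Proof.
rewrite ler_norml => /andP[x1 x2].
have h := expR_ge1Dx (- x); rewrite expRN in h.
have e0 := expR_gt0 x.
have : expR x * (1 - x) <= 1.
  by rewrite -[leRHS](@mulfV _ (expR x)) ?gt_eqF// ler_wpM2l// ltW.
nra.
Qed.

Let mI : measurable I01. Proof. exact: measurable_itv. Qed.

Let integrableZ (h : R -> R) (k : R) : mu.-integrable I01 (EFin \o h) ->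
  mu.-integrable I01 (EFin \o (fun x => k * h x)).
Proof. by move=> ih; apply: (integrableZl _ k ih). Qed.

Lemma density_mgf (f g : R -> R) (V b tau : R) : is_density f ->
    (forall x, I01 x -> f x <= V) -> measurable_fun setT g ->
    (forall x, I01 x -> `|g x| <= b) -> L2dot I01 g g <= 1 ->
    0 <= tau -> tau * b <= 1 / 2 ->
  (\int[density_law f]_x (expR (tau * g x))%:E <=
   (expR (tau * L2dot I01 f g + 2 * V * tau ^+ 2))%:E)%E.
Proof.
move=> df fV mg gb g1 t0 tb; have [mf f0 f1] := df.
have V0 : 0 <= V.
  have x0 : I01 0 by rewrite /= in_itv/= lexx ler01.
  exact: le_trans (f0 _ x0) (fV _ x0).
have b0 : 0 <= b.
  have x0 : I01 0 by rewrite /= in_itv/= lexx ler01.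
  exact: le_trans (gb _ x0).
have pdfE : density_pdf f = f \_ I01 by rewrite /density_pdf; case: asboolP.
have mpdf : measurable_fun setT (density_pdf f).
  by rewrite pdfE; apply/(measurable_restrictT f mI).
have me : measurable_fun [set: measurableTypeR R] (fun x => (expR (tau * g x))%:E).
  apply/measurable_EFinP; apply: measurableT_comp => //.
  by apply: measurable_funM.
have Lf : L2 I01 f.
  apply: (@L2_bounded _ _ _ V 1) => //.
    by move=> x x01; rewrite ger0_norm ?f0// fV.
  by move=> x; rewrite /= in_itv/= => /andP[x0 x1]; rewrite ger0_norm// ltNge x1.
have Lg : L2 I01 g.
  apply: (@L2_bounded _ _ _ b 1) => //; first exact: measurable_funTS.
  by move=> x; rewrite /= in_itv/= => /andP[x0 x1]; rewrite ger0_norm// ltNge x1.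
have pdf0 x : 0 <= density_pdf f x.
  by rewrite pdfE patchE; case: ifP => // /set_mem; exact: f0.
have e0 (x : R) : (0%:E <= (expR (tau * g x))%:E)%E by rewrite lee_fin expR_ge0.
have -> := @ge0_integral_density _ _ _ mu (density_law f)
  (density_pdf f) mpdf pdf0 (fun A _ => erefl) _ me e0.
rewrite [leLHS](_ : _ = \int[mu]_(x in I01) (expR (tau * g x) * f x)%:E)%E; last first.
  rewrite [RHS]integral_mkcond; apply: eq_integral => x _.
  by rewrite pdfE !patchE; case: ifP => // _; rewrite mule0.
have ifg := L2_integrableM mI Lf Lg.
have ig2f : mu.-integrable I01 (EFin \o (fun x => g x ^+ 2 * f x)).
  have Lgf : L2 I01 (fun x => g x * f x).
    apply: (@L2_bounded _ _ _ (b * V) 1) => //.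
    - by apply: measurable_funM => //; exact: measurable_funTS.
    - by move=> x x01; rewrite normrM ler_pM// ?gb// ger0_norm ?f0// fV.
    - by move=> x; rewrite /= in_itv/= => /andP[x0 x1]; rewrite ger0_norm// ltNge x1.
  have := L2_integrableM mI Lg Lgf.
  by under [X in _.-integrable _ (_ \o X)]eq_fun do rewrite mulrA -expr2.
have if1 : mu.-integrable I01 (EFin \o f).
  have L1 : L2 I01 (fun=> 1 : R).
    apply: (@L2_bounded _ _ _ 1 1) => //; first by move=> x _; rewrite normr1.
    by move=> x; rewrite /= in_itv/= => /andP[x0 x1]; rewrite ger0_norm// ltNge x1.
  have := L2_integrableM mI Lf L1.
  by under [X in _.-integrable _ (_ \o X)]eq_fun do rewrite mulr1.
have Rf1 : \int[mu]_(x in I01) f x = 1 by rewrite /Rintegral f1.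
pose h x := f x + (tau * (f x * g x) + 2 * tau ^+ 2 * (g x ^+ 2 * f x)).
have i2 : mu.-integrable I01 (EFin \o (fun x => tau * (f x * g x))).
  exact: integrableZ.
have i3 : mu.-integrable I01 (EFin \o (fun x => 2 * tau ^+ 2 * (g x ^+ 2 * f x))).
  exact: integrableZ.
have i23 : mu.-integrable I01 (EFin \o (fun x => tau * (f x * g x) + 2 * tau ^+ 2 * (g x ^+ 2 * f x))).
  by apply: (integrableD _ i2 i3).
have ih : mu.-integrable I01 (EFin \o h) by apply: (integrableD _ if1 i23).
apply: (@le_trans _ _ (\int[mu]_(x in I01) (h x)%:E)%E).
  apply: ge0_le_integral => //.
  - by move=> x x01; rewrite lee_fin mulr_ge0 ?expR_ge0 ?f0.
  - apply/measurable_EFinP; apply: measurable_funM => //.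
    by apply: measurable_funTS; apply/measurable_EFinP.
  - exact: measurable_int ih.
  - move=> x x01; rewrite lee_fin /h.
    have tg : `|tau * g x| <= 1 / 2.
      by rewrite normrM ger0_norm// (le_trans _ tb)// ler_wpM2l// gb.
    have := ler_wpM2r (f0 _ x01) (expR_le_quadratic tg).
    by move=> /le_trans; apply; rewrite le_eqVlt; apply/orP; left; apply/eqP; ring.
have -> : (\int[mu]_(x in I01) (h x)%:E = (\int[mu]_(x in I01) h x)%:E)%E.
  by rewrite /Rintegral fineK// integrable_fin_num.
rewrite lee_fin /h RintegralD// RintegralD// !RintegralZl// Rf1.
apply: le_trans (expR_ge1Dx _); rewrite lerD2l lerD2l -/(L2dot I01 f g).
have g2f : \int[mu]_(x in I01) (g x ^+ 2 * f x) <= V.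
  have Rg2 : V * L2dot I01 g g <= V by rewrite ler_piMr.
  apply: le_trans Rg2; rewrite /L2dot -RintegralZl//; last exact: L2_integrableM.
  apply: le_Rintegral => //.
    exact: (integrableZ V (L2_integrableM mI Lg Lg)).
  by move=> x x01; rewrite mulrC expr2 ler_wpM2r ?fV// -expr2 sqr_ge0.
have t2 : 0 <= 2 * tau ^+ 2 by rewrite mulr_ge0 ?sqr_ge0.
by apply: (le_trans (ler_wpM2l t2 g2f)); rewrite mulrAC.
Qed.

(** Bernstein's bound with the Chernoff exponent fixed at [tau] instead of optimised, admissible
    while tau b <= 1/2. *)
Lemma density_upper_tail (f g : R -> R) (V b tau K : R) n : is_density f ->
    (forall x, I01 x -> f x <= V) -> measurable_fun setT g ->
    (forall x, I01 x -> `|g x| <= b) -> L2dot I01 g g <= 1 ->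
    0 < tau -> tau * b <= 1 / 2 -> (0 < n)%N ->
  (data_law Density f n
    [set y | ((K + 2 * V) * tau <=
      n%:R^-1 * (\sum_(i < n) g (tnth y i)) - L2dot I01 f g)%R]
  <= (expR (- (K * (n%:R * tau ^+ 2))))%:E)%E.
Proof.
move=> df fV mg gb g1 t0 tb n0.
have nR : 0 < n%:R :> R by rewrite ltr0n.
pose G (i : 'I_n) (z : measurableTypeR R) : R := tau * g z.
pose u (i : 'I_n) : R := tau * L2dot I01 f g + 2 * V * tau ^+ 2.
have mG i : measurable_fun setT (G i) by apply: measurable_funM.
have Gu i : (\int[density_law f]_z (expR (G i z))%:E <= (expR (u i))%:E)%E.
  by apply: (density_mgf df fV mg gb g1) => //; exact: ltW.
have := iid_law_chernoff (K * (n%:R * tau ^+ 2)) mG Gu.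
apply: le_trans; apply: le_measure; rewrite ?inE.
- have mS : measurable_fun setT (fun y : n.-tuple (measurableTypeR R) =>
      n%:R^-1 * (\sum_(i < n) g (tnth y i)) - L2dot I01 f g).
    apply: measurable_funB => //; apply: measurable_funM => //.
    apply: measurable_sum => i.
    by apply: measurableT_comp => //; exact: measurable_tnth.
  exact: (measurable_le_set (measurable_cst _) mS).
- have mS : measurable_fun setT (fun y : n.-tuple (measurableTypeR R) =>
      \sum_(i < n) G i (tnth y i)).
    apply: measurable_sum => i; apply: measurableT_comp => //.
    exact: measurable_tnth.
  exact: (measurable_le_set (measurable_cst _) mS).
move=> y /=; set S := \sum_(i < n) g (tnth y i) => hS.
have -> : \sum_(i < n) G i (tnth y i) = tau * S by rewrite mulr_sumr.
rewrite /u sumr_const card_ord -mulr_natl.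
have := ler_wpM2l (ltW (mulr_gt0 nR t0)) hS.
have -> : n%:R * tau * (n%:R^-1 * S - L2dot I01 f g) =
    tau * S - n%:R * tau * L2dot I01 f g by field; rewrite gt_eqF.
rewrite -subr_ge0 => h; rewrite -subr_ge0; apply: le_trans h _.
rewrite le_eqVlt; apply/orP; left; apply/eqP; ring.
Qed.

End density_moment_generating_function.

(** * Scalar products approximated on the regular design *)

Section regression_design.
Context {R : realType}.
Local Notation mu := (@lebesgue_measure R).
Local Notation I01 := (`[0, 1]%classic : set R).
Local Notation D := (`]0, 1]%classic : set R).
Implicit Types (f g : R -> R) (n : nat).

(** Left-open, so that the right end of each cell is its design point and the cells partition ]0,
    1]. *)
Definition cell n (i : nat) : set R := `]i%:R / n%:R, i.+1%:R / n%:R]%classic.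

(** The integral of [g] over a cell. With these weights the mean of the estimator is exactly the
    scalar product of [g] with a step function taking the values of [f] at the design points. *)
Definition design_weight n g (i : nat) : R := L2dot D (\1_(cell n i)) g.

Let mD : measurable D. Proof. exact: measurable_itv. Qed.

Let bounded_D_L2 g (b : R) : measurable_fun D g -> (forall x, D x -> `|g x| <= b) ->
  L2 D g.
Proof.
move=> mg gb; apply: (@L2_bounded _ _ _ b 1) => //.
by move=> x; rewrite /= in_itv/= => /andP[x0 x1]; rewrite ger0_norm ?(ltW x0)// ltNge x1.
Qed.

Let indic_L2 n i : L2 D (\1_(cell n i)).
Proof.
apply: (@bounded_D_L2 _ 1).
  by apply: measurable_funTS; apply: measurable_indic; exact: measurable_itv.
by move=> x _; rewrite indicE; case: (x \in _); rewrite ?normr1 ?normr0.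
Qed.

Lemma cell_cover n x : (0 < n)%N -> D x ->
  exists2 i, (i < n)%N & forall j, (x \in cell n j) = (j == i).
Proof.
move=> n0; rewrite /= in_itv/= => /andP[x0 x1].
have nR : 0 < n%:R :> R by rewrite ltr0n.
have ex : exists i, x <= i.+1%:R / n%:R.
  by exists n.-1; rewrite prednK// divff ?gt_eqF.
case: (ex_minnP ex) => i xi imin.
have ix : i%:R / n%:R < x.
  case: i xi imin => [|i] xi imin; first by rewrite mul0r.
  by rewrite ltNge; apply/negP => /imin; rewrite ltnn.
have i_n : (i < n)%N.
  by rewrite -(prednK n0) ltnS imin// prednK// divff ?gt_eqF.
exists i => // j; apply/idP/eqP => [|->]; last first.
  by apply/mem_set; rewrite /cell /= in_itv/= ix.
move=> /set_mem; rewrite /cell /= in_itv/= => /andP[jx xj].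
apply/eqP; rewrite eqn_leq imin// andbT -ltnS -(ltr_nat R).
rewrite -(@ltr_pM2r _ n%:R^-1) ?invr_gt0//.
exact: lt_le_trans jx xi.
Qed.

Lemma mu_cell_dot n i : (0 < n)%N -> (i < n)%N ->
  L2dot D (\1_(cell n i)) (\1_(cell n i)) = n%:R^-1.
Proof.
move=> n0 i_n; have nR : 0 < n%:R :> R by rewrite ltr0n.
transitivity (\int[mu]_(x in D) (\1_(cell n i) x : R)).
  apply: eq_Rintegral => x _.
  by rewrite indicE; case: (x \in _); rewrite ?mulr1 ?mulr0.
have mc : measurable (cell n i) by exact: measurable_itv.
rewrite /Rintegral integral_indic//.
have -> : cell n i `&` D = cell n i.
  apply/setIidl => x; rewrite /cell /= !in_itv/= => /andP[ix xi]; apply/andP; split.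
    by apply: le_lt_trans ix; rewrite divr_ge0.
  by rewrite (le_trans xi)// ler_pdivrMr// mul1r ler_nat.
rewrite [X in fine X]lebesgue_measure_itv/= lte_fin ltr_pM2r ?invr_gt0// ltr_nat ltnSn.
by rewrite -EFinB/= -mulrBl -natrB// subSnn mul1r.
Qed.

Lemma cell_dot0 n i j : i != j -> L2dot D (\1_(cell n i)) (\1_(cell n j)) = 0.
Proof.
move=> ij; transitivity (\int[mu]_(x in D) (0 : R)); last first.
  by rewrite Rintegral_cst// mul0r.
apply: eq_Rintegral => x /set_mem Dx; have [n0|n0] := posnP n.
  rewrite /cell n0 invr0 !mulr0 !indicE (memNset (A := `]0, 0]%classic)) ?mul0r//=.
  by rewrite in_itv/= => /andP[x0]; rewrite leNgt x0.
have [k _ hk] := cell_cover n0 Dx.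
rewrite !indicE !hk; case: (i =P k) => [ik|_]; last by rewrite mul0r.
by rewrite -ik eq_sym (negbTE ij) mulr0.
Qed.

(** Multiplied by n^(1/2), the weights are the coefficients of [g] on the orthonormal family of
    normalised cell indicators, so this is Bessel's inequality. *)
Lemma design_weight_sqr_sum n g (b : R) : (0 < n)%N -> measurable_fun D g ->
    (forall x, D x -> `|g x| <= b) -> L2dot D g g <= 1 ->
  \sum_(i < n) design_weight n g i ^+ 2 <= n%:R^-1.
Proof.
move=> n0 mg gb g1; have Lg := bounded_D_L2 mg gb.
have nR : 0 < n%:R :> R by rewrite ltr0n.
pose h (i : nat) (x : R) := Num.sqrt n%:R * \1_(cell n i) x : R.
have oh : Defs.orthonormal D [set i | (i < n)%N] h.
  split=> [i _|i j ii jj]; first exact: L2Z.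
  rewrite /h L2dotZl//; last exact: L2Z.
  rewrite L2dotC L2dotZl// mulrA -expr2 sqr_sqrtr// L2dotC.
  have [->|ij] := eqVneq i j; last by rewrite cell_dot0// mulr0.
  by rewrite mu_cell_dot// mulfV ?gt_eqF.
have := bessel mD oh Lg (iota_uniq 0 n).
have hI i : i \in iota 0 n -> [set i | (i < n)%N] i by rewrite mem_iota.
move=> /(_ hI) /le_trans /(_ g1) H.
rewrite -[leRHS]mul1r ler_pdivlMr// mulr_suml.
apply: le_trans H; rewrite -(big_mkord xpredT (fun i => design_weight n g i ^+ 2 * n%:R)).
rewrite /index_iota subn0 le_eqVlt; apply/orP; left; apply/eqP; apply: eq_bigr => i _.
rewrite (L2dotC _ g) /h L2dotZl// exprMn sqr_sqrtr// mulrC.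
by [].
Qed.

(** Instead of Cauchy-Schwarz, c |g| <= (c / 2)(1 + g^2) is integrated over an interval of length
    1. *)
Lemma L2dot_le_sup f g (c : R) : L2 D f -> L2 D g -> 0 <= c ->
    (forall x, D x -> `|f x| <= c) -> L2dot D g g <= 1 ->
  `|L2dot D f g| <= c.
Proof.
move=> Lf Lg c0 fc g1.
have ifg := L2_integrableM mD Lf Lg.
apply: le_trans; first by apply: (le_normr_Rintegral _ ifg).
have L1 : L2 D (fun=> 1 : R) by apply: (@bounded_D_L2 _ 1) => // x _; rewrite normr1.
have i1 : mu.-integrable D (EFin \o (fun=> 1 : R)).
  have := L2_integrableM mD L1 L1.
  by under [X in _.-integrable _ (_ \o X)]eq_fun do rewrite mulr1.
have i2 := L2_integrableM mD Lg Lg.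
have i3 : mu.-integrable D (EFin \o (fun x => 1 + g x * g x)).
  by apply: (integrableD _ i1 i2).
have i4 : mu.-integrable D (EFin \o (fun x => c / 2 * (1 + g x * g x))).
  by apply: (integrableZl _ (c / 2) i3).
apply: (@le_trans _ _ (\int[mu]_(x in D) (c / 2 * (1 + g x * g x)))).
  apply: le_Rintegral => //.
    exact: (integrable_norm ifg).
  move=> x Dx; rewrite normrM.
  apply: (@le_trans _ _ (c * `|g x|)); first by rewrite ler_wpM2r// fc.
  rewrite -mulrA ler_wpM2l//.
  have := sqr_ge0 (`|g x| - 1); have : `|g x| ^+ 2 = g x * g x.
    by rewrite real_normK ?num_real// expr2.
  nra.
rewrite RintegralZl// RintegralD//.
have -> : \int[mu]_(x in D) (1 : R) = 1.
  rewrite Rintegral_cst// mul1r [X in fine X]lebesgue_measure_itv/= lte01.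
  by rewrite -EFinB subr0.
rewrite -/(L2dot D g g).
have : c * L2dot D g g <= c * 1 by rewrite ler_wpM2l.
lra.
Qed.

Lemma L2dot_itv_oc f g : L2 I01 f -> L2 I01 g -> L2dot I01 f g = L2dot D f g.
Proof.
move=> Lf Lg; rewrite /L2dot.
have mI : measurable I01 by exact: measurable_itv.
have ifg := L2_integrableM mI Lf Lg.
rewrite (Rintegral_itv_obnd_cbnd (r := 0))//.
apply: integrableS ifg => //.
by move=> x; rewrite /= !in_itv/= => /andP[/ltW -> ->].
Qed.

(** The step function [fn] is within [c] of [f] because a cell has length 1 / n. *)
Lemma design_bias n f g (a b c : R) : (0 < n)%N -> L2 I01 f -> L2 I01 g ->
    (forall x, I01 x -> `|f x| <= a) -> (forall x, I01 x -> `|g x| <= b) ->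
    L2dot I01 g g <= 1 -> 0 <= c ->
    (forall x y, I01 x -> I01 y -> `|x - y| <= n%:R^-1 -> `|f x - f y| <= c) ->
  `|\sum_(i < n) design_weight n g i * f (i.+1%:R / n%:R) - L2dot I01 f g| <= c.
Proof.
move=> n0 Lf Lg fa gb g1 c0 hc.
have nR : 0 < n%:R :> R by rewrite ltr0n.
have mI : measurable I01 by exact: measurable_itv.
have DI : D `<=` I01 by move=> x; rewrite /= !in_itv/= => /andP[/ltW -> ->].
have L2S h (m : R) : L2 I01 h -> (forall x, I01 x -> `|h x| <= m) -> L2 D h.
  move=> Lh hm; apply: (@bounded_D_L2 _ m); last by move=> x /DI; exact: hm.
  exact: measurable_funS mI DI (L2_measurable mI Lh).
rewrite L2dot_itv_oc// in g1; rewrite (L2dot_itv_oc Lf Lg).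
have Lf' := L2S _ _ Lf fa; have Lg' := L2S _ _ Lg gb.
pose fn x := \sum_(0 <= i < n) f (i.+1%:R / n%:R) * \1_(cell n i) x.
have -> : \sum_(i < n) design_weight n g i * f (i.+1%:R / n%:R) = L2dot D fn g.
  rewrite L2dot_suml//; last by move=> i _; exact: L2Z.
  rewrite big_mkord; apply: eq_bigr => i _.
  by rewrite L2dotZl// mulrC.
have Lfn : L2 D fn by apply: L2_sum => i _; exact: L2Z.
rewrite -L2dotBl//; apply: L2dot_le_sup => //; first exact: L2B.
move=> x Dx; have [k kn hk] := cell_cover n0 Dx.
have xk : x \in cell n k by rewrite hk.
have -> : fn x = f (k.+1%:R / n%:R).
  rewrite /fn (bigD1_seq k)/= ?mem_index_iota ?iota_uniq//.
  rewrite indicE hk eqxx mulr1 big1 ?addr0// => j /negbTE jk.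
  by rewrite indicE hk jk mulr0.
move: xk; rewrite inE /cell /= in_itv/= => /andP[kx xk].
apply: hc; last 1 first.
- rewrite ger0_norm ?subr_ge0//.
  have : k.+1%:R / n%:R - k%:R / n%:R = n%:R^-1 :> R.
    by rewrite -mulrBl -natrB// subSnn mul1r.
  lra.
- rewrite /= in_itv/= divr_ge0//= ler_pdivrMr// mul1r ler_nat//.
- exact: DI.
Qed.

End regression_design.

Section tail_bounds.
Context d (T : measurableType d) (R : realType) (P : probability T R).
Local Open Scope ereal_scope.

Lemma two_sided_tail (X : T -> R) (c t q : R) : measurable_fun setT X ->
    P [set y | (t <= X y - c)%R] <= q%:E ->
    P [set y | (t <= c - X y)%R] <= q%:E ->
  P [set y | (t < `|X y - c|)%R] <= (2 * q)%:E.
Proof.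
move=> mX h1 h2.
have m1 : measurable [set y | (t <= X y - c)%R].
  by apply: measurable_le_set => //; exact: measurable_funB.
have m2 : measurable [set y | (t <= c - X y)%R].
  by apply: measurable_le_set => //; exact: measurable_funB.
have m3 : measurable [set y | (t < `|X y - c|)%R].
  apply: measurable_lt_set => //; apply: measurableT_comp => //.
  exact: measurable_funB.
rewrite mulr2n mulrDl mul1r EFinD; apply: le_trans (leeD h1 h2).
apply: le_trans (measureU2 _ m1 m2); apply: le_measure; rewrite ?inE//.
  exact: measurableU.
move=> y /=; rewrite lter_normr => /orP[/ltW|]; first by left.
by rewrite opprB => /ltW; right.
Qed.

Lemma union_bound (I : eqType) (s : seq I) (A : I -> set T) (q : R) :
    (forall i, i \in s -> measurable (A i)) ->
    (forall i, i \in s -> P (A i) <= q%:E) ->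
  measurable [set y | exists2 i, i \in s & A i y] /\
  P [set y | exists2 i, i \in s & A i y] <= ((size s)%:R * q)%:E.
Proof.
elim: s => [|i s ih] mA hA.
  rewrite (_ : [set y | _] = set0); first by rewrite measure0 mul0r.
  by apply/seteqP; split => y // -[].
have [||m h] := ih.
- by move=> j js; apply: mA; rewrite in_cons js orbT.
- by move=> j js; apply: hA; rewrite in_cons js orbT.
have mi := mA i (mem_head _ _); have hi := hA i (mem_head _ _).
rewrite (_ : [set y | _] = A i `|` [set y | exists2 j, j \in s & A j y]); last first.
  apply/seteqP; split => y /=.
    move=> [j]; rewrite in_cons => /orP[/eqP ->|js] Ay; first by left.
    by right; exists j.
  move=> [Ay|[j js Ay]]; first by exists i => //; exact: mem_head.
  by exists j => //; rewrite in_cons js orbT.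
split; first exact: measurableU.
apply: le_trans (measureU2 _ mi m) _.
rewrite /= -natr1 addrC mulrDl mul1r EFinD; exact: leeD.
Qed.

End tail_bounds.

(** * Deviation of a single empirical coefficient *)

Section coefficient_estimation.
Context {R : realType} (W : wavelet_system R) (hW : cdv_system W).
Variables (e : nat + nat * nat -> R -> R) (B : R).
Hypothesis he : regular_basis W e B.
Variables (m : model R) (smin : R).
Hypothesis hm : model_ok m smin.
Local Notation mu := (@lebesgue_measure R).
Local Notation j0 := (wj0 W).
Local Notation I01 := (`[0, 1]%classic : set R).

Lemma model_ok_gt0 : 0 < smin.
Proof. by move: hm; case: m => [//|sigma [_]]; apply: lt_le_trans; lra. Qed.

Definition est n (i : nat + nat * nat) (y : n.-tuple R) : R :=
  match m with
  | Density => n%:R^-1 * (\sum_(k < n) e i (tnth y k))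
  | Regression _ => \sum_(k < n) design_weight n (e i) k * tnth y k
  end.

Definition tau n : R := Num.sqrt (ln n%:R / n%:R).

Let B0 : 0 <= B. Proof. by have [] := he. Qed.
Let ce i : continuous (e i). Proof. by have [_ h _ _ _] := he; exact: h. Qed.
Let mI : measurable I01. Proof. exact: measurable_itv. Qed.

Lemma measurable_basis i : measurable_fun setT (e i).
Proof. exact: continuous_measurable_fun. Qed.

Lemma measurable_est n i :
  measurable_fun [set: n.-tuple (measurableTypeR R)] (@est n i).
Proof.
rewrite /est; case: m => [|sigma].
  apply: measurable_funM => //; apply: measurable_sum => k.
  apply: (measurableT_comp (measurable_basis i)).
  exact: measurable_tnth.
apply: measurable_sum => k; apply: measurable_funM => //.
exact: measurable_tnth.
Qed.

Definition basis_bound (i : nat + nat * nat) : R :=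
  B * match i with inl _ => 1 | inr jk => 2 `^ (jk.1%:R / 2) end.

Lemma basis_boundP i x : basis_idx W i -> I01 x -> `|e i x| <= basis_bound i.
Proof.
have [_ _ _ hc hl] := he.
case: i => [k /= kj|[l k] /= /andP[jl kl]] x01; rewrite /basis_bound/=.
  have [h _] := hc x x x01 x01.
  by rewrite mulr1; exact: (@normr_le_sum _ (fun k => e (inl k) x) _ _ _ kj h).
have [h _] := hl l x x jl x01 x01.
exact: (@normr_le_sum _ (fun k => e (inr (l, k)) x) _ _ _ kl h).
Qed.

Lemma basis_unit i : basis_idx W i -> L2dot I01 (e i) (e i) = 1.
Proof.
move=> ib; have [_ _ ee _ _] := he.
have [_ _ _ _ [[_ oA] _ _]] := hW.
transitivity (L2dot I01 (basis_fun W i) (basis_fun W i)).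
  congr fine; apply: ae_eq_integral => //.
  - exact: measurable_int (L2_integrableM mI (regular_basis_L2 he i) (regular_basis_L2 he i)).
  - exact: measurable_int (L2_integrableM mI (L2_basis hW ib) (L2_basis hW ib)).
  move: (ee i ib).
  apply: (@filterS _ _ (ae_filter_ringOfSetsType (@lebesgue_measure R))) => x /=.
  by move=> h x01; rewrite h.
by rewrite (oA i i ib ib) eqxx.
Qed.

Let A := B + tail_const B smin.

Definition est_const : R := 3 + match m with
  | Density => 2 * A
  | Regression sigma => sigma ^+ 2 / 2 + modulus_const W B smin
  end.

Lemma modulus_const_ge0 : 0 <= modulus_const W B smin.
Proof.
have r1 : 0 < 2 `^ (1 / 2) - 1 :> R.
  by rewrite subr_gt0 -[ltLHS](powRr0 2) !pow2E ltr_expR ltr_pM2r ?ln2_gt0//; lra.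
have T0 := tail_const_ge0 he model_ok_gt0.
have h : 0 <= B * 2 `^ (j0.+1%:R / 2) / (2 `^ (1 / 2) - 1).
  by rewrite divr_ge0 ?(ltW r1)// mulr_ge0 ?powR_ge0.
by rewrite /modulus_const; move: B0; lra.
Qed.

(** In [est_const] the 3 yields failure probabilities of order n^(-3), to be summed over O(n)
    coefficients; the other terms stand for the variance and, in regression, the discretisation
    bias. *)
Lemma est_const_ge0 : 0 <= est_const.
Proof.
rewrite /est_const; have T0 := tail_const_ge0 he model_ok_gt0.
have := modulus_const_ge0; case: m => [|sigma] M0.
  by rewrite /A; move: B0; lra.
by have := sqr_ge0 sigma; lra.
Qed.

Lemma tau_sqr n : (0 < n)%N -> n%:R * tau n ^+ 2 = ln n%:R.
Proof.
move=> n0; rewrite /tau sqr_sqrtr; last first.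
  by rewrite divr_ge0// ln_ge0// ler1n.
by rewrite mulrC divfK// pnatr_eq0 -lt0n.
Qed.

(** The factor 1 + M dominates constant terms and terms proportional to M alike: the latter are the
    bound A M on the density, or the regression bias. Lower deviations are upper deviations for the
    negated basis function or weights. *)
Lemma est_tail n i s M f : (0 < n)%N -> 1 <= ln n%:R :> R ->
    tau n * basis_bound i <= 1 / 2 -> basis_idx W i -> smin <= s ->
    Cs W s M f -> in_model m f ->
  (data_law m f n
     [set y | (est_const * (1 + M) * tau n < `|est i y - theta W f i|)%R]
   <= (2 * expR (- (3 * ln n%:R)))%:E)%E.
Proof.
move=> n0 n3 tb ib ss Cf fm; have M0 := Cs_ge0 Cf.
have smin0 := model_ok_gt0.
have nR : 0 < n%:R :> R by rewrite ltr0n.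
have t0 : 0 < tau n by rewrite sqrtr_gt0 divr_gt0//; lra.
have Lf : L2 I01 f by case: Cf.
have fb x : I01 x -> `|f x| <= A * M by exact: (Cs_bounded hW he smin0 ss Cf).
have e1 : L2dot I01 (e i) (e i) <= 1 by rewrite basis_unit.
have eb x : I01 x -> `|e i x| <= basis_bound i by exact: basis_boundP.
have T0 := tail_const_ge0 he smin0.
have A0 : 0 <= A by rewrite addr_ge0.
have me := @measurable_est n i.
rewrite -(tau_sqr n0); move: me fm; rewrite /est /est_const.
have := modulus_const_ge0; move: hm; case: m => [h0|sigma [s0 s12]] C0 me fm.
  have thetaE' : theta W f i = L2dot I01 f (e i) by exact: (thetaE hW he Lf ib).
  apply: (@le_trans _ _ (data_law Density f n [set y | ((3 + 2 * (A * M)) * tau n <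
      `|n%:R^-1 * (\sum_(k < n) e i (tnth y k)) - theta W f i|)%R])).
    apply: le_measure; rewrite ?inE.
    - by apply: measurable_lt_set => //; apply: measurableT_comp => //; exact: measurable_funB.
    - by apply: measurable_lt_set => //; apply: measurableT_comp => //; exact: measurable_funB.
    move=> y /=; apply: le_lt_trans; rewrite ler_wpM2r ?(ltW t0)//.
    rewrite -subr_ge0 [leRHS](_ : _ = 3 * M + 2 * A); last by ring.
    by rewrite addr_ge0// mulr_ge0.
  have fV x : I01 x -> f x <= A * M by move=> x01; rewrite (le_trans (ler_norm _))// fb.
  apply: two_sided_tail => //.
    rewrite thetaE'.
    exact: (density_upper_tail 3 fm fV (measurable_basis i) eb e1 t0 tb n0).
  have := @density_upper_tail R f (fun x => - e i x) (A * M) (basis_bound i)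
    (tau n) 3 n fm fV.
  have mN : measurable_fun setT (fun x => - e i x).
    by apply: measurableT_comp => //; exact: measurable_basis.
  have ebN x : I01 x -> `|- e i x| <= basis_bound i by rewrite normrN; exact: eb.
  have e1N : L2dot I01 (fun x => - e i x) (fun x => - e i x) <= 1.
    rewrite (_ : L2dot _ _ _ = L2dot I01 (e i) (e i))//.
    by apply: eq_Rintegral => x _; rewrite mulrNN.
  move=> /(_ mN ebN e1N t0 tb n0) H.
  rewrite (_ : [set y | _] = [set y | ((3 + 2 * (A * M)) * tau n <=
    n%:R^-1 * (\sum_(k < n) - e i (tnth y k)) - L2dot I01 f (fun x => - e i x))%R]); first exact: H.
  have -> : L2dot I01 f (fun x => - e i x) = - theta W f i.
    rewrite thetaE' L2dotC (L2dotC _ f) -mulN1r -L2dotZl//; last exact: (regular_basis_L2 he).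
    by apply: eq_Rintegral => x _; rewrite mulN1r.
  have E (y : n.-tuple R) : n%:R^-1 * (\sum_(k < n) - e i (tnth y k)) - - theta W f i =
      theta W f i - n%:R^-1 * (\sum_(k < n) e i (tnth y k)).
    by rewrite sumrN mulrN opprK addrC.
  by apply/seteqP; split => y /=; rewrite E.
pose Ef := \sum_(k < n) design_weight n (e i) k * f (k.+1%:R / n%:R).
pose Md := modulus_const W B smin.
have bias : `|Ef - theta W f i| <= Md * M * tau n.
  rewrite (thetaE hW he Lf ib).
  (* Here ln n >= 1 enters: a bias of order n^(-1/2) is below the noise level. *)
  have snv : (Num.sqrt n%:R)^-1 <= tau n.
    rewrite -sqrtrV ?(ltW nR)// /tau ler_wsqrtr// ler_peMl// invr_ge0 ltW//.
  apply: (design_bias n0 Lf (regular_basis_L2 he i) fb eb e1); first by rewrite !mulr_ge0 ?(ltW t0).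
  move=> x y x01 y01 xy.
  have s12' : 1 / 2 <= s by exact: le_trans ss.
  apply: (le_trans (Cs_modulus hW he smin0 s12' ss Cf n0 x01 y01 xy)).
  by rewrite ler_wpM2l// mulr_ge0.
have DI : `]0, 1]%classic `<=` I01.
  by move=> x; rewrite /= !in_itv/= => /andP[/ltW -> ->].
have w2 : \sum_(k < n) design_weight n (e i) k ^+ 2 <= n%:R^-1.
  apply: (@design_weight_sqr_sum _ _ _ (basis_bound i)) => //.
  - by apply: measurable_funTS; exact: measurable_basis.
  - by move=> x /DI; exact: eb.
  - by rewrite -L2dot_itv_oc//; exact: (regular_basis_L2 he).
apply: (@le_trans _ _ (data_law (Regression sigma) f n
   [set y | ((3 + sigma ^+ 2 / 2) * tau n <
      `|\sum_(k < n) design_weight n (e i) k * tnth y k - Ef|)%R])).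
  apply: le_measure; rewrite ?inE.
  - by apply: measurable_lt_set => //; apply: measurableT_comp => //; exact: measurable_funB.
  - by apply: measurable_lt_set => //; apply: measurableT_comp => //; exact: measurable_funB.
  move=> y /=; set S := \sum_(k < n) _ => hS.
  have h1 : `|S - theta W f i| <= `|S - Ef| + `|Ef - theta W f i|.
    by rewrite (le_trans _ (ler_normD _ _))// addrA subrK.
  have h2 : (3 + sigma ^+ 2 / 2) * tau n + Md * M * tau n <=
      (3 + (sigma ^+ 2 / 2 + Md)) * (1 + M) * tau n.
    rewrite -mulrDl ler_wpM2r ?(ltW t0)//.
    have := mulr_ge0 (sqr_ge0 sigma) M0; have := mulr_ge0 C0 M0.
    rewrite -/Md in C0 *; nra.
  rewrite -/Md in hS; lra.
apply: two_sided_tail => //.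
  exact: (regression_upper_tail 3 f s0 t0 n0 w2).
have w2N : \sum_(k < n) (- design_weight n (e i) k) ^+ 2 <= n%:R^-1.
  by under eq_bigr do rewrite sqrrN.
have := regression_upper_tail 3 f s0 t0 n0 w2N.
apply: le_trans; rewrite le_eqVlt; apply/orP; left; apply/eqP; congr (data_law _ _ _ _).
have E (y : n.-tuple R) : \sum_(k < n) - design_weight n (e i) k * tnth y k
    - \sum_(k < n) - design_weight n (e i) k * f (k.+1%:R / n%:R) =
    Ef - \sum_(k < n) design_weight n (e i) k * tnth y k.
  under eq_bigr do rewrite mulNr.
  under [X in _ - X]eq_bigr do rewrite mulNr.
  by rewrite !sumrN opprK addrC.
by apply/seteqP; split => y /=; rewrite E.
Qed.

End coefficient_estimation.

(** * Concentration of the empirical coefficients *)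

Section resolution_levels.
Context {R : realType}.
Local Notation tau := (@tau R).
Implicit Types (s : R) (n : nat).

Lemma near_natr_gt (x : R) : \forall n \near \oo, x < n%:R.
Proof.
exists (Num.truncn x).+1 => // n /= xn.
by rewrite (lt_le_trans (truncnS_gt _))// ler_nat.
Qed.

(** From ln n = 2 ln(n^(1/2)) < 2 n^(1/2) follows tau^2 < 2 n^(-1/2), whence the threshold 4 /
    d^4. *)
Lemma tau_small (d : R) : 0 < d -> \forall n \near \oo, tau n < d.
Proof.
move=> d0; near=> n.
have n1 : 1 < n%:R :> R by near: n; exact: near_natr_gt.
have nd : 4 / d ^+ 4 < n%:R by near: n; exact: near_natr_gt.
have n0 : 0 < n%:R :> R by lra.
rewrite /tau -[ltRHS]ger0_norm ?(ltW d0)// -sqrtr_sqr ltr_sqrt ?exprn_gt0//.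
have s0 : 0 < Num.sqrt n%:R :> R by rewrite sqrtr_gt0.
have nS : n%:R = Num.sqrt n%:R ^+ 2 :> R by rewrite sqr_sqrtr// ltW.
have -> : ln n%:R = 2 * ln (Num.sqrt n%:R) :> R.
  by rewrite [in LHS]nS lnXn// mulr_natl.
move: s0 nS; set S := Num.sqrt n%:R => s0 nS.
have h := ln_sublinear s0.
apply: (@lt_trans _ _ (2 / S)).
  rewrite nS ltr_pdivrMr ?exprn_gt0//.
  by rewrite expr2 mulrA divfK ?gt_eqF// ltr_pM2l.
rewrite ltr_pdivrMr// mulrC -ltr_pdivrMr ?exprn_gt0//.
have dd : 0 < 2 / d ^+ 2 by rewrite divr_gt0// exprn_gt0.
rewrite -(@ltr_pXn2r _ 2)// ?nnegrE ?(ltW s0) ?(ltW dd)// -nS.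
rewrite expr_div_n -exprM; apply: le_lt_trans nd.
by rewrite -natrX.
Unshelve. all: by end_near. Qed.

Lemma near_ln_ge1 : \forall n \near \oo, 1 <= ln n%:R :> R.
Proof.
near=> n; have : expR 1 < n%:R :> R by near: n; exact: near_natr_gt.
move=> h; rewrite -[leLHS]expRK ler_ln ?posrE ?expR_gt0//; first exact: ltW.
by apply: lt_trans h; exact: expR_gt0.
Unshelve. all: by end_near. Qed.

Lemma tau_gt0 n : 1 <= ln n%:R :> R -> 0 < tau n.
Proof.
move=> h; rewrite sqrtr_gt0 divr_gt0//; first lra.
by rewrite ltr0n lt0n; apply/negP => /eqP n0; move: h; rewrite n0 ln0// ler10.
Qed.

(** The level at which the coefficient bound 2^(-J(s+1/2)) crosses the noise [tau]: after rounding
    down and adding one, the bound is at most [tau] here and, if tau <= 1, at least [tau] at the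
    predecessor. *)
Definition level s n : nat :=
  (Num.truncn (- ln (tau n) / ((s + 1 / 2) * ln 2))).+1.

Section level_bounds.
Variables (s : R) (n : nat).
Hypotheses (s0 : 0 <= s) (t0 : 0 < tau n) (t1 : tau n <= 1).

Let c0 : 0 < (s + 1 / 2) * ln 2.
Proof. by apply: mulr_gt0; [move: s0; lra|exact: ln2_gt0]. Qed.

Lemma level_le_tau : 2 `^ (- ((level s n)%:R * (s + 1 / 2))) <= tau n.
Proof.
rewrite pow2E -[leRHS]lnK ?posrE// ler_expR mulNr lerNl -mulrA.
by rewrite -ler_pdivrMr// ltW// /level truncnS_gt.
Qed.

Lemma tau_le_level : tau n <= 2 `^ (- ((level s n).-1%:R * (s + 1 / 2))).
Proof.
rewrite pow2E -[leLHS]lnK ?posrE// ler_expR mulNr lerNr -mulrA.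
rewrite -ler_pdivlMr// /level/= truncn_le// divr_ge0 ?(ltW c0)//.
by rewrite oppr_ge0 ln_le0.
Qed.

End level_bounds.

Lemma level_antitone s s' n : 0 <= s -> s <= s' -> 0 < tau n -> tau n <= 1 ->
  (level s' n <= level s n)%N.
Proof.
move=> s0 ss t0 t1; rewrite /level ltnS; apply: le_truncn.
rewrite ler_wpM2l// ?oppr_ge0 ?ln_le0// lef_pV2 ?posrE//.
- by rewrite ler_wpM2r ?(ltW ln2_gt0)// lerD2r.
- by apply: mulr_gt0; [lra|exact: ln2_gt0].
- by apply: mulr_gt0; [lra|exact: ln2_gt0].
Qed.

Lemma near_level_gt s (j : nat) : 0 <= s -> \forall n \near \oo, (j < level s n)%N.
Proof.
move=> s0; near=> n.
have n3 : 1 <= ln n%:R :> R by near: n; exact: near_ln_ge1.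
have t0 := tau_gt0 n3.
have t1 : tau n < 1 by near: n; exact: tau_small.
have tj : tau n < 2 `^ (- (j%:R * (s + 1 / 2))).
  by near: n; apply: tau_small; exact: powR_gt0.
have := le_lt_trans (level_le_tau s0 t0) tj.
rewrite !pow2E ltr_expR ltr_pM2r ?ln2_gt0// ltrN2 ltr_pM2r; last lra.
by rewrite ltr_nat.
Unshelve. all: by end_near. Qed.

(** The predecessor level satisfies 2^(J-1) tau^2 <= 1, whereas n tau^2 = ln n >= 1. Hence only O(n)
    coefficients are estimated. *)
Lemma level_pow_le s n : 0 <= s -> 1 <= ln n%:R :> R -> tau n <= 1 ->
  2 ^+ level s n <= 2 * n%:R :> R.
Proof.
move=> s0 n3 t1; have t0 := tau_gt0 n3.
have n0 : (0 < n)%N.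
  by rewrite lt0n; apply/negP => /eqP n0; move: n3; rewrite n0 ln0// ler10.
rewrite [level s n]/level exprS ler_wpM2l// -[Num.truncn _]/((level s n).-1).
set j := (level s n).-1.
have h := tau_le_level s0 t0 t1; rewrite -/j in h.
have h2 : tau n <= 2 `^ (- (j%:R / 2)).
  rewrite (le_trans h)// ler_pow2 lerN2 ler_wpM2l//; lra.
have h3 : tau n ^+ 2 * 2 ^+ j <= 1.
  have E : (2 `^ (- (j%:R / 2))) ^+ 2 * 2 ^+ j = 1 :> R.
    rewrite -(@powR_mulrn _ _ 2 (powR_ge0 2 _)) -powRrM.
    rewrite -(@powR_mulrn _ 2 j)// -powRD ?pnatr_eq0 ?implybT//.
    by rewrite (_ : _ + _ = 0) ?powRr0//; field.
  rewrite -[leRHS]E ler_wpM2r ?exprn_ge0//.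
  by rewrite ler_pXn2r// nnegrE ?powR_ge0// ltW.
have h4 := @tau_sqr R _ n0.
have t2 : 0 < tau n ^+ 2 by rewrite exprn_gt0.
rewrite -(ler_pM2r t2) h4; apply: le_trans n3.
by rewrite mulrC.
Qed.

End resolution_levels.

Section concentration.
Context {R : realType} (W : wavelet_system R) (hW : cdv_system W).
Variables (e : nat + nat * nat -> R -> R) (B : R).
Hypothesis he : regular_basis W e B.
Variables (m : model R) (smin : R).
Hypothesis hm : model_ok m smin.
Local Notation j0 := (wj0 W).
Local Notation tau := (@tau R).

Definition est_error n (M : R) : R := est_const W B m smin * (1 + M) * tau n.

Definition bad_event n (M : R) (f : R -> R) : set (n.-tuple R) :=
  [set y | exists2 i, i \in idxs W (level smin n) &
     est_error n M < `|est e m i y - theta W f i|].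

Let B0 : 0 <= B. Proof. by have [] := he. Qed.

Lemma size_idxs J : (size (idxs W J) <= 2 ^ j0 + 2 ^ J)%N.
Proof.
have sum_pow j k : (2 ^ j + sumn [seq 2 ^ l | l <- iota j k] = 2 ^ (j + k))%N.
  elim: k j => [|k ih] j; first by rewrite addn0 /= addn0.
  by rewrite /= addnA addnn -mul2n -expnS ih addSnnS.
rewrite size_cat size_map size_iota leq_add2l size_allpairs_dep.
under eq_map do rewrite size_iota.
have [JJ|/ltnW JJ] := leqP J j0.
  by rewrite (eqnP JJ).
rewrite -[X in (_ <= 2 ^ X)%N](subnKC JJ) -sum_pow.
exact: leq_addl.
Qed.

(** Below the finest level 2^(l/2) <= tau^(-1/(2 smin + 1)), so the product is at most of order
    tau^a with a = 1 - 1/(2 smin + 1) > 0. This makes [tau] an admissible Chernoff exponent for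
    every coefficient in use. *)
Lemma near_basis_bound :
  \forall n \near \oo, forall i, i \in idxs W (level smin n) ->
    tau n * basis_bound B i <= 1 / 2.
Proof.
have smin0 := model_ok_gt0 hm.
pose a := 1 - 1 / (2 * smin + 1).
have a0 : 0 < a by rewrite subr_gt0 ltr_pdivrMr ?mul1r; lra.
pose d : R := (2 * (B + 1))^-1.
have d0 : 0 < d by rewrite invr_gt0; have := B0; lra.
near=> n.
have n3 : 1 <= ln n%:R :> R by near: n; exact: near_ln_ge1.
have t0 := tau_gt0 n3.
have t1 : tau n < 1 by near: n; exact: tau_small.
have td : tau n < d by near: n; exact: tau_small.
have ta : tau n < d `^ a^-1 by near: n; apply: tau_small; exact: powR_gt0.
have tB x : 0 <= x -> x <= d -> x * B <= 1 / 2.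
  move=> x0 xd; apply: (@le_trans _ _ (d * (B + 1))).
    by rewrite ler_pM//; lra.
  by rewrite /d invfM -mulrA mulVf ?mulr1; [lra|rewrite gt_eqF//; have := B0; lra].
move=> [k|[l k]]; rewrite mem_idxs /basis_bound/= => h.
  by rewrite mulr1 tB ?ltW.
have lJ : (l <= (level smin n).-1)%N by move: h => /andP[_].
rewrite mulrCA mulrC tB//.
  by rewrite mulr_ge0 ?powR_ge0 ?ltW.
apply: (@le_trans _ _ (tau n `^ a)); last first.
  rewrite -[leRHS]powRr1 ?(ltW d0)// -[X in d `^ X](mulVf (lt0r_neq0 a0)) powRrM.
  by apply: ge0_ler_powR; rewrite ?nnegrE ?powR_ge0//; exact: ltW.
have h1 := tau_le_level (ltW smin0) t0 (ltW t1).
have h2 : tau n `^ (1 / (2 * smin + 1)) <= 2 `^ (- (l%:R / 2)).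
  have c0 : 0 <= 1 / (2 * smin + 1) by rewrite divr_ge0//; lra.
  apply: (@le_trans _ _ ((2 `^ (- ((level smin n).-1%:R * (smin + 1 / 2)))) `^ (1 / (2 * smin + 1)))).
    by apply: ge0_ler_powR; rewrite ?nnegrE ?powR_ge0//; exact: ltW.
  rewrite -powRrM ler_pow2.
  rewrite (_ : - (_ * (smin + 1 / 2)) * _ = - ((level smin n).-1%:R / 2)); last first.
    by field; lra.
  by rewrite lerN2 ler_pM2r// ler_nat.
have tn0 : tau n != 0 by rewrite gt_eqF.
rewrite /a powRB ?tn0 ?implybT// powRr1 ?(ltW t0)//.
rewrite ler_wpM2l ?(ltW t0)// -[leLHS]invrK -powRN lef_pV2 ?posrE ?powR_gt0//.
Unshelve. all: by end_near. Qed.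

Definition bad_prob n : R := (2 ^+ j0.+1 + 4) / n%:R.

(** The threshold on [n] precedes [s], [M] and [f]: all dependence on [M] sits in the size of the
    error. *)
Lemma bad_event_small : \forall n \near \oo,
  forall s M f, smin <= s -> Cs W s M f -> in_model m f ->
    measurable (@bad_event n M f : set (n.-tuple (measurableTypeR R))) /\
    (data_law m f n (@bad_event n M f) <= (bad_prob n)%:E)%E.
Proof.
have smin0 := model_ok_gt0 hm.
near=> n => s M f ss Cf fm.
have n3 : 1 <= ln n%:R :> R by near: n; exact: near_ln_ge1.
have t1 : tau n < 1 by near: n; exact: tau_small.
have n0 : (0 < n)%N.
  by rewrite lt0n; apply/negP => /eqP n0; move: n3; rewrite n0 ln0// ler10.
have nR : 1 <= n%:R :> R by rewrite ler1n.
have hb : forall i, i \in idxs W (level smin n) -> tau n * basis_bound B i <= 1 / 2.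
  by near: n; exact: near_basis_bound.
have [|i iJ|mb hbad] := @union_bound _ _ R (data_law m f n) _ (idxs W (level smin n))
  (fun i => [set y | est_error n M < `|est e m i y - theta W f i|])
  (2 * expR (- (3 * ln n%:R))).
- move=> i _; apply: measurable_lt_set => //; apply: measurableT_comp => //.
  by apply: measurable_funB => //; exact: (measurable_est he).
- exact: (est_tail hW he hm n0 n3 (hb _ iJ) (idxsP iJ) ss Cf fm).
split => //; apply: (le_trans hbad); rewrite lee_fin.
have -> : expR (- (3 * ln n%:R)) = (n%:R ^+ 3)^-1 :> R.
  by rewrite expRN (expRM_natl 3) lnK// posrE; lra.
have hs : (size (idxs W (level smin n)))%:R <= 2 ^+ j0 + 2 * n%:R :> R.
  apply: (@le_trans _ _ (2 ^ j0 + 2 ^ level smin n)%:R); first by rewrite ler_nat size_idxs.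
  by rewrite natrD !natrX lerD2l level_pow_le// ltW.
apply: (@le_trans _ _ ((2 ^+ j0 + 2 * n%:R) * (2 * (n%:R ^+ 3)^-1))).
  by rewrite ler_wpM2r// mulr_ge0// invr_ge0 exprn_ge0.
have A0 : 0 <= 2 ^+ j0 :> R by rewrite exprn_ge0.
rewrite /bad_prob [2 ^+ j0.+1]exprS; set A := 2 ^+ j0 in A0 *.
set N : R := n%:R in nR *.
have -> : (A + 2 * N) * (2 * (N ^+ 3)^-1) = (2 * A + 4 * N) / N ^+ 2 / N.
  by field; lra.
rewrite ler_wpM2r ?invr_ge0//.
have N1 : 1 <= N ^+ 2 by rewrite exprn_ege1.
have N2 : N <= N ^+ 2 by rewrite expr2 ler_peMr//; lra.
rewrite ler_pdivrMr ?(lt_le_trans ltr01)//.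
have := ler_wpM2l A0 N1; rewrite mulr1 => h1.
have -> : (2 * A + 4) * N ^+ 2 = 2 * (A * N ^+ 2) + 4 * N ^+ 2 by ring.
by move: N2 h1; set X := A * N ^+ 2; set Y := N ^+ 2; lra.
Unshelve. all: by end_near. Qed.

Lemma near_bad_prob (d : R) : 0 < d -> \forall n \near \oo, bad_prob n < d.
Proof.
move=> d0; near=> n.
have nR : (2 ^+ j0.+1 + 4) / d < n%:R by near: n; exact: near_natr_gt.
have c0 : 0 < 2 ^+ j0.+1 + 4 :> R by rewrite ltr_wpDl// exprn_ge0.
have n0 : 0 < n%:R :> R by apply: lt_trans nR; rewrite divr_gt0.
by rewrite /bad_prob ltr_pdivrMr// mulrC -ltr_pdivrMr.
Unshelve. all: by end_near. Qed.

End concentration.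

(** * The adaptive band *)

Section adaptive_band.
Context {R : realType} (W : wavelet_system R) (hW : cdv_system W).
Variables (e : nat + nat * nat -> R -> R) (B : R).
Hypothesis he : regular_basis W e B.
Variables (smin smax eps C : R) (rho : nat).
Hypotheses (smin0 : 0 < smin) (sminmax : smin <= smax) (heps : 0 < eps < 1)
  (C0 : 0 <= C).
Local Notation j0 := (wj0 W).
Local Notation I01 := (`[0, 1]%classic : set R).
Local Notation tau := (@tau R).
Implicit Types (th : nat + nat * nat -> R) (n : nat) (s M : R).

Definition err n M : R := C * (1 + M) * tau n.

Definition low_idxs := block_idxs W j0 (rho * j0).
Definition wlow : R := 2 `^ ((rho * j0)%:R * (smax + 1 / 2)).
Definition nlow : R := (size low_idxs)%:R.
Definition klow : R := 2 * wlow / eps * nlow.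
(** A sum in place of a maximum; the two agree up to the fixed factor [nlow]. *)
Definition low_sum th : R := \sum_(i <- low_idxs) `|th i|.

(** For the true coefficients, self-similarity gives M <= (wlow / eps) low_sum. Estimating them
    costs nlow C (1 + M) tau; since klow C tau <= 1, the part proportional to M is at most M / 2,
    and solving for M doubles the rest. *)
Definition Mhat n th : R := 2 * wlow / eps * (low_sum th + nlow * C * tau n).
(** An average of coefficients that are at most M, lowered by a bound on the error. If it is
    negative, as may happen for small M, no level is verified when rho > 0 and the series is kept up
    to the finest level. *)
Definition Mlow n th : R := low_sum th / nlow - err n (Mhat n th).

(* verified n th J certifies 2^(- J (s + 1/2)) <= tau n, without knowledge of
   the smoothness s: otherwise self-similarity provides, in every window
   [j, rho * j], a coefficient of size at least eps M tau^(l / J). *)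
Definition verified n th (J : nat) : Prop :=
  exists j, [/\ (j0 < j)%N, (rho * j < level smin n)%N &
    forall l k, (j <= l <= rho * j)%N -> (k < 2 ^ l)%N ->
      `|th (inr (l, k))| + err n (Mhat n th) <
      eps * Mlow n th * tau n `^ (l%:R / J%:R)].

(** Equals 1 until a verified level is met and 0 from there on; a product of indicators keeps
    measurability simple. The search starts at [level smax n] because certificates are sound only
    for s < smax, and from this level on truncation is harmless for s = smax. *)
Definition gate n th (l : nat) : R :=
  \prod_(level smax n <= J < l.+1) (if `[< verified n th J >] then 0 else 1).

Definition centre n th : R -> R := fun x =>
  \sum_(0 <= k < 2 ^ j0) th (inl k) * e (inl k) x +
  \sum_(j0 <= l < level smin n)
    gate n th l * \sum_(0 <= k < 2 ^ l) th (inr (l, k)) * e (inr (l, k)) x.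

Definition krad : R := 2 * tail_const B smin + C * B.

(** The last factor is comparable to 2^(J/2) for the truncation level J. The 2 in [krad] is the
    price of this comparison in the bias. *)
Definition radius n th : R := krad * (1 + Mhat n th) * tau n *
  (1 + \sum_(0 <= l < level smin n) gate n th l * 2 `^ (l%:R / 2)).

Definition large n : Prop := [/\ 0 < tau n, tau n < 1,
  (rho * j0 < level smin n)%N, (j0 < level smax n)%N & klow * C * tau n <= 1].

Definition close n M th f : Prop :=
  forall i, i \in idxs W (level smin n) -> `|th i - theta W f i| <= err n M.

Let eps0 : 0 < eps. Proof. by case/andP: heps. Qed.

Lemma centre_continuous n th : continuous (centre n th).
Proof.
have [_ ce _ _ _] := he; move=> x; apply: cvgD.
  by apply: continuous_sum => k z; apply: cvgM; [exact: cvg_cst|exact: ce].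
apply: continuous_sum => l z; apply: cvgM; first exact: cvg_cst.
by apply: continuous_sum => k y; apply: cvgM; [exact: cvg_cst|exact: ce].
Qed.

Lemma near_large : \forall n \near \oo, large n.
Proof.
have kC : 0 < klow * C + 1.
  rewrite ltr_wpDl// mulr_ge0// mulr_ge0// divr_ge0 ?(ltW eps0)//.
  by rewrite mulr_ge0 ?powR_ge0.
near=> n.
have n3 : 1 <= ln n%:R :> R by near: n; exact: near_ln_ge1.
have t0 := tau_gt0 n3; split => //.
- by near: n; exact: tau_small.
- by near: n; apply: near_level_gt; exact: ltW.
- by near: n; apply: near_level_gt; exact: le_trans (ltW smin0) sminmax.
- have tk : tau n < (klow * C + 1)^-1.
    by near: n; apply: tau_small; rewrite invr_gt0.
  apply: (@le_trans _ _ ((klow * C + 1) * tau n)).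
    by rewrite ler_wpM2r ?(ltW t0)// lerDl.
  by rewrite -[leRHS](mulfV (lt0r_neq0 kC)) ler_wpM2l ?(ltW kC)// ltW.
Unshelve. all: by end_near. Qed.

Lemma nlow_ge1 : 1 <= nlow.
Proof.
rewrite /nlow ler1n -has_predT; apply/hasP; exists (inl 0%N) => //.
by rewrite mem_block_idxs eqxx expn_gt0.
Qed.

Lemma wlow_ge1 : 1 <= wlow.
Proof.
rewrite /wlow -[leLHS](powRr0 2) ler_pow2 mulr_ge0//.
by move: smin0 sminmax; lra.
Qed.

Lemma klow_ge2 : 2 <= klow.
Proof.
have h1 := nlow_ge1; have h2 := wlow_ge1; case/andP: heps => e0 e1.
have h3 : 1 <= eps^-1 by rewrite invf_ge1// ltW.
rewrite /klow -!mulrA -[leLHS]mulr1 ler_wpM2l//.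
have h4 : 1 <= wlow * eps^-1 by rewrite -[leLHS]mulr1 ler_pM.
by rewrite mulrA -[leLHS]mulr1 ler_pM.
Qed.

Section deterministic.
Variables (n : nat) (f : R -> R) (th : nat + nat * nat -> R) (s M : R).
Hypotheses (lgn : large n) (ss : smin <= s <= smax) (M0 : 0 < M).
Hypothesis (Cf : self_similar W smax eps rho s M f).
Hypothesis (hth : close n M th f).

Let CsF : Cs W s M f. Proof. by case: Cf. Qed.
Let t0 : 0 < tau n. Proof. by case: lgn. Qed.
Let t1 : tau n < 1. Proof. by case: lgn. Qed.
Let s0 : 0 < s. Proof. by case/andP: ss => h _; exact: lt_le_trans h. Qed.

Lemma theta_le_M i : basis_idx W i -> `|theta W f i| <= M.
Proof.
case: i => [k kj|[l k] /= /andP[jl kl]]; first exact: (Cs_alpha CsF).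
rewrite (le_trans (Cs_beta CsF jl kl))// ler_piMr ?(ltW M0)//.
rewrite -[leRHS](powRr0 2) ler_pow2 oppr_le0 mulr_ge0//.
by move: s0; lra.
Qed.

(** The lower bound uses the window at [j0], the only one available for s = smax too; [wlow]
    dominates its weights since s <= smax. *)
Lemma low_sum_theta : eps * M <= wlow * low_sum (theta W f) /\
  low_sum (theta W f) <= nlow * M.
Proof.
split; last first.
  rewrite /low_sum /nlow -sum1_size natr_sum mulr_suml big_seq [leRHS]big_seq.
  by apply: ler_sum => i iL; rewrite mul1r; exact: theta_le_M (block_idxsP (leqnn _) iL).
have [_ /(_ j0 (leqnn _) (or_intror erefl)) h] := Cf.
have [a aL ha] := block_large_coef hW (leqnn _) (mulr_gt0 eps0 M0) h.
apply: (le_trans ha); apply: ler_pM => //.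
- by case: (a) => [k|[l k]] //=; rewrite powR_ge0.
- case: a aL {ha} => [k|[l k]] aL /=; first exact: wlow_ge1.
  move: aL; rewrite mem_block_idxs => /andP[/andP[_ /= lj] _].
  rewrite /wlow ler_pow2 ler_pM//; first by move: s0; lra.
    by rewrite ler_nat.
  by case/andP: ss => _; rewrite lerD2r.
- rewrite /low_sum (bigD1_seq a)//= ?block_idxs_uniq//.
  by rewrite lerDl sumr_ge0.
Qed.

Lemma low_idxs_sub i : i \in low_idxs -> i \in idxs W (level smin n).
Proof.
move=> iL; rewrite mem_idxs; have /basis_idxP -> := block_idxsP (leqnn _) iL.
case: i iL => // -[l k]; rewrite mem_block_idxs => /andP[/andP[_ /= lj] _].
by have [_ _ h _ _] := lgn; exact: leq_ltn_trans lj h.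
Qed.

Lemma low_sum_close : `|low_sum th - low_sum (theta W f)| <= nlow * err n M.
Proof.
rewrite /low_sum -sumrB (le_trans (ler_norm_sum _ _ _))//.
rewrite /nlow -sum1_size natr_sum mulr_suml big_seq [leRHS]big_seq.
apply: ler_sum => i iL; rewrite mul1r (le_trans (ler_dist_dist _ _))//.
exact/hth/low_idxs_sub.
Qed.

Lemma Ctau_le1 : C * tau n <= 1.
Proof.
have [_ _ _ _ h] := lgn; apply: le_trans h; rewrite -mulrA ler_peMl//.
  by rewrite mulr_ge0// ltW.
by have := klow_ge2; lra.
Qed.

Let e0 := eps0.
Let w1 := wlow_ge1.
Let n1 := nlow_ge1.

Lemma M_le_Mhat : M <= Mhat n th.
Proof.
have [h1 _] := low_sum_theta; have := low_sum_close.
rewrite ler_norml => /andP[h2 _].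
have [_ _ _ _ h3] := lgn.
have hM : M <= wlow / eps * low_sum (theta W f).
  by rewrite mulrAC ler_pdivlMr// mulrC.
have we0 : 0 <= wlow / eps by rewrite divr_ge0 ?(ltW e0)//; move: w1; lra.
have h4 : wlow / eps * low_sum (theta W f) <=
    wlow / eps * (low_sum th + nlow * err n M) by rewrite ler_wpM2l//; lra.
have h5 : klow * C * tau n * M <= M by rewrite ler_piMl// ltW.
have -> : Mhat n th = 2 * (wlow / eps * (low_sum th + nlow * err n M)) - klow * C * tau n * M.
  by rewrite /Mhat /err /klow; ring.
lra.
Qed.

Lemma Mhat_le : Mhat n th <= 2 * klow * (1 + M).
Proof.
have [_ h1] := low_sum_theta; have := low_sum_close.
rewrite ler_norml => /andP[_ h2].
have we0 : 0 <= 2 * wlow / eps by rewrite divr_ge0 ?(ltW e0)//; move: w1; lra.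
have c1 := Ctau_le1.
have h3 : low_sum th + nlow * C * tau n <= nlow * (2 * (1 + M)).
  have : nlow * err n M + nlow * C * tau n = nlow * ((2 + M) * (C * tau n)).
    by rewrite /err; ring.
  have : nlow * ((2 + M) * (C * tau n)) <= nlow * (2 + M).
    by rewrite ler_wpM2l ?ler_piMr//; move: M0 n1; lra.
  have -> : nlow * (2 * (1 + M)) = nlow * M + nlow * (2 + M) by ring.
  lra.
apply: (le_trans (ler_wpM2l we0 h3)).
by rewrite /klow le_eqVlt; apply/orP; left; apply/eqP; ring.
Qed.

Lemma Mlow_le : Mlow n th <= M.
Proof.
have [_ h1] := low_sum_theta; have := low_sum_close.
rewrite ler_norml => /andP[_ h2].
have n0 : 0 < nlow by move: n1; lra.
rewrite /Mlow lerBlDr ler_pdivrMr//.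
have h3 : err n M <= err n (Mhat n th).
  by rewrite ler_wpM2r ?(ltW t0)// ler_wpM2l// lerD2l M_le_Mhat.
have h4 := ler_wpM2l (ltW n0) h3.
have -> : (M + err n (Mhat n th)) * nlow = nlow * M + nlow * err n (Mhat n th) by ring.
lra.
Qed.

Lemma err_le_Mhat : err n M <= err n (Mhat n th).
Proof. by rewrite ler_wpM2r ?(ltW t0)// ler_wpM2l// lerD2l M_le_Mhat. Qed.

(** If tau were below 2^(-J(s+1/2)), its power l / J would be at most 2^(-l(s+1/2)). The certificate
    would then contradict the large coefficient of its window: [err_le_Mhat] and [Mlow_le] put both
    estimated constants on the safe side. *)
Lemma verified_sound (J : nat) : s < smax -> (0 < J)%N -> verified n th J ->
  2 `^ (- (J%:R * (s + 1 / 2))) <= tau n.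
Proof.
move=> s_lt J0 [j [jj rj hj]]; rewrite leNgt; apply/negP => tJ.
have [_ /(_ j (ltnW jj) (or_introl s_lt)) h] := Cf.
have [[k|[l k]]] := block_large_coef hW (ltnW jj) (mulr_gt0 eps0 M0) h.
  (* A window starting strictly above [j0] contains no scaling coefficient. *)
  by rewrite mem_block_idxs => /andP[/eqP jE]; rewrite jE ltnn in jj.
rewrite mem_block_idxs => /andP[/= jl kl] ha.
have JR : 0 < J%:R :> R by rewrite ltr0n.
have iJ : inr (l, k) \in idxs W (level smin n).
  rewrite mem_idxs /=; case/andP: jl => jl lj.
  rewrite (leq_trans (ltnW jj) jl) kl/=; exact: leq_ltn_trans lj rj.
have h1 := hj l k jl kl; have h2 := hth iJ.
have h3 : `|theta W f (inr (l, k))| <= `|th (inr (l, k))| + err n M.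
  have := ler_dist_dist (theta W f (inr (l, k))) (th (inr (l, k))).
  have := ler_norm (`|theta W f (inr (l, k))| - `|th (inr (l, k))|).
  rewrite distrC in h2; lra.
have h4 := err_le_Mhat.
have tl : tau n `^ (l%:R / J%:R) <= 2 `^ (- (l%:R * (s + 1 / 2))).
  apply: (@le_trans _ _ ((2 `^ (- (J%:R * (s + 1 / 2)))) `^ (l%:R / J%:R))).
    by apply: ge0_ler_powR; rewrite ?nnegrE ?divr_ge0 ?powR_ge0//; exact: ltW.
  rewrite -powRrM ler_pow2 le_eqVlt; apply/orP; left; apply/eqP; field.
  by rewrite gt_eqF.
have h5 : eps * Mlow n th * tau n `^ (l%:R / J%:R) <= eps * M * 2 `^ (- (l%:R * (s + 1 / 2))).
  apply: (@le_trans _ _ (eps * M * tau n `^ (l%:R / J%:R))).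
    by rewrite ler_wpM2r ?powR_ge0// ler_wpM2l ?(ltW e0)// Mlow_le.
  by rewrite ler_wpM2l// mulr_ge0 ?ltW.
have : eps * M * 2 `^ (- (l%:R * (s + 1 / 2))) <= `|theta W f (inr (l, k))|.
  by rewrite powRN ler_pdivrMr ?powR_gt0// [leRHS]mulrC.
lra.
Qed.

(** [Jh] is the least level from [level smax n] on that is verified or finest; the gate is the
    indicator of the levels below it. *)
Lemma stopping_level : exists Jh, [/\ (level smax n <= Jh <= level smin n)%N,
   (forall l, (l < level smin n)%N -> gate n th l = (l < Jh)%:R),
   Jh = level smin n \/ verified n th Jh &
   forall J, (level smax n <= J)%N -> verified n th J -> (Jh <= J)%N].
Proof.
have lev : (level smax n <= level smin n)%N.
  by apply: level_antitone => //; exact: ltW.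
pose p J := (level smax n <= J)%N && ((J == level smin n) || `[< verified n th J >]).
have ex : exists J, p J by exists (level smin n); rewrite /p lev eqxx.
case: (ex_minnP ex) => Jh /andP[lJ hJ] Jmin.
have JhJ : (Jh <= level smin n)%N by apply: Jmin; rewrite /p lev eqxx.
exists Jh; split.
- by rewrite lJ.
- move=> l ll; rewrite /gate; case: ltnP => [lJh|Jhl].
    rewrite big_nat_cond big1// => J /andP[/andP[J1 J2] _].
    case: asboolP => // vJ; have : p J by rewrite /p J1; apply/orP; right; exact/asboolP.
    by move=> /Jmin; rewrite leqNgt (leq_trans J2 lJh).
  case/orP: hJ => [/eqP E|vJ]; first by move: Jhl; rewrite E leqNgt ll.
  rewrite (@big_cat_nat _ _ _ Jh)//=; last exact: leqW.
  by rewrite [X in _ * X]big_ltn ?ltnS// vJ mul0r mulr0.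
- by case/orP: hJ => [/eqP|/asboolP]; [left|right].
- by move=> J lJ' vJ; apply: Jmin; rewrite /p lJ'/=; apply/orP; right; exact/asboolP.
Qed.

Lemma gate_sum Jh : (Jh <= level smin n)%N ->
    (forall l, (l < level smin n)%N -> gate n th l = (l < Jh)%:R) ->
  forall (a : nat) (F : nat -> R), (a <= Jh)%N ->
  \sum_(a <= l < level smin n) gate n th l * F l = \sum_(a <= l < Jh) F l.
Proof.
move=> JhJ hg a F aJ; rewrite (@big_cat_nat _ _ _ Jh)//=.
rewrite [X in _ + X]big_nat_cond [X in _ + X]big1 ?addr0; last first.
  by move=> l /andP[/andP[l1 l2] _]; rewrite hg// ltnNge l1 mul0r.
rewrite big_nat_cond [RHS]big_nat_cond; apply: eq_bigr => l /andP[/andP[l1 l2] _].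
by rewrite hg ?l2 ?mul1r//; exact: leq_trans l2 JhJ.
Qed.

(** Bias and noise are both of order tau 2^(Jh/2): the former as 2^(-Jh s) = 2^(-Jh(s+1/2))
    2^(Jh/2), the latter by summing 2^(l/2) over the kept levels. *)
Lemma band_covers x : I01 x -> `|f x - centre n th x| <= radius n th.
Proof.
move=> x01; have [Jh [/andP[J1 J2] hg hJ _]] := stopping_level.
have [_ _ _ jl _] := lgn.
have jJ : (j0 <= Jh)%N by exact: leq_trans (ltnW jl) J1.
have J0 : (0 < Jh)%N by apply: leq_trans J1.
have s_min : smin <= s by case/andP: ss.
have Jtau : 2 `^ (- (Jh%:R * (s + 1 / 2))) <= tau n.
  have mono J s' : s' <= s -> (J <= Jh)%N -> 0 <= s' ->
      2 `^ (- (Jh%:R * (s + 1 / 2))) <= 2 `^ (- (J%:R * (s' + 1 / 2))) :> R.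
    move=> s's JJh s'0; rewrite ler_pow2 lerN2 ler_pM//; [lra|by rewrite ler_nat|lra].
  (* The finest level suffices for every s >= smin, a verified level is sound for s < smax, and s =
     smax is covered by Jh >= [level smax n]. *)
  case: hJ => [E|vJ].
    apply: le_trans (level_le_tau (ltW smin0) t0).
    by apply: mono => //; [rewrite E|exact: ltW].
  have [s_lt|s_ge] := ltP s smax; first exact: verified_sound.
  apply: le_trans (level_le_tau (le_trans (ltW smin0) sminmax) t0).
  by apply: mono => //; exact: le_trans (ltW smin0) sminmax.
rewrite /centre /radius !(gate_sum J2 hg)//.
set G := 1 + \sum_(0 <= l < Jh) 2 `^ (l%:R / 2).
have G_ge : 2 `^ (Jh%:R / 2) <= 2 * G.
  rewrite /G -[in X in _ <= X](prednK J0) big_nat_recr//=.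
  have : 0 <= \sum_(0 <= i < Jh.-1) 2 `^ (i%:R / 2) :> R.
    by apply: sumr_ge0 => i _; exact: powR_ge0.
  have : 2 `^ (Jh%:R / 2) <= 2 * 2 `^ (Jh.-1%:R / 2) :> R.
    have -> : 2 * 2 `^ (Jh.-1%:R / 2) = 2 `^ (1 + Jh.-1%:R / 2) :> R.
      by rewrite powRD ?pnatr_eq0 ?implybT// powRr1.
    rewrite ler_pow2.
    by rewrite -{1}(prednK J0) -natr1; lra.
  lra.
have T0 := tail_const_ge0 he smin0.
have B0 : 0 <= B by have [] := he.
have err0 : 0 <= err n M.
  by rewrite mulr_ge0 ?(ltW t0)// mulr_ge0//; move: M0; lra.
have bias : `|f x - partial_sum W e f Jh x| <= 2 * tail_const B smin * M * tau n * G.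
  apply: (le_trans (series_tail_unif hW he smin0 s_min CsF jJ x01)).
  have -> : 2 `^ (- (Jh%:R * s)) = 2 `^ (- (Jh%:R * (s + 1 / 2))) * 2 `^ (Jh%:R / 2) :> R.
    by rewrite -powRD ?pnatr_eq0 ?implybT//; congr (_ `^ _); ring.
  rewrite [leRHS](_ : _ = tail_const B smin * M * (tau n * (2 * G))); last by ring.
  apply: ler_wpM2l; first exact: mulr_ge0 T0 (ltW M0).
  by apply: ler_pM; rewrite ?powR_ge0.
have stoch : `|partial_sum W e f Jh x - (\sum_(0 <= k < 2 ^ j0) th (inl k) * e (inl k) x +
     \sum_(j0 <= l < Jh) \sum_(0 <= k < 2 ^ l) th (inr (l, k)) * e (inr (l, k)) x)|
   <= err n M * B * G.
  rewrite /partial_sum big_idxs opprD addrACA -!sumrB.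
  rewrite (le_trans (ler_normD _ _))// /G mulrDr mulr1 lerD//.
    under eq_bigr do rewrite -mulrBl.
    apply: (coarse_bound he) => // k kj; rewrite distrC; apply: hth.
    by rewrite mem_idxs /= kj.
  under eq_bigr do rewrite -sumrB.
  apply: (@le_trans _ _ (err n M * B * \sum_(j0 <= l < Jh) 2 `^ (l%:R / 2))); last first.
    apply: ler_wpM2l; first exact: mulr_ge0.
    rewrite [leRHS](@big_cat_nat _ _ _ j0)//= lerDr.
    by apply: sumr_ge0 => i _; exact: powR_ge0.
  rewrite (le_trans (ler_norm_sum _ _ _))// mulr_sumr.
  apply: ler_sum_nat => l /andP[l1 l2].
  under eq_bigr do rewrite -mulrBl.
  rewrite -mulrA; apply: (level_bound he) => // k kl; rewrite distrC; apply: hth.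
  by rewrite mem_idxs /= l1 kl/= (leq_trans l2 J2).
rewrite -[f x](subrK (partial_sum W e f Jh x)) -addrA.
apply: (le_trans (ler_normD _ _)); apply: (le_trans (lerD bias stoch)).
have G0 : 0 <= G by apply: addr_ge0 => //; apply: sumr_ge0 => i _; exact: powR_ge0.
rewrite -mulrDl ler_wpM2r// /krad.
apply: (@le_trans _ _ ((2 * tail_const B smin + C * B) * (1 + M) * tau n)).
  rewrite /err -subr_ge0 [leRHS](_ : _ = 2 * tail_const B smin * tau n); last by ring.
  by rewrite mulr_ge0 ?(ltW t0)// mulr_ge0.
have kr0 : 0 <= 2 * tail_const B smin + C * B.
  by apply: addr_ge0; apply: mulr_ge0.
rewrite ler_wpM2r ?(ltW t0)//; apply: ler_wpM2l => //.
by rewrite lerD2l M_le_Mhat.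
Qed.

End deterministic.

End adaptive_band.

(** * Order of the radius on a fixed class *)

Section radius_rate.
Context {R : realType} (W : wavelet_system R) (hW : cdv_system W).
Variables (e : nat + nat * nat -> R -> R) (B : R).
Hypothesis he : regular_basis W e B.
Variables (smin smax eps C : R) (rho : nat).
Hypotheses (smin0 : 0 < smin) (sminmax : smin <= smax) (heps : 0 < eps < 1)
  (hrho : (0 < rho)%N) (C0 : 0 <= C).
Local Notation j0 := (wj0 W).
Local Notation tau := (@tau R).
Local Notation err := (err C).
Local Notation Mhat := (Mhat W smax eps C rho).
Local Notation Mlow := (Mlow W smax eps C rho).
Local Notation large := (large W smin smax eps C rho).
Local Notation close := (close W smin C).
Local Notation wlow := (wlow W smax rho).
Local Notation nlow := (nlow W rho).
Local Notation klow := (klow W smax eps rho).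
Local Notation verified := (verified W smin smax eps C rho).
Local Notation radius := (radius W B smin smax eps C rho).

Variables (s M : R).
Hypotheses (ss : smin <= s <= smax) (M0 : 0 < M).

Let err_unit : R := C * (1 + 2 * klow * (1 + M)).
Let Mlow_bound : R := eps * M / (2 * wlow * nlow).

Let s0 : 0 < s. Proof. by case/andP: ss => h _; exact: lt_le_trans h. Qed.
Let e0 : 0 < eps. Proof. by case/andP: heps. Qed.
Let w1 : 1 <= wlow. Proof. exact: wlow_ge1 smin0 sminmax. Qed.
Let n1 : 1 <= nlow. Proof. exact: nlow_ge1. Qed.
Let k2 : 2 <= klow. Proof. exact: klow_ge2 smin0 sminmax heps. Qed.
Let eu0 : 0 <= err_unit.
Proof.
apply: mulr_ge0 => //; apply: addr_ge0 => //; apply: mulr_ge0.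
  by move: k2; lra.
by move: M0; lra.
Qed.
Let Mlow0 : 0 < Mlow_bound.
Proof.
rewrite divr_gt0// ?mulr_gt0//; first by move: w1; lra.
by move: n1; lra.
Qed.

Lemma err_Mhat_le n f th : large n -> self_similar W smax eps rho s M f ->
  close n M th f -> err n (Mhat n th) <= err_unit * tau n.
Proof.
move=> lgn Cf hth; have [t0 _ _ _ _] := lgn.
rewrite ler_wpM2r ?(ltW t0)//; apply: ler_wpM2l => //; rewrite lerD2l.
exact: (Mhat_le hW smin0 sminmax heps C0 lgn ss M0 Cf hth).
Qed.

(** The average true low coefficient is at least twice [Mlow_bound]; the estimation error and the
    subtracted error together cost at most one half of it. *)
Lemma Mlow_ge n f th : large n -> self_similar W smax eps rho s M f ->
    close n M th f -> 2 * (err_unit * tau n) <= Mlow_bound ->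
  Mlow_bound <= Mlow n th.
Proof.
move=> lgn Cf hth small.
have h1 := err_Mhat_le lgn Cf hth.
have h2 := err_le_Mhat hW smin0 sminmax heps C0 lgn ss M0 Cf hth.
have [h3 _] := low_sum_theta hW smin0 sminmax heps ss M0 Cf.
have := low_sum_close lgn hth; rewrite ler_norml => /andP[h4 _].
have w0 : 0 < wlow by move: w1; lra.
have n0 : 0 < nlow by move: n1; lra.
have h5 : 2 * Mlow_bound <= low_sum W rho (theta W f) / nlow.
  rewrite ler_pdivlMr// -(ler_pM2l w0) /Mlow_bound.
  apply: le_trans h3; rewrite le_eqVlt; apply/orP; left; apply/eqP; field.
  by rewrite !gt_eqF.
have h6 : low_sum W rho (theta W f) / nlow - err n M <= low_sum W rho th / nlow.
  rewrite ler_pdivlMr// mulrBl divfK ?gt_eqF//.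
  by rewrite (mulrC _ nlow); lra.
rewrite /Mlow; lra.
Qed.

(** At level J + c the threshold tau^(l/(J+c)) exceeds 2^(-l(s+1/2)) by at least the factor
    2^(l(s+1/2)c/(J+c)). In the chosen window l >= J/(4 rho), so with c = 16 rho c' <= J this factor
    is at least 2^c', which beats the ratio K5 / K6 of the constants. *)
Lemma verified_complete : exists c : nat, \forall n \near \oo, forall f th,
  self_similar W smax eps rho s M f -> close n M th f ->
  verified n th (level s n + c)%N.
Proof.
pose K5 := M + 2 * err_unit; pose K6 := eps * Mlow_bound.
have K50 : 0 < K5 by rewrite /K5; move: M0 eu0; lra.
have K60 : 0 < K6 by rewrite mulr_gt0.
have [c' hc'] : exists c' : nat, K5 < K6 * 2 ^+ c'.
  exists (Num.truncn (K5 / K6)).+1.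
  rewrite -ltr_pdivrMl// mulrC (lt_trans (truncnS_gt _))// -natrX ltr_nat.
  exact: ltn_expl.
have [c cE] : exists c : nat, c = (16 * rho * c')%N by exists (16 * rho * c')%N.
exists c; near=> n => f th Cf hth.
have lgn : large n by near: n; exact: (near_large W rho smin0 sminmax heps C0).
have [t0 t1 _ _ _] := lgn.
have Jc : (c < level s n)%N by near: n; apply: near_level_gt; exact: ltW.
have Jj : (2 * rho * j0.+1 < level s n)%N by near: n; apply: near_level_gt; exact: ltW.
have te : 2 * (err_unit * tau n) <= Mlow_bound.
  have td : tau n < Mlow_bound / (2 * err_unit + 1).
    by near: n; apply: tau_small; rewrite divr_gt0//; move: eu0; lra.
  rewrite ltr_pdivlMr in td; last by move: eu0; lra.
  have := mulr_ge0 eu0 (ltW t0); move: td t0; lra.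
have hMl := Mlow_ge lgn Cf hth te.
have hE := err_Mhat_le lgn Cf hth.
have hE2 := err_le_Mhat hW smin0 sminmax heps C0 lgn ss M0 Cf hth.
have [J JE] : exists J, J = level s n by exists (level s n).
rewrite -JE in Jc Jj *.
(* The window [j, rho j] stays at levels up to J / 2, where the error, of order [tau], is dominated
   by 2^(-l(s+1/2)). *)
pose j := (J %/ (2 * rho))%N.
have r0 : (0 < 2 * rho)%N by rewrite muln_gt0.
have jj0 : (j0 < j)%N by rewrite /j leq_divRL// mulnC ltnW.
have jJ : (j * (2 * rho) <= J)%N by exact: leq_trunc_div.
have J4 : (J <= 4 * rho * j)%N.
  apply: (@leq_trans (j.+1 * (2 * rho))); first exact/ltnW/ltn_ceil.
  apply: (@leq_trans (j.*2 * (2 * rho))).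
    have j2 : (j.+1 <= j.*2)%N by rewrite -addnn -[leqLHS]addn1 leq_add2l (leq_ltn_trans _ jj0).
    by rewrite leq_mul2r j2 orbT.
  by rewrite -muln2 leq_eqVlt; apply/orP; left; apply/eqP; ring.
have J0 : (0 < J)%N by apply: leq_ltn_trans Jc.
have rjJ : (rho * j < J)%N.
  rewrite -(ltn_pmul2l (isT : 0 < 2)%N) mulnA mulnC; apply: (leq_ltn_trans jJ).
  by rewrite mul2n -addnn -{1}(addn0 J) ltn_add2l.
have Jlev : (J <= level smin n)%N.
  by rewrite JE; apply: level_antitone => //; [exact: ltW|case/andP: ss|exact: ltW].
exists j; split => //; first exact: leq_trans rjJ Jlev.
move=> l k /andP[jl lj] kl.
have lJ : (l <= J.-1)%N by rewrite -ltnS prednK//; exact: leq_ltn_trans lj rjJ.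
have iJ : inr (l, k) \in idxs W (level smin n).
  rewrite mem_idxs /= (leq_trans (ltnW jj0) jl) kl/=.
  exact: leq_ltn_trans lj (leq_trans rjJ Jlev).
have CsF : Cs W s M f by case: Cf.
have hb := Cs_beta CsF (leq_trans (ltnW jj0) jl) kl.
pose b : R := 2 `^ (- (l%:R * (s + 1 / 2))).
have b0 : 0 < b by exact: powR_gt0.
have tb : tau n <= b.
  apply: (le_trans (tau_le_level (ltW s0) t0 (ltW t1))).
  rewrite -JE ler_pow2 lerN2 ler_wpM2r ?ler_nat//.
  by move: s0; lra.
have hl : `|th (inr (l, k))| + err n (Mhat n th) <= K5 * b.
  have h1 := hth _ iJ.
  have h2 := ler_dist_dist (th (inr (l, k))) (theta W f (inr (l, k))).
  have h3 := ler_norm (`|th (inr (l, k))| - `|theta W f (inr (l, k))|).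
  have h4 : err_unit * tau n <= err_unit * b by rewrite ler_wpM2l.
  rewrite -/b in hb; rewrite /K5 mulrDl; lra.
apply: (le_lt_trans hl).
apply: (@lt_le_trans _ _ (K6 * tau n `^ (l%:R / (J + c)%:R))); last first.
  by rewrite ler_wpM2r ?powR_ge0// ler_wpM2l// ltW.
have JcR : 0 < (J + c)%:R :> R by rewrite ltr0n addn_gt0 J0.
have tp : 2 `^ (- (J%:R * (s + 1 / 2))) <= tau n.
  by rewrite JE; apply: level_le_tau => //; exact: ltW.
apply: (@lt_le_trans _ _ (K6 * (2 `^ (- (J%:R * (s + 1 / 2)))) `^ (l%:R / (J + c)%:R))); last first.
  rewrite ler_wpM2l ?(ltW K60)//.
  by apply: ge0_ler_powR; rewrite ?nnegrE ?divr_ge0 ?powR_ge0//; exact: ltW.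
rewrite -powRrM.
have -> : - (J%:R * (s + 1 / 2)) * (l%:R / (J + c)%:R) =
   - (l%:R * (s + 1 / 2)) + l%:R * (s + 1 / 2) * (c%:R / (J + c)%:R) :> R.
  by rewrite natrD; field; rewrite -natrD gt_eqF.
rewrite powRD ?pnatr_eq0 ?implybT// -/b mulrCA [ltLHS]mulrC ltr_pM2l//.
apply: (lt_le_trans hc'); rewrite ler_wpM2l ?(ltW K60)// -powR_mulrn// ler_pow2.
have l4 : J%:R <= 4 * rho%:R * l%:R :> R.
  apply: (@le_trans _ _ (4 * rho * j)%:R); first by rewrite ler_nat.
  by rewrite -!natrM ler_nat leq_mul2l jl orbT.
have cR : c%:R = 16 * rho%:R * c'%:R :> R by rewrite cE !natrM.
have cJ : c%:R <= J%:R :> R by rewrite ler_nat ltnW.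
have rR : 0 < rho%:R :> R by rewrite ltr0n.
rewrite mulrA ler_pdivlMr// natrD cR.
have x0 : 0 <= c'%:R :> R by [].
have h1 : c'%:R * (J%:R + c%:R) <= c'%:R * (2 * (4 * rho%:R * l%:R)) :> R.
  by rewrite ler_wpM2l//; lra.
rewrite cR in h1; apply: (le_trans h1).
have h2 : l%:R * (1 / 2) <= l%:R * (s + 1 / 2) by rewrite ler_wpM2l//; move: s0; lra.
have h4 := ler_wpM2r (mulr_ge0 (mulr_ge0 (ler0n R 16) (ltW rR)) x0) h2.
apply: le_trans h4; rewrite le_eqVlt; apply/orP; left; apply/eqP; field.
Unshelve. all: by end_near. Qed.

(** Stopping at most [c] levels above [level s n] makes 2^(Jh/2) of order at most tau^(-1/(2s+1)),
    and multiplication by tau gives the exponent 2s/(2s+1). *)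
Lemma radius_rate : exists2 L : R, 0 < L & \forall n \near \oo, forall f th,
  self_similar W smax eps rho s M f -> close n M th f ->
  radius n th <= L * tau n `^ (2 * s / (2 * s + 1)).
Proof.
have [c hc] := verified_complete.
have r1 : 0 < 2 `^ (1 / 2) - 1 :> R.
  by rewrite subr_gt0 -[ltLHS](powRr0 2) !pow2E ltr_expR ltr_pM2r ?ln2_gt0//; lra.
have B0 : 0 <= B by have [] := he.
have T0 := tail_const_ge0 he smin0.
have kr0 : 0 <= krad B smin C by rewrite addr_ge0// mulr_ge0.
(* The exponent has c + 1 and not c because [tau_le_level] controls the predecessor of
   [level s n]. *)
pose Q : R := (1 + 1 / (2 `^ (1 / 2) - 1)) * 2 `^ (c.+1%:R / 2).
pose P : R := krad B smin C * (1 + 2 * klow * (1 + M)).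
have P0 : 0 <= P.
  apply: mulr_ge0 => //; apply: addr_ge0 => //; apply: mulr_ge0; last by move: M0; lra.
  by move: k2; lra.
have Q0 : 0 <= Q.
  by rewrite mulr_ge0 ?powR_ge0// addr_ge0// divr_ge0// ltW.
exists (P * Q + 1); first by rewrite ltr_wpDl// mulr_ge0.
near=> n.
have hv : forall f th, self_similar W smax eps rho s M f -> close n M th f ->
    verified n th (level s n + c)%N by near: n; exact: hc.
move=> f th Cf hth; have vc := hv f th Cf hth.
have lgn : large n by near: n; exact: (near_large W rho smin0 sminmax heps C0).
have [t0 t1 _ _ _] := lgn.
have [Jh [/andP[J1 J2] hg _ hmin]] := stopping_level smin0 sminmax th lgn.
have Jc : (Jh <= level s n + c)%N.
  apply: hmin => //; apply: leq_trans (leq_addr _ _).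
  by apply: level_antitone => //; [exact: ltW|case/andP: ss|exact: ltW].
rewrite /radius (gate_sum J2 hg)//.
have MhatB := Mhat_le hW smin0 sminmax heps C0 lgn ss M0 Cf hth.
have hMh : 0 <= Mhat n th.
  by apply: le_trans (ltW M0) (M_le_Mhat hW smin0 sminmax heps lgn ss M0 Cf hth).
set G := 1 + \sum_(0 <= l < Jh) 2 `^ (l%:R / 2).
have one_le (x : R) : 0 <= x -> 1 <= 2 `^ x :> R.
  by move=> x0; rewrite -[leLHS](powRr0 2) ler_pow2.
have Gle : G <= (1 + 1 / (2 `^ (1 / 2) - 1)) * 2 `^ (Jh%:R / 2).
  have powE (l : nat) : 2 `^ (l%:R / 2) = (2 `^ (1 / 2)) ^+ l :> R.
    by rewrite -powR_mulrn ?powR_ge0// -powRrM; congr (_ `^ _); ring.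
  rewrite /G mulrDl mul1r lerD ?one_le//.
  have r1' : 1 < 2 `^ (1 / 2) :> R by move: r1; rewrite subr_gt0.
  have := geometric_sum_gt1 0 Jh r1'; rewrite -powE.
  under [X in X <= _ -> _]eq_bigr do rewrite -powE.
  by move=> gs; rewrite mul1r [leRHS]mulrC.
have level_half : 2 `^ ((level s n).-1%:R / 2) <= tau n `^ (- (1 / (2 * s + 1))).
  have h := tau_le_level (ltW s0) t0 (ltW t1).
  have c0 : 0 <= 1 / (2 * s + 1) by rewrite divr_ge0//; move: s0; lra.
  have h2 : tau n `^ (1 / (2 * s + 1)) <= 2 `^ (- ((level s n).-1%:R / 2)).
    apply: (@le_trans _ _ ((2 `^ (- ((level s n).-1%:R * (s + 1 / 2)))) `^ (1 / (2 * s + 1)))).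
      by apply: ge0_ler_powR; rewrite ?nnegrE ?powR_ge0//; exact: ltW.
    rewrite -powRrM le_eqVlt; apply/orP; left; apply/eqP; congr (_ `^ _).
    by field; move: s0; lra.
  by rewrite powRN -[leLHS]invrK -powRN lef_pV2 ?posrE ?powR_gt0.
have Jhalf : 2 `^ (Jh%:R / 2) <= 2 `^ (c.+1%:R / 2) * tau n `^ (- (1 / (2 * s + 1))).
  apply: (@le_trans _ _ (2 `^ (c.+1%:R / 2) * 2 `^ ((level s n).-1%:R / 2))); last first.
    by rewrite ler_wpM2l ?powR_ge0.
  rewrite -powRD ?pnatr_eq0 ?implybT// ler_pow2 -mulrDl ler_wpM2r//.
  by rewrite -natrD ler_nat (leq_trans Jc)// addSnnS prednK// addnC.
have tn0 : tau n != 0 by rewrite gt_eqF.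
have tE : tau n `^ (2 * s / (2 * s + 1)) = tau n * tau n `^ (- (1 / (2 * s + 1))).
  transitivity (tau n `^ 1 * tau n `^ (- (1 / (2 * s + 1)))).
    rewrite -powRD ?tn0 ?implybT//; congr (_ `^ _).
    by field; move: s0; lra.
  by rewrite powRr1// ltW.
have key : tau n * G <= Q * tau n `^ (2 * s / (2 * s + 1)).
  have A0 : 0 <= 1 + 1 / (2 `^ (1 / 2) - 1) :> R by rewrite addr_ge0// divr_ge0// ltW.
  have h := le_trans Gle (ler_wpM2l A0 Jhalf).
  rewrite tE; apply: le_trans (ler_wpM2l (ltW t0) h) _.
  by rewrite /Q le_eqVlt; apply/orP; left; apply/eqP; ring.
rewrite -mulrA; apply: (@le_trans _ _ (P * (tau n * G))).
  apply: ler_wpM2r.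
    apply: mulr_ge0; first exact: ltW.
    by apply: addr_ge0 => //; apply: sumr_ge0 => i _; exact: powR_ge0.
  by apply: ler_wpM2l => //; rewrite lerD2l.
apply: (le_trans (ler_wpM2l P0 key)); rewrite mulrA ler_wpM2r ?powR_ge0//.
by rewrite lerDl.
Unshelve. all: by end_near. Qed.

End radius_rate.

(** * Measurability and coverage *)

Section measurability_of_the_band.
Context {R : realType} (W : wavelet_system R).
Variables (e : nat + nat * nat -> R -> R) (B : R).
Hypothesis he : regular_basis W e B.
Variables (m : model R) (smin smax eps C : R) (rho n : nat).
Local Notation I01 := (`[0, 1]%classic : set R).
Local Notation data := (n.-tuple (measurableTypeR R)).

Let th (y : n.-tuple R) (i : nat + nat * nat) : R := est e m i y.

Let mth i : measurable_fun [set: data] (fun y => th y i).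
Proof. exact: (measurable_est he). Qed.

Let mlow : measurable_fun [set: data] (fun y => low_sum W rho (th y)).
Proof. by apply: measurable_sum => i; apply: measurableT_comp => //; exact: mth. Qed.

Let mMhat : measurable_fun [set: data] (fun y => Mhat W smax eps C rho n (th y)).
Proof. by apply: measurable_funM => //; exact: measurable_funD. Qed.

Let merr : measurable_fun [set: data]
  (fun y => err C n (Mhat W smax eps C rho n (th y))).
Proof.
apply: measurable_funM => //; apply: measurable_funM => //.
exact: measurable_funD.
Qed.

Let mMlow : measurable_fun [set: data] (fun y => Mlow W smax eps C rho n (th y)).
Proof. by apply: measurable_funB => //; exact: measurable_funM. Qed.

Let verified_set J : set data := [set y | verified W smin smax eps C rho n (th y) J].

Let mverified J : measurable (verified_set J).
Proof.
pose Q l k : set data := [set y |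
  `|th y (inr (l, k))| + err C n (Mhat W smax eps C rho n (th y)) <
  eps * Mlow W smax eps C rho n (th y) * tau n `^ (l%:R / J%:R)].
have -> : verified_set J =
    \bigcup_(j in [set j | (wj0 W < j)%N && (rho * j < level smin n)%N])
    \bigcap_(l in [set l | (j <= l <= rho * j)%N])
    \bigcap_(k in [set k | (k < 2 ^ l)%N]) Q l k.
  apply/seteqP; split => y /=.
    by move=> [j [j1 j2 h]]; exists j; [rewrite /= j1 j2|move=> l hl k hk; exact: h].
  by move=> [j /andP[j1 j2] h]; exists j; split => // l k hl hk; exact: (h l hl k hk).
apply: bigcup_measurable => j _; apply: bigcap_measurableType => l _.
apply: bigcap_measurableType => k _; apply: measurable_lt_set.
  by apply: measurable_funD => //; apply: measurableT_comp => //; exact: mth.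
by apply: measurable_funM => //; apply: measurable_funM.
Qed.

Let mgate l : measurable_fun [set: data] (fun y => gate W smin smax eps C rho n (th y) l).
Proof.
apply: measurable_prod => J _.
rewrite (_ : (fun y => _) = \1_(~` verified_set J)).
  by apply: measurable_indic; exact: measurableC.
apply/funext => y; rewrite indicE in_setC.
case: asboolP => v; first by rewrite mem_set.
by rewrite memNset.
Qed.

Lemma measurable_centre x : measurable_fun [set: data]
  (fun y => centre W e smin smax eps C rho n (th y) x).
Proof.
apply: measurable_funD.
  by apply: measurable_sum => k; apply: measurable_funM => //; exact: mth.
apply: measurable_sum => l; apply: measurable_funM; first exact: mgate.
by apply: measurable_sum => k; apply: measurable_funM => //; exact: mth.
Qed.

Lemma measurable_radius : measurable_fun [set: data]
  (fun y => radius W B smin smax eps C rho n (th y)).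
Proof.
apply: measurable_funM.
  apply: measurable_funM => //; apply: measurable_funM => //.
  exact: measurable_funD.
apply: measurable_funD => //; apply: measurable_sum => l.
by apply: measurable_funM => //; exact: mgate.
Qed.

End measurability_of_the_band.

Section noncoverage.
Context {R : realType}.
Local Notation I01 := (`[0, 1]%classic : set R).

Lemma sup_norm_le (g : R -> R) (r : R) :
  (sup_norm g <= r%:E)%E <-> forall x, I01 x -> `|g x| <= r.
Proof.
split=> [h x x01|h].
  by rewrite -lee_fin (le_trans _ h)//; apply: ereal_sup_ubound; exists x.
by apply: ge_ereal_sup => _ [x x01 <-]; rewrite lee_fin h.
Qed.

(** Noncoverage is an uncountable union over points; by continuity an exceedance at [x] persists on
    an interval and hence occurs at a rational point of [0, 1]. *)
Lemma measurable_noncoverage d (T : measurableType d) (fhat : T -> R -> R)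
    (rad : T -> R) (f : R -> R) :
    measurable_fun setT rad ->
    (forall x, I01 x -> measurable_fun setT (fhat ^~ x)) ->
    (forall y, {within I01, continuous (fhat y)}) ->
    {within I01, continuous f} ->
  measurable [set y | ~ band (fhat y) (rad y) f].
Proof.
move=> mrad mfhat cfhat cf.
have -> : [set y | ~ band (fhat y) (rad y) f] = \bigcup_(q : rat)
    (if ratr q \in I01 then [set y | rad y < `|f (ratr q) - fhat y (ratr q)|] else set0).
  apply/seteqP; split => y /=; last first.
    move=> [q _]; case: ifPn => // /set_mem q01 /= h [_] /sup_norm_le /(_ _ q01).
    by rewrite leNgt h.
  move=> nb; have : exists2 x, I01 x & rad y < `|f x - fhat y x|.
    apply: contrapT => nex; apply: nb; split => //; apply/sup_norm_le => x x01.
    by rewrite leNgt; apply/negP => h; apply: nex; exists x.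
  move=> [x x01 hx].
  have ch : {within I01, continuous (fun x => f x - fhat y x)}.
    by move=> z; apply: cvgB; [exact: cf|exact: cfhat].
  have gap : 0 < `|f x - fhat y x| - rad y by rewrite subr_gt0.
  have [r r0 hr] := within_continuous_dist ch x01 gap.
  have [a [b [a0 ab b1 hab]]] := unit_subinterval x01 r0.
  have [q] := rat_in_itvoo ab; rewrite in_itv/= => /andP[aq qb].
  have q01 : I01 (ratr q) by rewrite /= in_itv/=; apply/andP; split; lra.
  exists q => //; rewrite mem_set//=.
  have qr : `|x - ratr q| < r by apply: hab; rewrite !ltW.
  have h1 := hr _ q01 qr.
  have := ler_norm (`|f x - fhat y x| - `|f (ratr q) - fhat y (ratr q)|).
  have := ler_dist_dist (f x - fhat y x) (f (ratr q) - fhat y (ratr q)).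
  lra.
apply: bigcupT_measurable_rat => q; case: ifPn => [/set_mem q01|_] //.
apply: measurable_lt_set => //; apply: measurableT_comp => //.
by apply: measurable_funB => //; exact: mfhat.
Qed.

Lemma sup_prob_le (F : set (R -> R)) (p : (R -> R) -> \bar R) (c : R) : 0 <= c ->
  (forall f, F f -> (p f <= c%:E)%E) -> (sup_prob F p <= c%:E)%E.
Proof.
move=> c0 h; rewrite /sup_prob ge_max lee_fin c0/=.
by apply: ge_ereal_sup => _ [f Ff <-]; exact: h.
Qed.

Lemma limn_esup_le (u : nat -> \bar R) (c : \bar R) :
  (\forall n \near \oo, (u n <= c)%E) -> (limn_esup u <= c)%E.
Proof.
move=> [N _ hN]; apply: (@le_trans _ _ (ereal_sup (u @` [set n | (N <= n)%N]))).
  by apply: ereal_inf_lbound; exists [set n | (N <= n)%N] => //; exists N.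
by apply: ge_ereal_sup => _ [n Nn <-]; exact: hN.
Qed.

Lemma rateE (s : R) n : 1 <= ln n%:R :> R -> 0 < s ->
  rate s n = tau n `^ (2 * s / (2 * s + 1)).
Proof.
move=> n3 s0; have l0 : 0 < ln n%:R :> R by lra.
have n0 : 0 < n%:R :> R.
  by rewrite ltr0n lt0n; apply/negP => /eqP n0; move: n3; rewrite n0 ln0// ler10.
have q0 : 0 < ln n%:R / n%:R :> R by exact: divr_gt0.
rewrite /rate /tau -powR12_sqrt ?(ltW q0)// -powRrM.
have -> : n%:R / ln n%:R = (ln n%:R / n%:R) `^ (-1) :> R.
  by rewrite powR_inv1 ?(ltW q0)// invf_div.
by rewrite -powRrM; congr (_ `^ _); field; lra.
Qed.

End noncoverage.

Theorem theorem3p6 (R : realType) (W : wavelet_system R)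
    (hW : cdv_system W)
    (smax eps : R) (rho : nat)
    (hsmax : 0 < smax < (wN W)%:R) (heps : 0 < eps < 1) (hrho : (0 < rho)%N)
    (gamma : R) (hgamma : 0 < gamma < 1)
    (m : model R) (smin : R) (hm : model_ok m smin) (hsmin : smin <= smax) :
  let C0 := fun s M : R => self_similar W smax eps rho s M `&` in_model m in
  let F := [set f | exists s M : R,
                      [/\ smin <= s <= smax, 0 < M & C0 s M f]] in
  exists (fhat : forall n, n.-tuple R -> R -> R)
         (rad : forall n, n.-tuple R -> R),
    [/\ estimators fhat rad,
        (limn_esup (fun n : nat =>
           sup_prob F (fun f =>
             data_law m f n [set y | ~ band (fhat n y) (rad n y) f]))
         <= gamma%:E)%E &
        forall s M : R, smin <= s <= smax -> 0 < M ->
          exists2 L : R, 0 < L &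
            (fun n : nat =>
               sup_prob (C0 s M) (fun f =>
                 data_law m f n
                   [set y | rad n y > L * M `^ (1 / (2 * s + 1))
                                      / (2 `^ s - 1) * rate s n]))
            @ \oo --> 0%E].
Proof.
move=> C0 F; have smin0 := model_ok_gt0 hm.
have [e [B he]] := regular_basis_exists hW.
pose C := est_const W B m smin.
have Cge0 : 0 <= C := est_const_ge0 he hm.
pose th n (y : n.-tuple R) (i : nat + nat * nat) : R := est e m i y.
pose fhat n (y : n.-tuple R) := centre W e smin smax eps C rho n (th n y).
pose rad n (y : n.-tuple R) := radius W B smin smax eps C rho n (th n y).
have cfhat n y : {within `[0, 1]%classic, continuous (fhat n y)}.
  by apply: continuous_subspaceT => x; exact: (centre_continuous he).
have mrad n : measurable_fun [set: n.-tuple (measurableTypeR R)] (rad n).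
  exact: (measurable_radius he).
have mfhat n x : measurable_fun [set: n.-tuple (measurableTypeR R)] (fun y => fhat n y x).
  exact: (measurable_centre he).
have not_bad n M f (y : n.-tuple R) : ~ bad_event W e B m smin M f y ->
    close W smin C n M (th n y) f.
  by move=> nb i iJ; rewrite leNgt; apply/negP => h; apply: nb; exists i.
have bad0 n : 0 <= bad_prob W n by rewrite divr_ge0// addr_ge0// exprn_ge0.
exists fhat, rad; split.
- by move=> n; split.
- apply: limn_esup_le; near=> n.
  have bs : forall s M f, smin <= s -> Cs W s M f -> in_model m f ->
      measurable (@bad_event _ W e B m smin n M f : set (n.-tuple (measurableTypeR R))) /\
      (data_law m f n (@bad_event _ W e B m smin n M f) <= (bad_prob W n)%:E)%E.
    by near: n; exact: (bad_event_small hW he hm).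
  have lgn : large W smin smax eps C rho n by near: n; exact: near_large.
  apply: (@le_trans _ _ (bad_prob W n)%:E); last first.
    rewrite lee_fin; apply: ltW; near: n; apply: near_bad_prob.
    by case/andP: hgamma.
  apply: sup_prob_le => // f [s [M [ss M0 [Cf fm]]]].
  have CsF : Cs W s M f by case: Cf.
  have [mb pb] := bs s M f (andP ss).1 CsF fm.
  apply: le_trans pb; apply: le_measure; rewrite ?inE//.
    apply: (measurable_noncoverage (mrad n) (fun x _ => mfhat n x) (cfhat n)).
    by case: CsF.
  move=> y /= nb; apply: contrapT => /not_bad hc; apply: nb; split; first by case: CsF.
  by apply/sup_norm_le => x x01; exact: (band_covers hW he smin0 hsmin heps Cge0 lgn ss M0 Cf hc).
- move=> s M ss M0; have s0 : 0 < s by case/andP: ss => h _; exact: lt_le_trans h.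
  have [L0 L00 hL] := radius_rate hW he smin0 hsmin heps hrho Cge0 ss M0.
  have Ms : 0 < M `^ (1 / (2 * s + 1)) by exact: powR_gt0.
  have s21 : 0 < 2 `^ s - 1 :> R.
    by rewrite subr_gt0 -[ltLHS](powRr0 2) !pow2E ltr_expR ltr_pM2r ?ln2_gt0.
  (* [L] may depend on [s] and [M], so it is chosen to cancel the explicit factors of the statement,
     leaving [L0] times the rate. *)
  exists (L0 * (2 `^ s - 1) / M `^ (1 / (2 * s + 1))).
    by rewrite divr_gt0// mulr_gt0.
  apply: (@squeeze_cvge _ _ _ _ (cst 0%E) _ (fun n => (bad_prob W n)%:E)).
  + near=> n; apply/andP; split; first by rewrite /sup_prob le_max lexx.
    have bs : forall s M f, smin <= s -> Cs W s M f -> in_model m f ->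
      measurable (@bad_event _ W e B m smin n M f : set (n.-tuple (measurableTypeR R))) /\
      (data_law m f n (@bad_event _ W e B m smin n M f) <= (bad_prob W n)%:E)%E.
      by near: n; exact: (bad_event_small hW he hm).
    have hLn : forall f th, self_similar W smax eps rho s M f ->
        close W smin C n M th f -> radius W B smin smax eps C rho n th <=
          L0 * tau n `^ (2 * s / (2 * s + 1)).
      by near: n; exact: hL.
    have n3 : 1 <= ln n%:R :> R by near: n; exact: near_ln_ge1.
    apply: sup_prob_le => // f [Cf fm].
    have CsF : Cs W s M f by case: Cf.
    have [mb pb] := bs s M f (andP ss).1 CsF fm.
    apply: le_trans pb; apply: le_measure; rewrite ?inE//.
      exact: (measurable_lt_set (measurable_cst _) (mrad n)).
    move=> y /=; rewrite divfK ?gt_eqF// mulfK ?gt_eqF// rateE// => h.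
    apply: contrapT => /not_bad /(hLn f _ Cf).
    by rewrite leNgt h.
  + exact: cvg_cst.
  + apply/fine_cvgP; split; first by near=> n.
    apply/cvgr0Pnorm_lt => d d0; near=> n.
    rewrite /= ger0_norm//; near: n; exact: near_bad_prob.
Unshelve. all: by end_near.
Qed.
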